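(* Let $\mathcal{M}=(V,E,F)$ be a $G$-vertex-reversing map with $G$ solvable and $|V|,|F|\geq 3$. Let $\chi$ be the Euler characteristic of $\mathcal{M}$ and let $\Gamma$ be its underlying graph. If $\gcd(\chi,|E|)=1$, then one of the following holds. (1) $G\cong \mathrm{D}_{2n}$ for some $n$, $\mathcal{M}$ is a $G$-bireversing map, and there exist integers $j,k$ such that $\gcd(j,k,n)=1$, $d=\gcd(j,n)\geq 3$, $\Gamma\cong \mathbf{C}_d^{(n/d)}$, and $\chi=\gcd(j,n)+\gcd(2k-j,n)-n$. In addition, $\mathcal{M}$ is orientable if and only if $\gcd(j,2k,n)=2$. (2) $\mathcal{M}$ is a $G$-reversing map and one of the following holds: (a) $G\cong \mathrm{D}_{2n}$ with $n$ even, $\Gamma\cong \mathbf{C}_{n/2}^{(2)}$, $\chi=1$, and $\mathcal{M}$ is non-orientable; (b) $G\cong \mathrm{D}_{2n}$ for some $n$, there exist integers $j,k$ with $\gcd(j,k,n)=1$ and $d=\gcd(j,n)\geq 3$ such that $\Gamma\cong \mathbf{C}_d^{(n/d)}$ and $\chi=\gcd(j,n)+\gcd(k,n)+\gcd(j-k,n)-n$, and $\mathcal{M}$ is orientable; (c) $G\cong \mathrm{D}_{2m}\times \mathrm{D}_{2n}$, where $m,n>1$ are coprime odd integers, $\Gamma\cong \mathbf{C}_m^{(2n)}$ or $\Gamma\cong \mathbf{C}_m\times \mathbf{C}_n$, $\chi=m+n-mn$, and $\mathcal{M}$ is non-orientable; (d) $G\cong \mathbb{Z}_{mn\ell}{:}\mathbb{Z}_2^2$,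 where $m,n,\ell>1$ are pairwise coprime odd integers, $\Gamma\cong(\mathbf{C}_m\times \mathbf{C}_n)^{(\ell)}$, $\chi=mn+m\ell+n\ell-2mn\ell$, and $\mathcal{M}$ is non-orientable; (e) $G\cong \mathbb{Z}_{3^f s}.\mathrm{S}_4$, where $f\geq 0$ and $s\geq1$ are integers with $\gcd(6,s)=1$, $\Gamma$ is isomorphic to one of $\mathbf{K}_4^{(2\cdot 3^f\cdot s)}$, $\mathbf{C}_{3^{f+1}s}[\overline{\mathbf{K}_2}]$, $\mathbf{C}_{3^{f+1}s}^{(4)}$, $\chi=4-3^{f+1}\cdot s$, and $\mathcal{M}$ is non-orientable.
   Context: All groups, graphs and maps are finite. A map $\mathcal{M}=(V,E,F)$ is a 2-cell embedding of a connected graph $\Gamma$ (the underlying graph; multiple edges allowed, no loops or semi-edges) in a closed surface, with vertex set $V$, edge set $E$, face set $F$; its Euler characteristic is $|V|-|E|+|F|$; it is orientable if the surface is. An arc is an incident pair (vertex, edge); a flag is a mutually incident triple (vertex, edge, face). An automorphism is a permutation of the flags preserving incidence. For $G\leq\mathrm{Aut}(\mathcal{M})$, $\mathcal{M}$ is $G$-vertex-reversing if $G$ acts regularly on the arcs and, for a vertex $\alpha$, the stabilizer $G_\alpha$ is dihedral and acts regularly on the set of edges incident with $\alpha$. An arc-regular triple for a group $G$ is an ordered triple $(x,y,z)$ of involutions with $G=\langle x,y,z\rangle$ and $|G:\langle x,y\rangle|\geq 3$. Notation: $y^z=z^{-1}yz$, $[G:H]$ is the set of right cosets of $H$ in $G$.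 $\mathrm{RevMap}(G,x,y,z)$ and $\mathrm{BiRevMap}(G,x,y,z)$ are the maps with vertex set $[G:\langle x,y\rangle]$, edge set $[G:\langle z\rangle]$, and face set, respectively, the disjoint union of $[G:\langle x,z\rangle]$ and $[G:\langle y,z\rangle]$, and $[G:\langle x,y^z\rangle]$; two elements of different kinds are incident iff the cosets intersect. A $G$-reversing map (resp. $G$-bireversing map) is a map isomorphic to some $\mathrm{RevMap}(G,x,y,z)$ (resp. $\mathrm{BiRevMap}(G,x,y,z)$). It is known that every $G$-vertex-reversing map with $|V|,|F|\geq 3$ is of one of these two kinds, and that the map is orientable iff $|G:G^+|=2$, where $G^+=\langle xy,xz\rangle$ for $\mathrm{RevMap}$ and $G^+=\langle xy,z,xzy\rangle$ for $\mathrm{BiRevMap}$. $\mathrm{D}_{2n}$ is the dihedral group of order $2n$; $\mathrm{D}_4\cong\mathbb{Z}_2^2$. $A{:}B$ is a semidirect product with normal subgroup $A$; $A.B$ is an extension with normal subgroup $A$ and quotient $B$. $\mathbf{C}_n$ is the cycle on $n$ vertices, $\mathbf{K}_n$ the complete graph, $\overline{\mathbf{K}_2}$ the edgeless graph on 2 vertices. For a simple graph $\Sigma$, $\Sigma^{(\lambda)}$ is the multigraph obtained by replacing each edge by $\lambda$ parallel edges. The direct product $\Gamma_1\times\Gamma_2$ has vertex set $V_1\times V_2$ with $(u_1,u_2)\sim(v_1,v_2)$ iff $u_i\sim v_i$ for both $i=1,2$. The lexicographic product $\Gamma_1[\Gamma_2]$ has vertex set $V_1\times V_2$ with $(u_1,u_2)\sim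 (v_1,v_2)$ iff $u_1\sim v_1$, or $u_1=v_1$ and $u_2\sim v_2$. *)

(* Defs.v *)
From HB Require Import structures.
From mathcomp Require Import all_boot all_order all_algebra.
From mathcomp Require Import all_fingroup all_solvable.

Set Implicit Arguments.
Unset Strict Implicit.
Unset Printing Implicit Defensive.

Import Order.TTheory GRing.Theory Num.Theory.
Import GroupScope.

Record multigraph := MultiGraph {
  mg_vertex : finType;
  mg_edge : finType;
  mg_ends : mg_edge -> {set mg_vertex}
}.

Definition mg_iso (A B : multigraph) : Prop :=
  exists (f : mg_vertex A -> mg_vertex B) (h : mg_edge A -> mg_edge B),
    [/\ bijective f, bijective h &
        forall e, mg_ends (h e) = f @: mg_ends e].

Record sgraph := SGraph {
  sg_vertex :> finType;
  sg_adj : rel sg_vertex;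
  sg_sym : symmetric sg_adj;
  sg_irr : irreflexive sg_adj
}.

Definition sg_edges (S : sgraph) : {set {set S}} :=
  [set A | [exists u, exists v, sg_adj u v && (A == [set u; v])]].

(* The multigraph obtained from S by replacing each edge by lambda parallel
   edges. *)
Definition multiple (S : sgraph) (lambda : nat) : multigraph :=
  @MultiGraph S ({A : {set S} | A \in sg_edges S} * 'I_lambda)%type
    (fun e => sval e.1).

(* This is the n-cycle for n >= 3. *)
Definition cycle_adj (n : nat) : rel 'I_n := fun i j =>
  (i != j) && ((i.+1 == j %[mod n]) || (j.+1 == i %[mod n])).

Lemma cycle_adj_sym n : symmetric (@cycle_adj n).
Proof. by move=> i j; rewrite /cycle_adj eq_sym orbC. Qed.

Lemma cycle_adj_irr n : irreflexive (@cycle_adj n).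
Proof. by move=> i; rewrite /cycle_adj eqxx. Qed.

Definition cycle_graph (n : nat) : sgraph :=
  SGraph (@cycle_adj_sym n) (@cycle_adj_irr n).

Definition complete_adj (n : nat) : rel 'I_n := fun i j => i != j.

Lemma complete_adj_sym n : symmetric (@complete_adj n).
Proof. by move=> i j; rewrite /complete_adj eq_sym. Qed.

Lemma complete_adj_irr n : irreflexive (@complete_adj n).
Proof. by move=> i; rewrite /complete_adj eqxx. Qed.

Definition complete_graph (n : nat) : sgraph :=
  SGraph (@complete_adj_sym n) (@complete_adj_irr n).

Definition edgeless_adj (n : nat) : rel 'I_n := fun _ _ => false.

Definition edgeless_graph (n : nat) : sgraph :=
  @SGraph 'I_n (@edgeless_adj n) (fun _ _ => erefl) (fun _ => erefl).

Definition direct_adj (S T : sgraph) : rel (S * T) := fun a b =>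
  sg_adj a.1 b.1 && sg_adj a.2 b.2.

Lemma direct_adj_sym S T : symmetric (@direct_adj S T).
Proof. by move=> a b; rewrite /direct_adj sg_sym [sg_adj b.2 _]sg_sym. Qed.

Lemma direct_adj_irr S T : irreflexive (@direct_adj S T).
Proof. by move=> a; rewrite /direct_adj sg_irr. Qed.

Definition sg_direct (S T : sgraph) : sgraph :=
  SGraph (@direct_adj_sym S T) (@direct_adj_irr S T).

Definition lex_adj (S T : sgraph) : rel (S * T) := fun a b =>
  sg_adj a.1 b.1 || (a.1 == b.1) && sg_adj a.2 b.2.

Lemma lex_adj_sym S T : symmetric (@lex_adj S T).
Proof.
by move=> a b; rewrite /lex_adj sg_sym [sg_adj b.2 _]sg_sym [b.1 == _]eq_sym.
Qed.

Lemma lex_adj_irr S T : irreflexive (@lex_adj S T).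
Proof. by move=> a; rewrite /lex_adj !sg_irr andbF. Qed.

Definition sg_lex (S T : sgraph) : sgraph :=
  SGraph (@lex_adj_sym S T) (@lex_adj_irr S T).

Definition step (T : finType) (ts : seq (T -> T)) : rel T :=
  fun w w' => has (fun t => t w == w') ts.

(* A 2-cell embedding of a finite connected graph in a closed surface, given
   by the triangles of its barycentric subdivision, which are the flags.  The
   side of a triangle opposite to its vertex (resp. edge, face) corner is
   shared with exactly one other triangle, its image under t0 (resp. t1, t2):
   fixed points would be boundary points.  The vertices, edges and faces are
   the orbits of <t1,t2>, <t0,t2>, <t0,t1>, so that fv, fe, ff send a flag to
   its vertex, edge and face.  The t's are part of the data because in
   degenerate maps (e.g. when a face passes several times through a vertex)
   they are not determined by the incidence of vertices, edges and faces.
   [map_loopless] excludes loops and semi-edges. *)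
Record surface_map := SurfaceMap {
  vertex : finType;
  edge : finType;
  face : finType;
  flag : finType;
  fv : flag -> vertex;
  fe : flag -> edge;
  ff : flag -> face;
  t0 : flag -> flag;
  t1 : flag -> flag;
  t2 : flag -> flag;
  flag_inh : 0 < #|flag|;
  t0K : involutive t0;
  t1K : involutive t1;
  t2K : involutive t2;
  t02C : forall w, t0 (t2 w) = t2 (t0 w);
  t1_fpf : forall w, t1 w != w;
  t2_fpf : forall w, t2 w != w;
  map_loopless : forall w, fv (t0 w) != fv w;
  fv_surj : forall v, exists w, fv w == v;
  fe_surj : forall e, exists w, fe w == e;
  ff_surj : forall f, exists w, ff w == f;
  fvP : forall w w', fv w = fv w' <-> connect (step [:: t1; t2]) w w';
  feP : forall w w', fe w = fe w' <-> connect (step [:: t0; t2]) w w';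
  ffP : forall w w', ff w = ff w' <-> connect (step [:: t0; t1]) w w';
  map_connected : forall w w', connect (step [:: t0; t1; t2]) w w'
}.

Definition map_iso (M N : surface_map) : Prop :=
  exists f : flag M -> flag N,
    [/\ bijective f,
        forall w, f (t0 w) = t0 (f w),
        forall w, f (t1 w) = t1 (f w) &
        forall w, f (t2 w) = t2 (f w)].

Definition euler_char (M : surface_map) : int :=
  (#|vertex M|%:Z - #|edge M|%:Z + #|face M|%:Z)%R.

(* The triangles of the barycentric subdivision can be coherently oriented. *)
Definition orientable (M : surface_map) : Prop :=
  exists c : flag M -> bool, forall w,
    [/\ c (t0 w) = ~~ c w, c (t1 w) = ~~ c w & c (t2 w) = ~~ c w].

Definition incident_ve (M : surface_map) (v : vertex M) (e : edge M) : bool :=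
  [exists w, (fv w == v) && (fe w == e)].

Definition incident_ef (M : surface_map) (e : edge M) (f : face M) : bool :=
  [exists w, (fe w == e) && (ff w == f)].

Definition incident_vf (M : surface_map) (v : vertex M) (f : face M) : bool :=
  [exists w, (fv w == v) && (ff w == f)].

Lemma incident_vfE (M : surface_map) (v : vertex M) (f : face M) :
  incident_vf v f = [exists e, incident_ve v e && incident_ef e f].
Proof.
apply/existsP/existsP => [[w /andP[vw fw]]|[e /andP[]]].
  exists (fe w); apply/andP.
  by split; apply/existsP; exists w; rewrite ?vw ?fw eqxx.
case/existsP=> w /andP[/eqP<- /eqP<-] /existsP[u /andP[/eqP/feP + /eqP<-]].
have f0 (x : flag M) : ff (t0 x) = ff x.
  by apply/ffP/connect1; rewrite /step /= t0K eqxx.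
have v2 (x : flag M) : fv (t2 x) = fv x.
  by apply/fvP/connect1; rewrite /step /= t2K eqxx orbT.
case/connectP=> p + ->; suff: forall x, fv x \in [:: fv u; fv (t0 u)] ->
    fv (t0 x) \in [:: fv u; fv (t0 u)] -> path (step [:: @t0 M; @t2 M]) x p ->
    fv (last x p) \in [:: fv u; fv (t0 u)].
  move=> /(_ u); rewrite !inE !eqxx orbT /= => /(_ isT isT) H /H /orP[] /eqP E.
    by exists u; rewrite E !eqxx.
  by exists (t0 u); rewrite E f0 !eqxx.
elim: p => //= x p IHp y vy v0y /andP[/or3P[] // /eqP <-]; apply: IHp.
- by [].
- by rewrite t0K.
- by rewrite v2.
by rewrite t02C v2.
Qed.

Definition underlying_graph (M : surface_map) : multigraph :=
  @MultiGraph (vertex M) (edge M) (fun e => [set v | incident_ve v e]).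

Definition map_aut (M : surface_map) : {set {perm flag M}} :=
  [set p : {perm flag M} |
    [forall w, [&& p (t0 w) == t0 (p w), p (t1 w) == t1 (p w)
                 & p (t2 w) == t2 (p w)]]].

(* The actions induced on vertices and edges; they do not depend on the chosen
   flags when p is an automorphism, by [vactE] and [eactE]. *)
Definition vact (M : surface_map) (v : vertex M) (p : {perm flag M}) :=
  fv (p (xchoose (fv_surj v))).

Definition eact (M : surface_map) (e : edge M) (p : {perm flag M}) :=
  fe (p (xchoose (fe_surj e))).

Lemma homo_connect (T T' : finType) (r : rel T) (r' : rel T') (f : T -> T') :
  (forall a b, r a b -> r' (f a) (f b)) ->
  forall a b, connect r a b -> connect r' (f a) (f b).
Proof.
move=> fr a b /connectP[p + ->] {b}.
elim: p a => //= b p IHp a /andP[/fr/connect1 + /IHp].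
exact: connect_trans.
Qed.

Lemma vactE (M : surface_map) (p : {perm flag M}) w :
  p \in map_aut M -> vact (fv w) p = fv (p w).
Proof.
rewrite inE => /forallP Mp; rewrite /vact; have /eqP/fvP := xchooseP (fv_surj (fv w)).
move=> w'w; apply/fvP; apply: (homo_connect _ w'w) => a b.
by rewrite /step /= => /or3P[] // /eqP <-; have /and3P[_ /eqP E1 /eqP E2] := Mp a;
  rewrite ?E1 ?E2 eqxx ?orbT.
Qed.

Lemma eactE (M : surface_map) (p : {perm flag M}) w :
  p \in map_aut M -> eact (fe w) p = fe (p w).
Proof.
rewrite inE => /forallP Mp; rewrite /eact; have /eqP/feP := xchooseP (fe_surj (fe w)).
move=> w'w; apply/feP; apply: (homo_connect _ w'w) => a b.
by rewrite /step /= => /or3P[] // /eqP <-; have /and3P[/eqP E1 _ /eqP E2] := Mp a;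
  rewrite ?E1 ?E2 eqxx ?orbT.
Qed.

Definition arcs (M : surface_map) : {set vertex M * edge M} :=
  [set a | incident_ve a.1 a.2].

Definition arc_act (M : surface_map) (a : vertex M * edge M)
  (p : {perm flag M}) := (vact a.1 p, eact a.2 p).

Definition acts_regularly (aT : finGroupType) (T : finType) (act : T -> aT -> T)
    (A : {set aT}) (S : {set T}) : Prop :=
  {in S & S, forall a b, #|[set g in A | act a g == b]| = 1%N}.

(* Dihedral of order 2n, n >= 1; the library's 'D_m requires m >= 4. *)
Definition is_dihedral (gT : finGroupType) (A : {set gT}) (n : nat) : bool :=
  if n == 1%N then A \isog [set: 'Z_2] else (0 < n) && (A \isog 'D_(2 * n)%N).

Definition vertex_stab (M : surface_map) (G : {set {perm flag M}})
    (v : vertex M) : {set {perm flag M}} :=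
  [set g in G | vact v g == v].

Definition vertex_reversing (M : surface_map) (G : {group {perm flag M}}) :=
  [/\ G \subset map_aut M,
      acts_regularly (@arc_act M) G (arcs M) &
      forall v : vertex M,
        (exists n, is_dihedral (vertex_stab G v) n) /\
        acts_regularly (@eact M) (vertex_stab G v) [set e | incident_ve v e]].

Record arc_regular_triple (gT : finGroupType) (G : {group gT}) := ARTriple {
  tx : gT;
  ty : gT;
  tz : gT;
  tx_inv : #[tx] = 2;
  ty_inv : #[ty] = 2;
  tz_inv : #[tz] = 2;
  t_gen : G = <<[set tx; ty; tz]>> :> {set gT};
  t_index : 3 <= #|G : <<[set tx; ty]>>|
}.

Section CosetMaps.

Variables (gT : finGroupType) (G : {group gT}) (t : arc_regular_triple G).

Local Notation x := (tx t).
Local Notation y := (ty t).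
Local Notation z := (tz t).

Definition rcoset_type (A : {set gT}) : finType :=
  {C : {set gT} | C \in rcosets A G}.

Lemma rcoset_of_subproof (A : {set gT}) (g : subg_of G) :
  A :* sgval g \in rcosets A G.
Proof. by rewrite -rcosetE imset_f ?subgP. Qed.

Definition rcoset_of (A : {set gT}) (g : subg_of G) : rcoset_type A :=
  exist _ (A :* sgval g) (rcoset_of_subproof A g).

(* The element g of G is the arc (<x,y>g, <z>g), and (g, true), (g, false) are
   the two flags containing it.  Around its vertex these flags are reflected
   by x and by y respectively: t1 sends (g, true) to (xg, true) and (g, false)
   to (yg, false).  The element z reverses the arc; it preserves the two sides
   of the edge in RevMap and exchanges them in BiRevMap. *)
Definition cm_flag : finType := (subg_of G * bool)%type.

Definition cm_lmul (a : gT) (g : subg_of G) : subg_of G := subg G a * g.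

Definition cm_t1 (w : cm_flag) : cm_flag :=
  (cm_lmul (if w.2 then x else y) w.1, w.2).

Definition cm_t2 (w : cm_flag) : cm_flag := (w.1, ~~ w.2).

Definition rev_t0 (w : cm_flag) : cm_flag := (cm_lmul z w.1, w.2).

Definition birev_t0 (w : cm_flag) : cm_flag := (cm_lmul z w.1, ~~ w.2).

Definition cm_fv (w : cm_flag) : rcoset_type <<[set x; y]>> :=
  rcoset_of _ w.1.

Definition cm_fe (w : cm_flag) : rcoset_type <<[set z]>> := rcoset_of _ w.1.

Definition rev_ff (w : cm_flag) :
    (rcoset_type <<[set x; z]>> + rcoset_type <<[set y; z]>>)%type :=
  if w.2 then inl (rcoset_of _ w.1) else inr (rcoset_of _ w.1).

(* The face on the other side of the edge <z>g is <x,y^z>zg. *)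
Definition birev_ff (w : cm_flag) : rcoset_type <<[set x; y ^ z]>> :=
  rcoset_of _ (if w.2 then w.1 else cm_lmul z w.1).

Lemma cm_xG : x \in G.
Proof. by rewrite (t_gen t) mem_gen // !inE eqxx. Qed.

Lemma cm_yG : y \in G.
Proof. by rewrite (t_gen t) mem_gen // !inE eqxx orbT. Qed.

Lemma cm_zG : z \in G.
Proof. by rewrite (t_gen t) mem_gen // !inE eqxx orbT. Qed.

Lemma cm_sqr (a : gT) : #[a] = 2 -> a * a = 1.
Proof. by move=> oa; rewrite -expg2 -oa expg_order. Qed.

Let xx : x * x = 1 := cm_sqr (tx_inv t).
Let yy : y * y = 1 := cm_sqr (ty_inv t).
Let zz : z * z = 1 := cm_sqr (tz_inv t).

Lemma cm_lmulE a g : a \in G -> sgval (cm_lmul a g) = a * sgval g.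
Proof. by move=> Ga; rewrite /cm_lmul /= subgK. Qed.

Lemma cm_lmulM a b g :
  a \in G -> b \in G -> cm_lmul (a * b) g = cm_lmul a (cm_lmul b g).
Proof.
move=> Ga Gb; apply: val_inj.
by rewrite /= !subgK ?groupM // mulgA.
Qed.

Lemma cm_lmul1 g : cm_lmul 1 g = g.
Proof. by apply: val_inj; rewrite /= subgK ?group1 // mul1g. Qed.

Lemma cm_lmulK a g : a \in G -> a * a = 1 -> cm_lmul a (cm_lmul a g) = g.
Proof. by move=> Ga aa; rewrite -cm_lmulM // aa cm_lmul1. Qed.

Lemma cm_lmul_fpf a g : a \in G -> #[a] = 2 -> cm_lmul a g != g.
Proof.
move=> Ga oa; apply/eqP => /(congr1 sgval); rewrite cm_lmulE // => /eqP.
rewrite -[X in _ == X]mul1g (inj_eq (mulIg _)) => /eqP a1.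
by move: oa; rewrite a1 order1.
Qed.

Lemma rcoset_of_eq (A : {set gT}) g h :
  rcoset_of <<A>> g = rcoset_of <<A>> h <-> sgval h * (sgval g)^-1 \in <<A>>.
Proof.
rewrite -mem_rcoset; split => [/(congr1 val) /= -> | /rcoset_eqP hg].
  exact: rcoset_refl.
exact: val_inj.
Qed.

Lemma rcoset_of_lmul (A : {set gT}) a g :
  a \in G -> a \in <<A>> -> rcoset_of <<A>> (cm_lmul a g) = rcoset_of <<A>> g.
Proof.
move=> Ga Aa; apply/esym/rcoset_of_eq.
by rewrite cm_lmulE // mulgK.
Qed.

Lemma rcoset_connect (T : finType) (r : rel T) (phi : subg_of G -> T)
    (A : {set gT}) : A \subset G ->
    (forall a g, a \in A -> connect r (phi g) (phi (cm_lmul a g))) ->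
  forall g h, rcoset_of <<A>> g = rcoset_of <<A>> h ->
    connect r (phi g) (phi h).
Proof.
move=> sAG rA g h /rcoset_of_eq.
pose K := [set a in G | [forall k, connect r (phi k) (phi (cm_lmul a k))]].
have gK : group_set K.
  apply/group_setP; split=> [|a b].
    by rewrite inE group1; apply/forallP => k; rewrite cm_lmul1.
  rewrite !inE => /andP[Ga /forallP Ka] /andP[Gb /forallP Kb].
  rewrite groupM //; apply/forallP => k; rewrite cm_lmulM //.
  exact: connect_trans (Kb k) (Ka _).
have: <<A>> \subset Group gK.
  rewrite gen_subG; apply/subsetP => a Aa; rewrite inE (subsetP sAG) //=.
  by apply/forallP => k; apply: rA.
move/subsetP => sAK /sAK; rewrite inE => /andP[Gh /forallP/(_ g)].
rewrite (_ : cm_lmul _ g = h) //; apply: val_inj.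
by rewrite [LHS]cm_lmulE // mulgKV.
Qed.

Lemma connect_const (T : finType) (U : Type) (r : rel T) (l : T -> U) :
  (forall w w', r w w' -> l w = l w') ->
  forall w w', connect r w w' -> l w = l w'.
Proof.
move=> rl w w' /connectP[p + ->] {w'}.
by elim: p w => //= b p IHp w /andP[/rl-> /IHp].
Qed.

Lemma cm_sAG (A : {set gT}) : A \subset [set x; y; z] -> A \subset G.
Proof. by rewrite (t_gen t); apply: sub_gen. Qed.

Lemma sub_xy : [set x; y] \subset G.
Proof. by apply: cm_sAG; apply: subsetUl. Qed.

Lemma sub_z : [set z] \subset G.
Proof. by apply: cm_sAG; apply: subsetUr. Qed.

Lemma sub_xz : [set x; z] \subset G.
Proof. by rewrite subUset !sub1set cm_xG cm_zG. Qed.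

Lemma sub_yz : [set y; z] \subset G.
Proof. by rewrite subUset !sub1set cm_yG cm_zG. Qed.

Lemma cm_yzG : y ^ z \in G.
Proof. by rewrite groupJ ?cm_yG ?cm_zG. Qed.

Lemma sub_xyz : [set x; y ^ z] \subset G.
Proof. by rewrite subUset !sub1set cm_xG cm_yzG. Qed.

Lemma cm_yzE : y ^ z = z * y * z.
Proof.
have zV : z^-1 = z by apply: (mulgI z); rewrite mulgV zz.
by rewrite conjgE zV mulgA.
Qed.

Lemma cm_stG (s : bool) : (if s then x else y) \in G.
Proof. by case: s; rewrite (cm_xG, cm_yG). Qed.

Lemma cm_flag_inh : 0 < #|cm_flag|.
Proof. by apply/card_gt0P; exists (1, true). Qed.

Lemma cm_t1K : involutive cm_t1.
Proof.
case=> g s; rewrite /cm_t1 /= cm_lmulK ?cm_stG //.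
by case: s; rewrite (xx, yy).
Qed.

Lemma cm_t2K : involutive cm_t2.
Proof. by case=> g s; rewrite /cm_t2 /= negbK. Qed.

Lemma rev_t0K : involutive rev_t0.
Proof. by case=> g s; rewrite /rev_t0 /= cm_lmulK ?cm_zG. Qed.

Lemma birev_t0K : involutive birev_t0.
Proof. by case=> g s; rewrite /birev_t0 /= cm_lmulK ?cm_zG // negbK. Qed.

Lemma rev_t02C w : rev_t0 (cm_t2 w) = cm_t2 (rev_t0 w).
Proof. by []. Qed.

Lemma birev_t02C w : birev_t0 (cm_t2 w) = cm_t2 (birev_t0 w).
Proof. by []. Qed.

Lemma cm_t1_fpf w : cm_t1 w != w.
Proof.
case: w => g s; apply/eqP => -[] /eqP; apply/negP; apply: cm_lmul_fpf.
  exact: cm_stG.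
by case: s; rewrite (tx_inv, ty_inv).
Qed.

Lemma cm_t2_fpf w : cm_t2 w != w.
Proof. by case: w => g []; apply/eqP => -[]. Qed.

Lemma cm_z_notin : z \notin <<[set x; y]>>.
Proof.
apply/negP => zH; have /eqP GH : G == <<[set x; y]>> :> {set gT}.
  rewrite eqEsubset gen_subG sub_xy andbT (t_gen t) gen_subG.
  by rewrite subUset sub1set zH subset_gen.
by have := t_index t; rewrite -GH indexgg.
Qed.

Lemma cm_rcoset_z g :
  rcoset_of <<[set x; y]>> (cm_lmul z g) != rcoset_of <<[set x; y]>> g.
Proof.
apply/eqP => /esym/rcoset_of_eq; rewrite cm_lmulE ?cm_zG // mulgK => zH.
by have := cm_z_notin; rewrite zH.
Qed.

Lemma rcoset_of_surj (A : {set gT}) (C : rcoset_type A) :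
  exists g, rcoset_of A g = C.
Proof.
case: C => C CG; have /rcosetsP[g Gg defC] := CG.
by exists (subg G g); apply: val_inj; rewrite /= subgK.
Qed.

Lemma cm_fv_surj v : exists w, cm_fv w == v.
Proof. by have [g <-] := rcoset_of_surj v; exists (g, true). Qed.

Lemma cm_fe_surj e : exists w, cm_fe w == e.
Proof. by have [g <-] := rcoset_of_surj e; exists (g, true). Qed.

Lemma rev_ff_surj f : exists w, rev_ff w == f.
Proof.
case: f => C; have [g <-] := rcoset_of_surj C.
  by exists (g, true).
by exists (g, false).
Qed.

Lemma birev_ff_surj f : exists w, birev_ff w == f.
Proof. by have [g <-] := rcoset_of_surj f; exists (g, true). Qed.

Let in_gen a (A : {set gT}) : a \in A -> a \in <<A>> := @mem_gen _ a A.

Lemma cm_fvP w w' :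
  cm_fv w = cm_fv w' <-> connect (step [:: cm_t1; cm_t2]) w w'.
Proof.
split=> [|]; last first.
  apply: connect_const => {w w'} -[g s] w' /or3P[] // /eqP <- //.
  rewrite /cm_fv /= rcoset_of_lmul ?cm_stG //.
  by apply: in_gen; case: s; rewrite !inE eqxx ?orbT.
have c2 u : connect (step [:: cm_t1; cm_t2]) u (cm_t2 u).
  by apply: connect1; rewrite /step /= eqxx orbT.
have c1 u : connect (step [:: cm_t1; cm_t2]) u (cm_t1 u).
  by apply: connect1; rewrite /step /= eqxx.
have sw g s s' : connect (step [:: cm_t1; cm_t2]) (g, s) (g, s').
  have := c2 (g, s); rewrite /cm_t2 /=; case: s; case: s' => // *;
  exact: connect0.
case: w w' => [g s] [g' s']; rewrite /cm_fv /= => gg'.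
apply: connect_trans (sw g s true) _; apply: connect_trans (sw g' true s').
apply: (rcoset_connect (phi := fun k => (k, true)) sub_xy _ gg') => a k.
rewrite !inE => /orP[] /eqP->; first exact: c1 (k, true).
apply: connect_trans (sw k true false) _.
by apply: connect_trans (c1 (k, false)) _; apply: sw.
Qed.

Lemma rev_feP w w' :
  cm_fe w = cm_fe w' <-> connect (step [:: rev_t0; cm_t2]) w w'.
Proof.
split=> [|]; last first.
  apply: connect_const => {w w'} -[g s] w' /or3P[] // /eqP <- //.
  by rewrite /cm_fe /= rcoset_of_lmul ?cm_zG // in_gen // set11.
have c2 u : connect (step [:: rev_t0; cm_t2]) u (cm_t2 u).
  by apply: connect1; rewrite /step /= eqxx orbT.
have c0 u : connect (step [:: rev_t0; cm_t2]) u (rev_t0 u).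
  by apply: connect1; rewrite /step /= eqxx.
have sw g s s' : connect (step [:: rev_t0; cm_t2]) (g, s) (g, s').
  have := c2 (g, s); rewrite /cm_t2 /=; case: s; case: s' => // *;
  exact: connect0.
case: w w' => [g s] [g' s']; rewrite /cm_fe /= => gg'.
apply: connect_trans (sw g s true) _; apply: connect_trans (sw g' true s').
apply: (rcoset_connect (phi := fun k => (k, true)) sub_z _ gg') => a k.
by rewrite !inE => /eqP->; apply: c0 (k, true).
Qed.

Lemma birev_feP w w' :
  cm_fe w = cm_fe w' <-> connect (step [:: birev_t0; cm_t2]) w w'.
Proof.
split=> [|]; last first.
  apply: connect_const => {w w'} -[g s] w' /or3P[] // /eqP <- //.
  by rewrite /cm_fe /= rcoset_of_lmul ?cm_zG // in_gen // set11.
have c2 u : connect (step [:: birev_t0; cm_t2]) u (cm_t2 u).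
  by apply: connect1; rewrite /step /= eqxx orbT.
have c0 u : connect (step [:: birev_t0; cm_t2]) u (birev_t0 u).
  by apply: connect1; rewrite /step /= eqxx.
have sw g s s' : connect (step [:: birev_t0; cm_t2]) (g, s) (g, s').
  have := c2 (g, s); rewrite /cm_t2 /=; case: s; case: s' => // *;
  exact: connect0.
case: w w' => [g s] [g' s']; rewrite /cm_fe /= => gg'.
apply: connect_trans (sw g s true) _; apply: connect_trans (sw g' true s').
apply: (rcoset_connect (phi := fun k => (k, true)) sub_z _ gg') => a k.
rewrite !inE => /eqP->; apply: connect_trans (c0 (k, true)) _; exact: sw.
Qed.

Lemma rev_ffP w w' :
  rev_ff w = rev_ff w' <-> connect (step [:: rev_t0; cm_t1]) w w'.
Proof.
split=> [|]; last first.
  apply: connect_const => {w w'} -[g s] w' /or3P[] // /eqP <- //;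
    rewrite /rev_ff /=; case: s;
    rewrite rcoset_of_lmul ?cm_xG ?cm_yG ?cm_zG //;
    by apply: in_gen; rewrite !inE eqxx ?orbT.
have c1 u : connect (step [:: rev_t0; cm_t1]) u (cm_t1 u).
  by apply: connect1; rewrite /step /= eqxx orbT.
have c0 u : connect (step [:: rev_t0; cm_t1]) u (rev_t0 u).
  by apply: connect1; rewrite /step /= eqxx.
case: w w' => [g []] [g' []]; rewrite /rev_ff //= => -[] gg'.
  have {}gg' : rcoset_of <<[set x; z]>> g = rcoset_of <<[set x; z]>> g'.
    exact: val_inj.
  apply: (rcoset_connect (phi := fun k => (k, true)) sub_xz _ gg') => a k.
  by rewrite !inE => /orP[] /eqP->; [apply: c1 (k, true) | apply: c0 (k, true)].
have {}gg' : rcoset_of <<[set y; z]>> g = rcoset_of <<[set y; z]>> g'.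
  exact: val_inj.
apply: (rcoset_connect (phi := fun k => (k, false)) sub_yz _ gg') => a k.
by rewrite !inE => /orP[] /eqP->; [apply: c1 (k, false) | apply: c0 (k, false)].
Qed.

Lemma birev_ffP w w' :
  birev_ff w = birev_ff w' <-> connect (step [:: birev_t0; cm_t1]) w w'.
Proof.
split=> [|]; last first.
  apply: connect_const => {w w'} -[g s] w' /or3P[] // /eqP <- //;
    rewrite /birev_ff /=; case: s => /=.
  - by rewrite cm_lmulK ?cm_zG.
  - by [].
  - by rewrite rcoset_of_lmul ?cm_xG // in_gen // !inE eqxx.
  apply/esym; rewrite -(@rcoset_of_lmul _ (y ^ z) (cm_lmul z g)) ?cm_yzG //.
    rewrite -!cm_lmulM ?cm_yzG ?cm_yG ?cm_zG ?groupM ?cm_yzG ?cm_yG ?cm_zG //.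
    by rewrite cm_yzE -!mulgA zz mulg1.
  by rewrite in_gen // !inE eqxx orbT.
have c1 u : connect (step [:: birev_t0; cm_t1]) u (cm_t1 u).
  by apply: connect1; rewrite /step /= eqxx orbT.
have c0 u : connect (step [:: birev_t0; cm_t1]) u (birev_t0 u).
  by apply: connect1; rewrite /step /= eqxx.
pose nf (w : cm_flag) := if w.2 then w.1 else cm_lmul z w.1.
have toT u : connect (step [:: birev_t0; cm_t1]) u (nf u, true).
  by case: u => g []; [exact: connect0 | exact: c0 (g, false)].
have ofT u : connect (step [:: birev_t0; cm_t1]) (nf u, true) u.
  case: u => g []; first exact: connect0.
  have := c0 (cm_lmul z g, true); rewrite /birev_t0 /= cm_lmulK ?cm_zG //.
rewrite /birev_ff -/(nf w) -/(nf w') => gg'.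
apply: connect_trans (toT w) _; apply: connect_trans (ofT w').
apply: (rcoset_connect (phi := fun k => (k, true)) sub_xyz _ gg') => a k.
rewrite !inE => /orP[] /eqP->; first exact: c1 (k, true).
apply: connect_trans (c0 (k, true)) _.
apply: connect_trans (c1 (cm_lmul z k, false)) _.
by rewrite cm_yzE !cm_lmulM ?groupM ?cm_yG ?cm_zG.
Qed.

Lemma cm_connect (r : rel cm_flag) :
    (forall g s s', connect r (g, s) (g, s')) ->
    (forall g a, a \in [set x; y; z] ->
       exists s s', connect r (g, s) (cm_lmul a g, s')) ->
  forall w w', connect r w w'.
Proof.
move=> sw rA [g s] [g' s'].
apply: connect_trans (sw g s true) _; apply: connect_trans (sw g' true s').
apply: (rcoset_connect (phi := fun k => (k, true)) (cm_sAG (subxx _))).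
  move=> a k /(rA k)[u [u' cu]].
  apply: connect_trans (sw k true u) _; exact: connect_trans cu (sw _ u' true).
by apply/rcoset_of_eq; rewrite -(t_gen t) groupM ?groupV ?subgP.
Qed.

Lemma rev_connected w w' : connect (step [:: rev_t0; cm_t1; cm_t2]) w w'.
Proof.
have c0 u : connect (step [:: rev_t0; cm_t1; cm_t2]) u (rev_t0 u).
  by apply: connect1; rewrite /step /= eqxx.
have c1 u : connect (step [:: rev_t0; cm_t1; cm_t2]) u (cm_t1 u).
  by apply: connect1; rewrite /step /= eqxx orbT.
have c2 u : connect (step [:: rev_t0; cm_t1; cm_t2]) u (cm_t2 u).
  by apply: connect1; rewrite /step /= eqxx !orbT.
apply: cm_connect => [g s s'|g a].
  have := c2 (g, s); rewrite /cm_t2 /=; case: s; case: s' => // *;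
  exact: connect0.
rewrite !inE -orbA => /or3P[] /eqP->.
- by exists true, true; apply: c1 (g, true).
- by exists false, false; apply: c1 (g, false).
- by exists true, true; apply: c0 (g, true).
Qed.

Lemma birev_connected w w' : connect (step [:: birev_t0; cm_t1; cm_t2]) w w'.
Proof.
have c0 u : connect (step [:: birev_t0; cm_t1; cm_t2]) u (birev_t0 u).
  by apply: connect1; rewrite /step /= eqxx.
have c1 u : connect (step [:: birev_t0; cm_t1; cm_t2]) u (cm_t1 u).
  by apply: connect1; rewrite /step /= eqxx orbT.
have c2 u : connect (step [:: birev_t0; cm_t1; cm_t2]) u (cm_t2 u).
  by apply: connect1; rewrite /step /= eqxx !orbT.
apply: cm_connect => [g s s'|g a].
  have := c2 (g, s); rewrite /cm_t2 /=; case: s; case: s' => // *;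
  exact: connect0.
rewrite !inE -orbA => /or3P[] /eqP->.
- by exists true, true; apply: c1 (g, true).
- by exists false, false; apply: c1 (g, false).
- by exists true, false; apply: c0 (g, true).
Qed.

Definition RevMap : surface_map :=
  SurfaceMap cm_flag_inh rev_t0K cm_t1K cm_t2K rev_t02C cm_t1_fpf cm_t2_fpf
    (fun w => cm_rcoset_z w.1) cm_fv_surj cm_fe_surj rev_ff_surj
    cm_fvP rev_feP rev_ffP rev_connected.

Definition BiRevMap : surface_map :=
  SurfaceMap cm_flag_inh birev_t0K cm_t1K cm_t2K birev_t02C cm_t1_fpf cm_t2_fpf
    (fun w => cm_rcoset_z w.1) cm_fv_surj cm_fe_surj birev_ff_surj
    cm_fvP birev_feP birev_ffP birev_connected.

Lemma meet_rcosets (A B : {set gT}) (C : rcoset_type <<A>>)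
    (D : rcoset_type <<B>>) : A \subset G ->
  (val C :&: val D != set0) =
  [exists g : subg_of G, (rcoset_of <<A>> g == C) && (rcoset_of <<B>> g == D)].
Proof.
move=> sAG; apply/set0Pn/existsP => [[h]|[g /andP[/eqP<- /eqP<-]]]; last first.
  by exists (sgval g); rewrite inE !rcoset_refl.
case: C D => C CG [D DG]; rewrite inE /=.
have /rcosetsP[c Gc defC] := CG; have /rcosetsP[d Gd defD] := DG.
case/andP=> Ch Dh; have Gh : h \in G.
  move: Ch; rewrite defC mem_rcoset => Ach.
  have: h * c^-1 \in G by apply: subsetP Ach; rewrite gen_subG.
  by rewrite groupMr ?groupV.
exists (subg G h); apply/andP; split; apply/eqP/val_inj; rewrite /= subgK //.
  by rewrite defC; apply/rcoset_eqP; rewrite -defC.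
by rewrite defD; apply/rcoset_eqP; rewrite -defD.
Qed.

(* Two elements of different kinds are incident iff the cosets intersect.  The
   exception is a vertex and a face of BiRevMap: the boundary of the
   face <x,y^z> contains the edge <z>, hence both its ends <x,y> and <x,y>z,
   although <x,y>z need not meet <x,y^z>.  There the incidence is given by
   [incident_vfE]. *)
Lemma RevMap_incident_ve (v : vertex RevMap) (e : edge RevMap) :
  incident_ve v e = (val v :&: val e != set0).
Proof.
rewrite meet_rcosets ?sub_xy //; apply/existsP/existsP => [[w vw]|[g vg]].
  by exists w.1.
by exists (g, true).
Qed.

Lemma BiRevMap_incident_ve (v : vertex BiRevMap) (e : edge BiRevMap) :
  incident_ve v e = (val v :&: val e != set0).
Proof.
rewrite meet_rcosets ?sub_xy //; apply/existsP/existsP => [[w vw]|[g vg]].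
  by exists w.1.
by exists (g, true).
Qed.

Definition rev_face_coset (f : face RevMap) : {set gT} :=
  match f with inl C => val C | inr C => val C end.

Lemma RevMap_incident_ef (e : edge RevMap) (f : face RevMap) :
  incident_ef e f = (val e :&: rev_face_coset f != set0).
Proof.
case: f => C; rewrite /rev_face_coset meet_rcosets ?sub_z //;
  apply/existsP/existsP => [[[g []] /andP[eg /eqP]] //= [Cg]|[g /andP[eg /eqP Cg]]].
- by exists g; rewrite Cg eqxx andbT.
- by exists (g, true); apply/andP; split=> //; rewrite -Cg.
- by exists g; rewrite Cg eqxx andbT.
- by exists (g, false); apply/andP; split=> //; rewrite -Cg.
Qed.

Lemma RevMap_incident_vf (v : vertex RevMap) (f : face RevMap) :
  incident_vf v f = (val v :&: rev_face_coset f != set0).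
Proof.
case: f => C; rewrite /rev_face_coset meet_rcosets ?sub_xy //;
  apply/existsP/existsP => [[[g []] /andP[eg /eqP]] //= [Cg]|[g /andP[eg /eqP Cg]]].
- by exists g; rewrite Cg eqxx andbT.
- by exists (g, true); apply/andP; split=> //; rewrite -Cg.
- by exists g; rewrite Cg eqxx andbT.
- by exists (g, false); apply/andP; split=> //; rewrite -Cg.
Qed.

Lemma BiRevMap_incident_ef (e : edge BiRevMap) (f : face BiRevMap) :
  incident_ef e f = (val e :&: val f != set0).
Proof.
rewrite meet_rcosets ?sub_z //; apply/existsP/existsP => [[w]|[g eg]]; last first.
  by exists (g, true).
rewrite /= /cm_fe /birev_ff; case: w.2 => ew; first by exists w.1.
exists (cm_lmul z w.1); rewrite rcoset_of_lmul ?cm_zG //.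
by rewrite mem_gen // set11.
Qed.

End CosetMaps.

Definition reversing_map (M : surface_map) (gT : finGroupType) (G : {group gT})
    : Prop :=
  exists t : arc_regular_triple G, map_iso M (RevMap t).

Definition bireversing_map (M : surface_map) (gT : finGroupType)
    (G : {group gT}) : Prop :=
  exists t : arc_regular_triple G, map_iso M (BiRevMap t).

(* Main.v *)
Require Import Defs.
From HB Require Import structures.
From mathcomp Require Import all_boot all_order all_algebra.
From mathcomp Require Import all_fingroup all_solvable.
From mathcomp Require Import zify.

Set Implicit Arguments.
Unset Strict Implicit.
Unset Printing Implicit Defensive.

Import Order.TTheory GRing.Theory Num.Theory.
Import GroupScope.

(** A vertex-reversing map is determined by a triple of involutions of its group,
    after which the theorem is a statement about indices of dihedral subgroups.

    A group that is regular on the arcs has two orbits on flags, exchanged by [t2].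
    If the orbits were exchanged by [t1] as well, vertex stabilizers would be cyclic
    as well as dihedral, vertices would have valency 2 and there would be at most
    two faces ([vertex_reflection]). So the effect of [t1] on the two flags [w] and
    [t2 w] of an arc is that of two involutions [x] and [y] of [G], and the effect
    of [t0] on [w] is that of an involution [z], possibly composed with [t2]. This
    identifies the map with the coset map, of one kind or of the other, of the triple
    ([vertex_reversing_coset_map]).

    The vertices and faces are then cosets of subgroups generated by two involutions,
    and there are [|G| / 2] edges. So the hypothesis says that the sum of the
    indices of these dihedral subgroups, three or two according to the kind, is
    coprime to [|G| / 2]. Each prime divisor of [|G| / 2] thus misses one of the
    indices, and the Sylow subgroups of [G] are cyclic for odd primes and cyclic or
    dihedral for 2. For [G] solvable, the action on the Fitting subgroup gives two
    possible shapes ([dihedral_index_structure]): either [G] has a cyclic normal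
    subgroup [N] of odd order such that [G / N] is a 2-group, or it has a normal
    Klein group [K] with [G / 'C_G(K)] of order 6 and ['C_G(K) = K \x N], where [N]
    is cyclic of odd order.

    In the first shape, if 4 does not divide [|G|] then [G] is dihedral, and the three
    generators are reflections [x], [x a^j], [x a^k]; the indices are greatest common
    divisors ([dihedral_coordinates], [rev_coord], [birev_coord]). If 4 divides [|G|]
    the sum of the indices is odd. For bireversing maps this is impossible: [y] and
    [y ^ z] generate the same subgroup with [x] modulo the Frattini subgroup of
    [G / N], so the two indices have the same parity. For reversing maps, an odd
    number of pairs of generators generate [G / N], and this leaves two cases
    ([third_central]). Either a generator is central ([rev_central]), or [G / N] is a
    Klein group containing the images of the three generators; then coprimality
    makes [N] the product of its intersections with the three dihedral subgroups,
    whose orders are pairwise coprime and give all the invariants ([rev_klein]).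

    In the second shape, involutions outside [K] act on [K] as transpositions. Parity
    and divisibility by 3 of the sum show that the map is reversing, that one
    generator lies in [K] and that the other two generate a subgroup of index 4
    containing [N] ([nk_triple]); so [G / N] is [S_4] ([s4_isog]), and the three roles
    that [z] can have among the generators give three graphs ([s4_coset_graph]).

    The graphs are identified by labelling the cosets of [H = <x, y>]: a vertex has
    [|H : H :&: H :^ z|] neighbours and the edges have multiplicity [|H :&: H :^ z|]
    ([coset_graph_multiple]). A coherent colouring of the flags amounts to a
    homomorphism onto the group of order 2 with prescribed values at [x], [y] and [z]
    ([RevMap_parity], [BiRevMap_parity]). *)

(** * Multigraphs of coset graphs *)

Lemma mg_iso_trans A B C : mg_iso A B -> mg_iso B C -> mg_iso A C.
Proof.
case=> f [h [bf bh fh]] [f' [h' [bf' bh' fh']]].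
exists (f' \o f), (h' \o h); split; try exact: bij_comp.
by move=> e; rewrite /= fh' fh imset_comp.
Qed.

(** Numbers the elements of each fibre, such as the edges parallel to a given one. *)
Lemma fibre_bij (E X : finType) (l : nat) (f : E -> X) :
  (forall x, #|[set e | f e == x]| = l) ->
  exists h : E -> X * 'I_l, bijective h /\ forall e, (h e).1 = f e.
Proof.
move=> fibre.
have lt_index e : index e (enum [set e' | f e' == f e]) < l.
  by rewrite -(fibre (f e)) cardE index_mem mem_enum inE.
pose h e := (f e, Ordinal (lt_index e)); exists h; split=> //.
apply: inj_card_bij => [e e' [fe] | ].
  by rewrite fe; apply: (index_inj e); rewrite mem_enum inE ?fe.
rewrite card_prod card_ord -sum_nat_const -sum1_card.
rewrite (partition_big f xpredT) //= leq_sum // => x _.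
by rewrite sum1_card -(fibre x) cardsE.
Qed.

(** The usual proof by induction on a word in generators [A], read from the right.
    The set [X] need not be a group: it is often a product of subgroups. *)
Lemma gen_lmul_sub (gT : finGroupType) (A X : {set gT}) :
  1 \in X -> {in A & X, forall a w, a * w \in X} -> <<A>> \subset X.
Proof.
move=> X1 AX; pose K := [set g | [forall w in X, g * w \in X]].
have gK : group_set K.
  apply/group_setP; split=> [|g k].
    by rewrite inE; apply/forall_inP => w; rewrite mul1g.
  rewrite !inE => /forall_inP Kg /forall_inP Kk.
  by apply/forall_inP => w Xw; rewrite -mulgA Kg ?Kk.
have /subsetP sAK : <<A>> \subset Group gK.
  rewrite gen_subG; apply/subsetP => a Aa; rewrite inE.
  by apply/forall_inP => w; apply: AX.
apply/subsetP => g /sAK; rewrite inE => /forall_inP/(_ 1 X1).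
by rewrite mulg1.
Qed.

(** When the powers of [r] represent all the cosets of [T], they do so
    periodically, with period the index of [T]; so exponents modulo this index
    label the cosets. *)
Lemma cyclic_transversal (gT : finGroupType) (G T : {group gT}) (r : gT) (d : nat) :
    T \subset G -> r \in G -> G \subset T * <[r]> -> #|G : T| = d ->
  exists phi : gT -> 'I_d,
    [/\ {in G &, forall g k, (phi g == phi k) = (k * g^-1 \in T)},
        {in G, forall g, g * r ^- (phi g) \in T},
        {in G, forall g n, g * r ^- n \in T -> n = phi g %[mod d]} &
        forall a b, (r ^+ a * r ^- b \in T) = (a == b %[mod d])].
Proof.
move=> sTG Gr GTR iT.
pose R0 := (<[r]> :&: T)%G.
have nR0 : <[r]> \subset 'N(R0).
  by apply: sub_abelian_norm; [apply: cycle_abelian | apply: subsetIl].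
have sRG : <[r]> \subset G by rewrite cycle_subG.
have od : #[coset R0 r] = d.
  rewrite -iT orderE -quotient_cycle ?(subsetP nR0) ?cycle_id //.
  rewrite card_quotient // indexgI -(indexMg T); congr #|_ : T|.
  by apply/eqP; rewrite eqEsubset GTR mulG_subG sTG sRG.
have dvT a b : (r ^+ a * r ^- b \in T) = (a == b %[mod d]).
  have Na n : r ^+ n \in 'N(R0) by rewrite (subsetP nR0) ?mem_cycle.
  rewrite -od -eq_expg_mod_order -!morphX ?(subsetP nR0) ?cycle_id //=.
  have -> : (r ^+ a * r ^- b \in T) = (r ^+ a * r ^- b \in R0).
    by rewrite inE [_ \in <[r]>]groupM ?groupV ?mem_cycle.
  rewrite -mem_rcoset; apply/idP/eqP => [/rcoset_eqP ab | ab].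
    by apply/eqP; rewrite -val_eqE /= !val_coset // ab.
  exact/(rcoset_kercosetP (Na a) (Na b)).
have d_gt0 : 0 < d by rewrite -iT indexg_gt0.
have sel g : g \in G -> exists i : 'I_d, g * r ^- i \in T.
  move/(subsetP GTR)/mulsgP=> [t _ Tt /cycleP[n ->] ->].
  exists (Ordinal (ltn_pmod n d_gt0)).
  by rewrite /= -mulgA groupM // dvT modn_mod.
pose phi g := odflt (Ordinal d_gt0) [pick i : 'I_d | g * r ^- i \in T].
have phiT g : g \in G -> g * r ^- (phi g) \in T.
  by move=> Gg; rewrite /phi; case: pickP => //= none; have [i] := sel g Gg; rewrite none.
have phi_uniq g n : g \in G -> g * r ^- n \in T -> n = phi g %[mod d].
  move=> Gg Tn; apply/eqP; rewrite -dvT; have := groupM (groupVr Tn) (phiT g Gg).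
  by rewrite invMg invgK !mulgA mulgKV.
have val_phi g n : g \in G -> g * r ^- n \in T -> val (phi g) = n %% d.
  by move=> Gg /(phi_uniq g n Gg) ->; rewrite modn_small.
have phi_eq : {in G &, forall g k, (phi g == phi k) = (k * g^-1 \in T)}.
  move=> g k Gg Gk; apply/eqP/idP => [gk | Tkg].
    have := groupM (phiT k Gk) (groupVr (phiT g Gg)).
    by rewrite gk invMg invgK !mulgA mulgKV.
  apply: val_inj; rewrite (val_phi g (phi k)) ?modn_small //.
  have := groupM (groupVr Tkg) (phiT k Gk).
  by rewrite invMg invgK !mulgA mulgKV.
by exists phi; split=> // g Gg n; apply: phi_uniq.
Qed.

(** With [T :&: T :^ z] of index 2 in [T], each coset [Tg] has the two
    neighbours [T r g] and [T r^-1 g], where [r = z h] for any [h] in [T]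
    outside [T :^ z]; so the powers of [r] wind once around the cosets. *)
Lemma cycle_labelling (gT : finGroupType) (G T : {group gT}) (z : gT) (d : nat) :
    T \subset G -> z \in G -> z * z = 1 -> G \subset <<z |: T>> ->
    #|T : T :&: T :^ z| = 2 -> #|G : T| = d -> 1 < d ->
  exists phi : gT -> 'I_d,
    [/\ {in G &, forall g k, (phi g == phi k) = (k * g^-1 \in T)},
        forall i, exists2 g, g \in G & phi g = i &
        {in G, forall g, @cycle_adj d (phi g) (phi (z * g))}].
Proof.
move=> sTG Gz zz genG iL iT d_gt1.
have zV : z^-1 = z by apply: (mulgI z); rewrite mulgV zz.
have zK g : z * (z * g) = g by rewrite mulgA zz mul1g.
pose L := (T :&: T :^ z)%G.
have sLT : L \subset T by apply: subsetIl.
have [h Th nLh] : exists2 h, h \in T & h \notin L.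
  by apply/subsetPn; rewrite -indexg_eq1 iL.
have GT t : t \in T -> t \in G by apply: subsetP.
have zL l : l \in L -> z * l * z \in T.
  rewrite inE => /andP[_]; rewrite mem_conjg zV conjgE zV mulgA.
  by [].
have splitT t : t \in T -> t \notin L -> t * h^-1 \in L.
  by move=> Tt nLt; rewrite -mem_rcoset (rcoset_index2 sLT iL) in_setD ?nLh ?nLt.
have [r def_r] : {r | r = z * h} by exists (z * h).
have Gr : r \in G by rewrite def_r groupM // GT.
have zt_in t : t \in T -> t \in L -> z * t * r \in T.
  move=> Tt Lt; have -> : z * t * r = z * t * z * h by rewrite def_r !mulgA.
  by rewrite groupM ?zL.
have zt_out t : t \in T -> t \notin L -> z * t * r^-1 \in T.
  move=> Tt nLt; have -> : z * t * r^-1 = z * (t * h^-1) * z.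
    by rewrite def_r invMg zV !mulgA.
  by rewrite zL ?splitT.
have GTR : G \subset T * <[r]>.
  apply: subset_trans genG _; apply: gen_lmul_sub => [|a _ Aa /mulsgP[t _ Tt /cycleP[n ->] ->]].
    by rewrite -[1]mulg1 mem_mulg.
  case/setU1P: Aa => [-> | Ta]; last by rewrite mulgA mem_mulg ?groupM ?mem_cycle.
  case Lt: (t \in L).
    have -> : z * (t * r ^+ n) = (z * t * r) * (r^-1 * r ^+ n) by rewrite !mulgA mulgK.
    by rewrite mem_mulg ?zt_in // groupM ?groupV ?mem_cycle ?cycle_id.
  have -> : z * (t * r ^+ n) = (z * t * r^-1) * (r * r ^+ n) by rewrite !mulgA mulgKV.
  by rewrite mem_mulg ?zt_out ?Lt // -expgS mem_cycle.
have [phi [phi_eq phiT phi_uniq dvT]] := cyclic_transversal sTG Gr GTR iT.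
exists phi; split=> // [i | g Gg].
  exists (r ^+ i); first by rewrite groupX.
  apply: val_inj; have := phi_uniq (r ^+ i) (groupX i Gr) i.
  by rewrite mulgV group1 !modn_small // => /(_ isT).
have Gzg : z * g \in G by rewrite groupM.
have nTz : z \notin T.
  apply: contraTN d_gt1 => Tz.
  have sGT : G \subset T.
    by apply: subset_trans genG _; rewrite gen_subG subUset sub1set Tz subxx.
  by rewrite -iT -leqNgt leq_eqVlt indexg_eq1 sGT.
rewrite /cycle_adj phi_eq // mulgK nTz /=.
have := phiT g Gg; set i := phi g; set j := phi (z * g) => Ti.
have Tj : z * g * r ^- j \in T by apply: phiT.
case Li: (g * r ^- i \in L).
  apply/orP; right; have := groupM (groupVr Tj) (zt_in _ Ti Li).
  have -> : (z * g * r ^- j)^-1 * (z * (g * r ^- i) * r) = r ^+ j.+1 * r ^- i.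
    rewrite !invMg invgK !mulgA !mulgKV expgSr -!mulgA; congr (_ * _).
    exact/commute_sym/commuteV/commuteX.
  by rewrite dvT.
apply/orP; left; have := groupM (groupVr Tj) (zt_out _ Ti (negbT Li)).
have -> : (z * g * r ^- j)^-1 * (z * (g * r ^- i) * r^-1) = r ^+ j * r ^- i.+1.
  by rewrite !invMg invgK !mulgA !mulgKV expgS invMg mulgA.
by rewrite dvT eq_sym.
Qed.

Lemma cycle_degree d (s : 'I_d) : #|[set u | @cycle_adj d s u]| <= 2.
Proof.
case: d s => [[] // | d] s.
pose a : 'I_d.+1 := inord (s.+1 %% d.+1).
pose b : 'I_d.+1 := inord ((s + d) %% d.+1).
apply: leq_trans (_ : #|[set a; b]| <= 2); last by rewrite cards2; case: eqP.
apply/subset_leq_card/subsetP => u; rewrite !inE => /andP[_ /orP[] /eqP E].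
  by apply/orP; left; rewrite -val_eqE /= inordK ?ltn_pmod // E modn_small.
apply/orP; right; rewrite -val_eqE /= inordK ?ltn_pmod //.
by rewrite -modnDml -E modnDml addSnnS modnDr modn_small.
Qed.

Lemma coset_labelling (gT : finGroupType) (G D : {group gT}) (d : nat) :
    #|G : D| = d ->
  exists phi : gT -> 'I_d,
    {in G &, forall g k, (phi g == phi k) = (k * g^-1 \in D)} /\
    forall i, exists2 g, g \in G & phi g = i.
Proof.
move=> iD; have oD : #|rcoset_type G D| = d by rewrite card_sig -iD.
pose phi g := cast_ord oD (enum_rank (rcoset_of D (subg G g))); exists phi; split.
  move=> g k Gg Gk; rewrite (inj_eq (@cast_ord_inj _ _ _)) (inj_eq enum_rank_inj).
  by rewrite -val_eqE /= !subgK // -mem_rcoset eq_sym; apply/eqP/rcoset_eqP.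
move=> i; have [g gE] := rcoset_of_surj (enum_val (cast_ord (esym oD) i)).
exists (sgval g); first exact: subgP.
by rewrite /phi sgvalK gE enum_valK cast_ordKV.
Qed.

Section CosetGraph.

Variables (gT : finGroupType) (G : {group gT}) (t : arc_regular_triple G).

Local Notation x := (tx t).
Local Notation y := (ty t).
Local Notation z := (tz t).
Local Notation H := <<[set x; y]>>%G.

(** Both kinds of maps defined by a triple have this underlying graph, so that each
    graph is identified only once. *)
Definition coset_graph : multigraph :=
  @MultiGraph (rcoset_type G <<[set x; y]>>) (rcoset_type G <<[set z]>>)
    (fun e => [set v | val v :&: val e != set0]).

Lemma RevMap_graph : mg_iso (underlying_graph (RevMap t)) coset_graph.
Proof.
exists id, id; split=> [||e]; try by exists id.
by rewrite imset_id; apply/setP => v; rewrite !inE RevMap_incident_ve.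
Qed.

Lemma BiRevMap_graph : mg_iso (underlying_graph (BiRevMap t)) coset_graph.
Proof.
exists id, id; split=> [||e]; try by exists id.
by rewrite imset_id; apply/setP => v; rewrite !inE BiRevMap_incident_ve.
Qed.

Lemma tz_sq : z * z = 1. Proof. exact: cm_sqr (tz_inv t). Qed.

Lemma tz_V : z^-1 = z.
Proof. by apply: (mulgI z); rewrite mulgV tz_sq. Qed.

Lemma gen_z : <<[set z]>> = [set 1; z].
Proof. by rewrite -/(<[z]>) cycle2g ?tz_inv. Qed.

Lemma tH_sub : H \subset G.
Proof. by rewrite gen_subG sub_xy. Qed.

Lemma coset_ends (g : subg_of G) :
  mg_ends (rcoset_of <<[set z]>> g : mg_edge coset_graph) =
    [set rcoset_of <<[set x; y]>> g; rcoset_of <<[set x; y]>> (cm_lmul z g)].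
Proof.
have Gz := cm_zG t; apply/setP => v; rewrite !inE meet_rcosets ?sub_xy //.
apply/existsP/orP => [[k /andP[/eqP<-]] | [] /eqP->]; last 2 first.
- by exists g; rewrite !eqxx.
- exists (cm_lmul z g); rewrite eqxx /=; apply/eqP.
  by rewrite rcoset_of_lmul ?mem_gen ?set11.
move=> /eqP/esym/rcoset_of_eq; rewrite gen_z !inE => /orP[] /eqP kg.
  by left; apply/eqP; congr rcoset_of; apply: val_inj; apply/(mulIg (sgval g)^-1);
    rewrite kg mulgV.
right; apply/eqP; congr rcoset_of; apply: val_inj.
by rewrite /= subgK // -kg mulgKV.
Qed.

(** An edge joining two given cosets has a unique representative in the first
    one, so the edges from [Hg] to [Hzg] correspond to the elements [h] of [H]
    with [Hzhg = Hzg], which form [H :&: H :^ z]. *)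
Lemma coset_graph_multiple (S : sgraph) (phi : gT -> S) :
    {in G &, forall g k, (phi g == phi k) = (k * g^-1 \in H)} ->
    (forall s, exists2 g, g \in G & phi g = s) ->
    {in G, forall g, @sg_adj S (phi g) (phi (z * g))} ->
    (forall s, #|[set u | @sg_adj S s u]| <= #|H : H :&: H :^ z|) ->
  mg_iso coset_graph (multiple S #|H :&: H :^ z|).
Proof.
move=> phiE phi_surj adjz degS.
have Gz := cm_zG t; have sHG := tH_sub.
have GH h : h \in H -> h \in G by apply: subsetP.
have phiH h g : h \in H -> g \in G -> phi (h * g) = phi g.
  move=> Hh Gg; apply/esym/eqP.
  by rewrite phiE ?mulgK // groupM // GH.
pose nb g := [set phi (z * h * g) | h in H].
have phizE g h k : g \in G -> h \in H -> k \in H ->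
    (phi (z * h * g) == phi (z * k * g)) = (k * h^-1 \in H :&: H :^ z).
  move=> Gg Hh Hk; have [Gh Gk] := (GH h Hh, GH k Hk).
  have [Ghg Gkg] : z * h * g \in G /\ z * k * g \in G by rewrite !groupM.
  rewrite phiE // inE (groupM Hk) ?groupV //=.
  by rewrite mem_conjg tz_V !invMg tz_V conjgE tz_V !mulgA mulgK.
have nb_adj g : g \in G -> [set phi (z * h * g) | h in H] = [set u | @sg_adj S (phi g) u].
  move=> Gg; apply/eqP; rewrite eqEcard; apply/andP; split.
    apply/subsetP => _ /imsetP[h Hh ->]; rewrite inE -mulgA.
    by rewrite -(phiH h g) // adjz // groupM // GH.
  apply: leq_trans (degS _) _.
  rewrite -[#|H : _|](@card_in_imset _ _ (fun C => phi (z * repr C * g)));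
    last first.
    move=> _ _ /rcosetsP[h Hh ->] /rcosetsP[k Hk ->] /eqP.
    have sLH : H :&: H :^ z \subset H by apply: subsetIl.
    have repH k' : k' \in H -> repr ((H :&: H :^ z) :* k') \in H.
      move=> Hk'; have := mem_repr_rcoset (H :&: H :^ z)%G k'.
      by rewrite mem_rcoset => /(subsetP sLH); rewrite groupMr ?groupV.
    rewrite phizE ?repH // -mem_rcoset => /rcoset_eqP.
    by rewrite !rcoset_repr.
  apply/subset_leq_card/subsetP => _ /imsetP[C /rcosetsP[h Hh ->] ->].
  apply/imsetP; exists (repr ((H :&: H :^ z) :* h)) => //.
  have := mem_repr_rcoset (H :&: H :^ z)%G h.
  by rewrite mem_rcoset inE => /andP[+ _]; rewrite groupMr ?groupV.
pose f (C : rcoset_type G H) := phi (repr (val C)).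
have fE g : f (rcoset_of H g) = phi (sgval g).
  rewrite /f /=; have := mem_repr_rcoset H (sgval g).
  by rewrite mem_rcoset => Hr; rewrite -(phiH _ (sgval g) Hr) ?mulgKV ?subgP.
have f_inj : injective f.
  move=> C D; have [[g <-] [k <-]] := (rcoset_of_surj C, rcoset_of_surj D).
  by rewrite !fE => /eqP; rewrite phiE ?subgP // => gk; apply/rcoset_of_eq.
have f_bij : bijective f.
  apply: inj_card_bij => //; rewrite -(card_imset _ f_inj).
  apply/subset_leq_card/subsetP => s _; have [g Gg <-] := phi_surj s.
  have <- : sgval (subg G g) = g by rewrite subgK.
  by rewrite -fE; apply: imset_f.
have endsE g : f @: (mg_ends (rcoset_of <<[set z]>> g : mg_edge coset_graph)) =
    [set phi (sgval g); phi (z * sgval g)].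
  by rewrite coset_ends imsetU1 imset_set1 !fE cm_lmulE.
have edgeP e : f @: (mg_ends (e : mg_edge coset_graph)) \in sg_edges S.
  have [g <-] := rcoset_of_surj e; rewrite endsE inE.
  apply/existsP; exists (phi (sgval g)); apply/existsP; exists (phi (z * sgval g)).
  by rewrite eqxx adjz ?subgP.
pose fe e : {A : {set S} | A \in sg_edges S} :=
  @exist _ (fun A => is_true (A \in sg_edges S)) _ (edgeP e).
suff /fibre_bij[h [h_bij hE]] : forall A, #|[set e | fe e == A]| = #|H :&: H :^ z|.
  by exists f, h; split=> // e; rewrite /= hE.
case=> A SA; have := SA; rewrite inE => /existsP[s /existsP[u /andP[su /eqP defA]]].
have [g Gg def_s] := phi_surj s.
have : u \in [set phi (z * h * g) | h in H] by rewrite nb_adj // inE def_s.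
case/imsetP=> h0 Hh0 def_u.
rewrite -(card_rcoset _ h0).
have memL h : h \in (H :&: H :^ z) :* h0 -> h \in H.
  by rewrite mem_rcoset inE => /andP[+ _]; rewrite groupMr ?groupV.
have neq_su : s != u by apply: contraTneq su => ->; rewrite sg_irr.
rewrite -(@card_in_imset _ _ (fun h => rcoset_of <<[set z]>> (subg G (h * g)))).
  congr #|pred_of_set _|; apply/setP => e; rewrite inE -val_eqE /=.
  apply/eqP/imsetP => [|[h Lh ->]]; last first.
    have Hh := memL h Lh; have Ghg : h * g \in G := groupM (GH h Hh) Gg.
    rewrite endsE subgK // phiH // def_s defA.
    congr [set _; _]; apply/eqP; rewrite def_u mulgA phizE //.
    by rewrite -groupV invMg invgK -mem_rcoset.
  have key k : phi (sgval k) = s -> phi (z * sgval k) = u ->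
      exists2 h, h \in (H :&: H :^ z) :* h0 & k = subg G (h * g).
    move=> ks ku; exists (sgval k * g^-1); last first.
      by rewrite mulgKV; apply: val_inj; rewrite /= subgK ?subgP.
    move/eqP: ks; rewrite -def_s eq_sym phiE ?subgP // => Hkg.
    by rewrite mem_rcoset -(phizE g) // -def_u -ku mulgA mulgKV.
  have [k <-] := rcoset_of_surj e; rewrite endsE defA => /setP ends.
  have := ends s; have := ends u; rewrite !inE !eqxx orbT /=.
  have [ks _ _ | ks] := eqVneq s (phi (sgval k)).
    have:= ends u; rewrite !inE eqxx orbT -ks eq_sym (negbTE neq_su) /=.
    by move/eqP/esym/(key _ (esym ks)) => [h Lh ->]; exists h.
  move=> uk /eqP sk; move: uk.
  have -> : (u == phi (z * sgval k)) = false by rewrite -sk eq_sym (negbTE neq_su).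
  rewrite orbF => /eqP uk.
  have [||h Lh kE] := key (cm_lmul z k).
  - by rewrite cm_lmulE.
  - by rewrite cm_lmulE // mulgA tz_sq mul1g.
  by exists h; rewrite // -kE rcoset_of_lmul // mem_gen ?set11.
move=> h k Lh Lk /rcoset_of_eq; have [Hh Hk] := (memL h Lh, memL k Lk).
rewrite !subgK ?(groupM (GH _ _) Gg) // invMg mulgA mulgK gen_z !inE => /orP[] /eqP E.
  by apply/esym/(mulIg h^-1); rewrite mulgV.
by have := cm_z_notin t; rewrite -E groupM ?groupV.
Qed.

Lemma tH_lt : 1 < #|G : H|.
Proof. exact: leq_trans (t_index t). Qed.

Lemma tG_gen : G \subset <<z |: H>>.
Proof.
rewrite {1}(t_gen t) gen_subG subUset sub1set.
rewrite (subset_trans _ (subset_gen _)) ?mem_gen ?setU11 //.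
by rewrite (subset_trans (subset_gen _)) ?subsetUr.
Qed.

Lemma card_meet k : #|H : H :&: H :^ z| = k -> #|H :&: H :^ z| = #|H| %/ k.
Proof. by move=> <-; rewrite -(Lagrange (subsetIl H (H :^ z)%G)) mulnK ?indexg_gt0. Qed.

(** A vertex has [|H : H :&: H :^ z|] neighbours, so connectedness forces a cycle. *)
Lemma coset_graph_cycle :
    #|H : H :&: H :^ z| = 2 ->
  mg_iso coset_graph (multiple (cycle_graph #|G : H|) (#|H| %/ 2)).
Proof.
move=> iL; rewrite -(card_meet iL).
have [phi [phiE phi_surj adjz]] :=
  cycle_labelling tH_sub (cm_zG t) tz_sq tG_gen iL erefl tH_lt.
apply: (@coset_graph_multiple (cycle_graph _) phi) => // s.
by rewrite iL; apply: cycle_degree.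
Qed.

(** Four vertices with three neighbours each are pairwise adjacent. *)
Lemma coset_graph_complete4 :
    #|G : H| = 4 -> #|H : H :&: H :^ z| = 3 ->
  mg_iso coset_graph (multiple (complete_graph 4) (#|H| %/ 3)).
Proof.
move=> iH iL; rewrite -(card_meet iL).
have [phi [phiE phi_surj]] := coset_labelling iH.
apply: (@coset_graph_multiple (complete_graph 4) phi) => // [g Gg | s].
  have Gzg : z * g \in G by rewrite groupM ?cm_zG.
  by rewrite /= /complete_adj phiE // mulgK cm_z_notin.
rewrite iL -ltnS; apply: leq_trans (_ : #|[set: 'I_4]| <= 4); last by rewrite cardsT card_ord.
rewrite [X in _ < X](cardsD1 s) inE ltnS.
by apply/subset_leq_card/subsetP => u; rewrite !inE andbT eq_sym.
Qed.

(** The cosets of [T] wind into a cycle and each is the union of two vertices;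
    a vertex has four neighbours, hence all those in the two adjacent blocks. *)
Lemma coset_graph_lex (T : {group gT}) :
    H \subset T -> T \subset G -> #|T : H| = 2 -> #|T : T :&: T :^ z| = 2 ->
    1 < #|G : T| -> #|H : H :&: H :^ z| = 4 ->
  mg_iso coset_graph
    (multiple (sg_lex (cycle_graph #|G : T|) (edgeless_graph 2)) (#|H| %/ 4)).
Proof.
move=> sHT sTG iHT iLT iT iL; rewrite -(card_meet iL).
have Gz := cm_zG t.
have genT : G \subset <<z |: T>>.
  by apply: subset_trans tG_gen _; rewrite genS // setUS.
have [f [fE f_surj adjz]] := cycle_labelling sTG Gz tz_sq genT iLT erefl iT.
have [tau Ttau nHtau] : exists2 tau, tau \in T & tau \notin H.
  by apply/subsetPn; rewrite -indexg_eq1 iHT.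
have GT g : g \in T -> g \in G by apply: subsetP.
pose F (C : rcoset_type G H) := f (repr (val C)).
have FE g : F (rcoset_of H g) = f (sgval g).
  have := mem_repr_rcoset H (sgval g); rewrite mem_rcoset => Hr.
  have Grg : repr (H :* sgval g) \in G.
    by rewrite -(mulgKV (sgval g) (repr _)) groupM ?subgP ?GT ?(subsetP sHT).
  by apply/eqP; rewrite eq_sym fE ?subgP // (subsetP sHT).
have fibre i : #|[set C | F C == i]| = 2.
  have [g Gg <-] := f_surj i.
  have Gtg : tau * g \in G := groupM (GT tau Ttau) Gg.
  have -> : [set C | F C == f g] =
      [set rcoset_of H (subg G g); rcoset_of H (subg G (tau * g))].
    apply/setP => C; have [k <-] := rcoset_of_surj C.
    rewrite !inE FE eq_sym fE ?subgP //; apply/idP/orP => [Tkg | [] /eqP/rcoset_of_eq].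
    - case Hkg: (sgval k * g^-1 \in H).
        by left; apply/eqP/esym/rcoset_of_eq; rewrite subgK.
      right; apply/eqP/esym/rcoset_of_eq; rewrite subgK // invMg mulgA.
      rewrite -mem_rcoset (rcoset_index2 sHT iHT) in_setD ?nHtau ?Hkg //.
    - by rewrite subgK // -groupV invMg invgK => /(subsetP sHT).
    rewrite subgK // -groupV invMg invgK => /(subsetP sHT).
    by rewrite invMg mulgA (groupMr _ (groupVr Ttau)).
  rewrite cards2 (_ : _ != _) //; apply/eqP => /rcoset_of_eq.
  by rewrite !subgK // mulgK (negbTE nHtau).
have [h [h_bij hF]] := fibre_bij fibre.
pose phi g := h (rcoset_of H (subg G g)).
apply: (@coset_graph_multiple (sg_lex (cycle_graph _) (edgeless_graph 2)) phi) => [g k Gg Gk | s | g Gg | s].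
- rewrite (inj_eq (bij_inj h_bij)).
  by apply/eqP/idP => [/rcoset_of_eq | Hkg]; [|apply/rcoset_of_eq]; rewrite !subgK.
- have [h' _ h'K] := h_bij; have [g gE] := rcoset_of_surj (h' s).
  by exists (sgval g); [exact: subgP | rewrite /phi sgvalK gE h'K].
- rewrite /= /lex_adj !hF !FE !subgK ?groupM //; apply/orP; left.
  exact: adjz.
rewrite iL; apply: leq_trans (_ : #|setX [set u | cycle_adj s.1 u] [set: 'I_2]| <= 4).
  by apply/subset_leq_card/subsetP => u; rewrite !inE /= /lex_adj andbF orbF andbT.
by rewrite cardsX cardsT card_ord (leq_mul (cycle_degree _) (leqnn 2)).
Qed.

(** The powers of [c] label the cosets of [H] by [Z/mn], that is by
    [Z/m * Z/n], and conjugation by [H] changes the signs of the two components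
    of [c] independently. *)
Lemma coset_graph_direct (c : gT) (m n : nat) :
    1 < m -> 1 < n -> coprime m n -> c \in G -> G \subset H * <[c]> ->
    #|G : H| = (m * n)%N -> z * c^-1 \in H ->
    (forall h, h \in H -> exists k, [/\ c ^ h = c ^+ k,
       (k == 1 %[mod m]) || (k.+1 == 0 %[mod m]) &
       (k == 1 %[mod n]) || (k.+1 == 0 %[mod n])]) ->
    #|H : H :&: H :^ z| = 4 ->
  mg_iso coset_graph
    (multiple (sg_direct (cycle_graph m) (cycle_graph n)) (#|H| %/ 4)).
Proof.
move=> m_gt1 n_gt1 co_mn Gc GHc iH zc cH iL; rewrite -(card_meet iL).
have [f [fE fH f_uniq _]] := cyclic_transversal tH_sub Gc GHc iH.
have [m_gt0 n_gt0] := (ltnW m_gt1, ltnW n_gt1).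
pose phi g := (Ordinal (ltn_pmod (f g) m_gt0), Ordinal (ltn_pmod (f g) n_gt0)).
have adj_mod d (d_gt0 : 0 < d) i j k : 1 < d ->
    (k == 1 %[mod d]) || (k.+1 == 0 %[mod d]) -> j = k + i %[mod d] ->
    cycle_adj (Ordinal (ltn_pmod i d_gt0)) (Ordinal (ltn_pmod j d_gt0)).
  move=> d_gt1 kd jki; rewrite /cycle_adj -val_eqE /= modn_mod -addn1 modnDml.
  rewrite -[(_ %% _).+1]addn1 modnDml modn_mod.
  have neq a : a.+1 != a %[mod d].
    rewrite -[a in X in _ != X]addn0 -addn1 eqn_modDl.
    by rewrite !modn_small.
  case/orP: kd => /eqP kd.
    have -> : j %% d = i.+1 %% d by rewrite jki -modnDml kd modnDml.
    by rewrite addn1 eqxx eq_sym neq.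
  have E : j.+1 %% d = i %% d.
    by rewrite -addn1 -modnDml jki modnDml addn1 -addSn -modnDml kd mod0n add0n.
  rewrite !addn1 E eqxx orbT andbT; apply/eqP => ij.
  by have := neq j; rewrite E ij eqxx.
apply: (@coset_graph_multiple (sg_direct (cycle_graph _) (cycle_graph _)) phi) => [g k Gg Gk | s | g Gg | s].
- rewrite xpair_eqE -!val_eqE /= -chinese_remainder //.
  by rewrite !modn_small // val_eqE fE.
- pose N := chinese m n s.1 s.2; exists (c ^+ N); first by rewrite groupX.
  have fN : N = f (c ^+ N) %[mod m * n].
    by apply: f_uniq; rewrite ?groupX // mulgV.
  rewrite /phi [s]surjective_pairing; congr (_, _); apply: val_inj => /=.
    rewrite -(modn_dvdm _ (dvdn_mulr n (dvdnn m))) -fN modn_dvdm ?dvdn_mulr //.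
    by rewrite chinese_modl // modn_small.
  rewrite -(modn_dvdm _ (dvdn_mull m (dvdnn n))) -fN modn_dvdm ?dvdn_mull //.
  by rewrite chinese_modr // modn_small.
- have Hg := fH g Gg; have [k [ck km kn]] := cH _ Hg; have Gz := cm_zG t.
  have fzg : k + f g = f (z * g) %[mod m * n].
    apply: f_uniq; first by rewrite groupM.
    have -> : z * g * c ^- (k + f g) = (z * c^-1) * (g * c ^- f g).
      rewrite expgD invMg -ck -conjVg conjgE -!mulgA; congr (z * _).
      by rewrite mulgA mulKVg.
    by rewrite groupM.
  have mod_of d : d %| m * n -> f (z * g) = k + f g %[mod d].
    by move=> dmn; rewrite -(modn_dvdm _ dmn) -fzg modn_dvdm.
  apply/andP; split; apply: (adj_mod _ _ _ _ k) => //; apply: mod_of.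
    exact: dvdn_mulr.
  exact: dvdn_mull.
rewrite iL; apply: leq_trans (_ : #|setX [set u | cycle_adj s.1 u] [set u | cycle_adj s.2 u]| <= 4).
  by apply/subset_leq_card/subsetP => u; rewrite !inE /= /direct_adj.
by rewrite cardsX (leq_mul (cycle_degree _) (cycle_degree _)).
Qed.

End CosetGraph.

(** * Dihedral subgroups generated by two involutions *)

Section TwoInvolutions.

Variables (gT : finGroupType) (a b : gT).
Hypotheses (oa : #[a] = 2) (ob : #[b] = 2).

Local Notation D := <<[set a; b]>>%G.
Local Notation r := (a * b).

Lemma invol_sq (c : gT) : #[c] = 2 -> c * c = 1.
Proof. by move=> oc; rewrite -expg2 -oc expg_order. Qed.

Lemma invol_inv (c : gT) : #[c] = 2 -> c^-1 = c.
Proof. by move=> oc; apply: (mulgI c); rewrite mulgV invol_sq. Qed.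

Lemma invol_neq1 (c : gT) : #[c] = 2 -> c != 1.
Proof. by move=> oc; rewrite -order_gt1 oc. Qed.

Lemma dih_invl : r ^ a = r^-1.
Proof. by rewrite invMg !invol_inv // conjgE invol_inv // !mulgA invol_sq // mul1g. Qed.

Lemma dih_invr : r ^ b = r^-1.
Proof.
by rewrite invMg !invol_inv // conjgE invol_inv // -!mulgA invol_sq // mulg1.
Qed.

Lemma dih_l : a \in D. Proof. by rewrite mem_gen ?set21. Qed.
Lemma dih_r : b \in D. Proof. by rewrite mem_gen ?set22. Qed.
Lemma dih_rot : <[r]> \subset D.
Proof. by rewrite cycle_subG groupM ?dih_l ?dih_r. Qed.

Lemma dih_inv_rot c : c \in <[r]> -> c ^ a = c^-1 /\ c ^ b = c^-1.
Proof.
case/cycleP=> i ->; by rewrite !conjXg dih_invl dih_invr expgVn.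
Qed.

Lemma dih_cases g : g \in D -> (g \in <[r]>) || (a * g \in <[r]>).
Proof.
have aa := invol_sq oa; have bb := invol_sq ob.
have /subsetP sD : D \subset [set g | (g \in <[r]>) || (a * g \in <[r]>)].
  apply: gen_lmul_sub => [|c k]; rewrite ?inE ?group1 //.
  case/orP=> /eqP ->; first by rewrite mulgA aa mul1g orbC.
  case/orP=> [rk | rak]; apply/orP; [right | left].
    by rewrite mulgA groupM ?cycle_id.
  have -> : b * k = r^-1 * (a * k) by rewrite invMg !invol_inv // -mulgA (mulgA a) aa mul1g.
  by rewrite groupM ?groupV ?cycle_id.
by move/sD; rewrite inE.
Qed.

Lemma dih_out_sq g : g \in D -> g \notin <[r]> -> g * g = 1.
Proof.
move=> Dg nrg; have := dih_cases Dg; rewrite (negbTE nrg) /= => rag.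
have [E _] := dih_inv_rot rag.
have -> : g * g = (a * g) ^ a * (a * g).
  by rewrite conjgE invol_inv // -!mulgA !(mulgA a a) (invol_sq oa) !mul1g.
by rewrite E mulVg.
Qed.

Lemma dih_card_le : #|D| <= 2 * #[r].
Proof.
have sD : D \subset <[r]> :|: a *: <[r]>.
  apply/subsetP => g /dih_cases; rewrite inE mem_lcoset invol_inv //.
apply: leq_trans (subset_leq_card sD) _.
apply: leq_trans (leq_card_setU _ _) _.
by rewrite card_lcoset mul2n addnn.
Qed.

Lemma dih_index : #|D : <[r]>| <= 2.
Proof.
by rewrite -(leq_pmul2l (order_gt0 r)) (Lagrange dih_rot) mulnC dih_card_le.
Qed.

Lemma dih_notin : a != b -> a \notin <[r]>.
Proof.
move=> nab; apply/negP => ra; have [aV _] := dih_inv_rot (cycle_id r).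
have rr : r ^+ 2 = 1.
  have ca : r ^ a = r by apply/conjg_fixP/commgP; apply: (centsP (cycle_abelian r)); rewrite ?cycle_id.
  by rewrite expgS expg1 -{1}ca aV mulVg.
have o2 : #[r] %| 2 by rewrite order_dvdn rr.
have : #[a] %| #[r] by rewrite order_dvdG.
rewrite oa => d2; have or2 : #[r] = 2 by apply/eqP; rewrite eqn_dvd o2 d2.
move: ra; rewrite cycle2g // !inE (negbTE (invol_neq1 oa)) /=.
by rewrite -{1}[a]mulg1 (inj_eq (mulgI a)) eq_sym (negbTE (invol_neq1 ob)).
Qed.

Lemma dih_card : a != b -> #|D| = (2 * #[r])%N.
Proof.
move/dih_notin => nra; apply/eqP; rewrite eqn_leq dih_card_le /=.
rewrite -(Lagrange dih_rot) mulnC leq_pmul2l ?order_gt0 //.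
have : #|D : <[r]>| != 1%N.
  by rewrite indexg_eq1; apply: contra nra => /subsetP -> //; apply: dih_l.
by case: #|_ : _| (indexg_gt0 D <[r]>) => [|[|k]].
Qed.

(** The elements of [D] outside [<[r]>] have order 2. *)
Lemma dih_odd_sub (P : {group gT}) : P \subset D -> odd #|P| -> P \subset <[r]>.
Proof.
move=> sPD oP; apply/subsetP => g Pg; apply/negP => /negP nrg.
have := dih_out_sq (subsetP sPD g Pg) nrg => gg.
have o2 : #[g] %| 2 by rewrite order_dvdn expgS expg1 gg.
have o1 : #[g] %| #|P| by apply: order_dvdG.
have : #[g] %| 1.
  rewrite -(eqP (_ : gcdn 2 #|P| == 1%N)) ?dvdn_gcd ?o2 //.
  by rewrite -[_ == _]/(coprime 2 #|P|) coprime2n.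
by rewrite dvdn1 order_eq1 => /eqP g1; rewrite g1 group1 in nrg.
Qed.

End TwoInvolutions.

(** * Solvable groups generated by involutions *)

(** Otherwise the last term of the derived series of ['C_G('F(G))] outside ['F(G)]
    would be nilpotent of class 2, as its derived subgroup lies in ['F(G)], which
    it centralises. *)
Lemma solvable_cent_Fitting (gT : finGroupType) (G : {group gT}) :
  solvable G -> 'C_G('F(G)) \subset 'F(G).
Proof.
move=> solG; set F := 'F(G); pose C := 'C_G(F)%G.
have nCG : C <| G.
  rewrite /normal subsetIl normsI ?normG //.
  exact: subset_trans (normal_norm (Fitting_normal G)) (cent_norm _).
have /derivedP[n Cn] : solvable C := solvableS (subsetIl _ _) solG.
have : C^`(n) \subset F by rewrite Cn sub1G.
elim: {Cn}n => [|n IHn] sCnF; first by rewrite derg0 in sCnF.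
apply: IHn; apply: Fitting_max; first exact: gFnormal_trans nCG.
apply/lcnP; exists 2; rewrite lcnSn lcn2; apply/commG1P.
apply: (subset_trans (sCnF : (C^`(n))^`(1) \subset F)); rewrite centsC.
exact: subset_trans (der_sub n C) (subsetIr _ _).
Qed.

Section OddAction.

Variables (gT : finGroupType) (G N : {group gT}) (X : {set gT}).
Hypotheses (genG : G = <<X>> :> {set gT}) (invX : {in X, forall u, u * u = 1}).
Hypotheses (nNG : N <| G) (cycN : cyclic N).

(** Automorphisms of a cyclic group commute, so those induced by [G] form an
    elementary abelian 2-group, as those induced by the generators square to 1. *)
Lemma sq_cent_cyclic g : g \in G -> g ^+ 2 \in 'C(N).
Proof.
have /cyclicP[a defN] := cycN.
have pow h : h \in G -> exists k, a ^ h = a ^+ k.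
  move=> Gh; apply/cycleP; rewrite -defN memJ_norm ?defN ?cycle_id //.
  by rewrite -defN (subsetP (normal_norm nNG)).
have sXG : X \subset G by rewrite genG subset_gen.
have /subsetP sG : G \subset [set g in G | a ^ (g ^+ 2) == a].
  rewrite {1}genG; apply: gen_lmul_sub => [|u h]; rewrite !inE.
    by rewrite group1 expg1n conjg1 eqxx.
  move=> Xu /andP[Gh /eqP ah]; have Gu := subsetP sXG u Xu.
  rewrite groupM //=; have [[k ak] [l al]] := (pow u Gu, pow h Gh).
  move: ah; rewrite !expg2 => ah.
  have au : (a ^+ k) ^+ k = a.
    by rewrite -ak -conjXg -ak -conjgM invX // conjg1.
  have {}ah : (a ^+ l) ^+ l = a by rewrite -al -conjXg -al -conjgM.
  have auh : a ^ (u * h) = a ^+ (l * k) by rewrite conjgM ak conjXg al -expgM.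
  apply/eqP; rewrite conjgM auh conjXg auh -expgM mulnACA expgM.
  by rewrite [a ^+ (l * l)]expgM ah expgM au.
move/sG; rewrite inE => /andP[_ /eqP ag].
rewrite defN cent_cycle; apply/cent1P.
exact/commute_sym/commgP/conjg_fixP.
Qed.

(** An element of odd order is a power of its square. *)
Lemma odd_cent_cyclic g : g \in G -> odd #[g] -> g \in 'C(N).
Proof.
move=> Gg og; have -> : g = (g ^+ 2) ^+ (#[g].+1)./2.
  by rewrite -expgM mul2n even_halfK ?negbK //= expgS expg_order mulg1.
by rewrite groupX // sq_cent_cyclic.
Qed.

End OddAction.

(** The automorphism group of a cyclic 2-group is a 2-group, so [g] centralises the
    cyclic subgroups that it normalises. If [K] has elements of order above 2 they
    all lie in [C], which is then normalised by [g], hence fixed pointwise; and [g]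
    multiplies the elements of [K] outside [C] by a constant of odd order, that is
    by 1. So [K] has exponent 2, and its cyclic subgroup [C] has order at most 2. *)
Lemma odd_action_klein (gT : finGroupType) (K C : {group gT}) (g : gT) :
    2.-group K -> C \subset K -> cyclic C -> #|K : C| <= 2 ->
    {in K, forall k, k \notin C -> k * k = 1} ->
    g \in 'N(K) -> odd #[g] -> g \notin 'C(K) ->
  2.-abelem K /\ #|K| = 4.
Proof.
move=> pK sCK cycC iC outC nKg og ncKg.
have cent_cyclic (A : {group gT}) : 2.-group A -> cyclic A -> g \in 'N(A) -> g \in 'C(A).
  move=> pA cycA nAg.
  rewrite -ker_conj_aut; apply/kerP => //; apply/eqP; rewrite -order_eq1 -dvdn1.
  have d1 : #[conj_aut A g] %| #[g] by apply: morph_order.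
  have d2 : #[conj_aut A g] %| totient #|A|.
    rewrite -card_Aut_cyclic // order_dvdG //.
    by apply: (subsetP (Aut_conj_aut A 'N(A))); rewrite mem_morphim.
  have o_tot : coprime #[g] (totient #|A|).
    rewrite (card_pgroup pA); case: (logn 2 #|A|) => [|e]; first by rewrite coprimen1.
    by rewrite totient_pfactor // mul1n coprimeXr // coprimen2.
  by rewrite -(eqP o_tot) dvdn_gcd d1 d2.
have ncycK : ~~ cyclic K by apply: contra ncKg => cK; apply: cent_cyclic.
have pC : 2.-group C := pgroupS sCK pK.
have [exp2 | [k Kk kk]] : {in K, forall k, k * k = 1} \/ exists2 k, k \in K & k * k != 1.
  have [/forall_inP allK | ] := boolP [forall k in K, k * k == 1].
    by left => k /allK /eqP.
  by rewrite negb_forall_in => /exists_inP[k Kk kk]; right; exists k.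
  have abK : 2.-abelem K.
    by apply: exponent2_abelem; apply/exponentP => k Kk; rewrite expg2 exp2.
  split=> //; have C_le2 : #|C| <= 2.
    have [c defC] := cyclicP cycC; rewrite defC; apply: dvdn_leq => //.
    by rewrite order_dvdn expg2 exp2 // (subsetP sCK) // defC cycle_id.
  have K_le4 : #|K| <= 4 by rewrite -(Lagrange sCK) (leq_mul C_le2 iC).
  move: ncycK K_le4; rewrite (card_pgroup pK).
  have := card_pgroup pK; case: (logn 2 #|K|) => [|[|[|e]]] //.
  - by move/eqP; rewrite -trivg_card1 => /eqP ->; rewrite cyclic1.
  - by move=> oK; rewrite prime_cyclic ?oK.
  by move=> _ _; rewrite -[4]/(2 ^ 2)%N leq_exp2l.
case/negP: ncKg.
have big_C u : u \in K -> u * u != 1 -> u \in C.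
  by move=> Ku; apply: contraR => /(outC u Ku) ->.
have [c defC] := cyclicP cycC.
have Cc : c \in C by rewrite defC cycle_id.
have Kc : c \in K := subsetP sCK c Cc.
have cc : c * c != 1.
  have := big_C k Kk kk; rewrite defC => /cycleP[i ki]; apply: contra kk => /eqP cc.
  by rewrite ki -expgD addnn -mul2n expgM expg2 cc expg1n.
have Kcg u : u \in K -> u ^ g \in K by move=> Ku; rewrite memJ_norm.
have nCg : g \in 'N(C).
  rewrite inE {1}defC -cycleJ cycle_subG big_C ?Kcg //.
  by rewrite -conjMg conjg_eq1.
have /centP cCg := cent_cyclic C pC cycC nCg.
apply/centP => u Ku; have [Cu | nCu] := boolP (u \in C); first exact: cCg.
have iC2 : #|K : C| = 2.
  have : #|K : C| != 1%N.
    by rewrite indexg_eq1; apply: contra nCu => /subsetP ->.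
  by case: #|_ : _| (indexg_gt0 K C) iC => [|[|[|]]].
(* [u ^ g = l * u] with [l] fixed by [g], so [l] has odd order *)
pose l := u ^ g * u^-1.
have nCug : u ^ g \notin C by rewrite -{1}(normP nCg) memJ_conjg.
have Cl : l \in C.
  rewrite -mem_rcoset (rcoset_index2 sCK iC2) inE ?nCu ?Ku // nCug Kcg //.
have lg : l ^ g = l by apply/conjg_fixP/commgP; apply: commute_sym; apply: cCg.
have ug i : u ^ (g ^+ i) = l ^+ i * u.
  elim: i => [|i IHi]; first by rewrite conjg1 mul1g.
  by rewrite expgSr conjgM IHi conjMg conjXg lg expgSr -mulgA /l mulgKV.
have l1 : l = 1.
  apply/eqP; rewrite -order_eq1 -dvdn1.
  have d1 : #[l] %| #[g].
    by rewrite order_dvdn; apply/eqP/(mulIg u); rewrite -ug expg_order conjg1 mul1g.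
  have co : coprime #[g] #[l].
    by rewrite coprime_sym (pnat_coprime (mem_p_elt pC Cl)) // -odd_2'nat.
  by rewrite -(eqP co) dvdn_gcd d1 dvdnn.
by apply/commute_sym/commgP/conjg_fixP; move: l1 => /eqP; rewrite -eq_mulgV1 => /eqP.
Qed.

(** The two factors will be the length of an orbit on the three involutions of a
    Klein group and the index of the kernel in a stabilizer. *)
Lemma dvd6 n1 n2 d : 0 < n1 -> n1 <= 3 -> 0 < n2 -> n2 <= 2 ->
  ~~ odd (n1 * n2) -> d %| n1 * n2 -> odd d -> d != 1%N -> (n1 * n2)%N = 6.
Proof.
move=> n1_gt0 n1_le3 n2_gt0 n2_le2 even_n dn.
have : d <= n1 * n2 by rewrite dvdn_leq // muln_gt0 n1_gt0.
case: n1 n1_gt0 n1_le3 even_n dn => [|[|[|[|]]]] // _ _;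
  case: n2 n2_gt0 n2_le2 => [|[|[|]]] // _ _;
  by case: d => [|[|[|[|[|d]]]]].
Qed.

Section KleinNormal.

Variables (gT : finGroupType) (G K : {group gT}).
Hypotheses (nKG : K <| G) (abK : 2.-abelem K) (oK : #|K| = 4).

Lemma klein_sq k : k \in K -> k * k = 1.
Proof. by move=> Kk; have /abelemP[//|_ /(_ k Kk)] := abK; rewrite expg2. Qed.

Lemma klein_comm : {in K &, forall k l, k * l = l * k}.
Proof. by move=> k l Kk Kl; apply: (centsP (abelem_abelian abK)). Qed.

Lemma klein_gen a b :
  a \in K -> b \in K -> a != 1 -> b != 1 -> a != b -> <<[set a; b]>> = K.
Proof.
move=> Ka Kb na nb nab; apply/eqP; rewrite eqEcard gen_subG subUset !sub1set Ka Kb /=.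
have sD : <<[set a; b]>> \subset K by rewrite gen_subG subUset !sub1set Ka Kb.
have c3 : 3 <= #|<<[set a; b]>>|.
  have s3 : 1 |: [set a; b] \subset <<[set a; b]>>.
    by rewrite subUset sub1set group1 subset_gen.
  apply: leq_trans (subset_leq_card s3); rewrite cardsU1 cards2 nab !inE.
  by rewrite ![1 == _]eq_sym negb_or na nb.
by have := cardSg sD; rewrite oK; case: #|_| c3 => [|[|[|[|n]]]].
Qed.

Lemma klein_cases a b k : a \in K -> b \in K -> a != 1 -> b != 1 -> a != b ->
  k \in K -> k \in [:: 1; a; b; a * b].
Proof.
move=> Ka Kb na nb nab Kk.
have nab1 : a * b != 1.
  by apply: contra nab => /eqP ab1; rewrite -(inj_eq (mulIg b)) ab1 klein_sq.
have naab : a != a * b by rewrite -{1}(mulg1 a) (inj_eq (mulgI a)) eq_sym.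
have nbab : b != a * b by rewrite -{1}(mul1g b) (inj_eq (mulIg b)) eq_sym.
have /card_uniqP us : uniq [:: 1; a; b; a * b].
  by rewrite /= !inE !negb_or ![1 == _]eq_sym na nb nab1 nab naab nbab.
have sK : [:: 1; a; b; a * b] \subset K.
  by apply/subsetP => u; rewrite !inE => /or4P[] /eqP ->; rewrite ?group1 ?groupM.
by rewrite (subset_cardP _ sK) // us oK.
Qed.

Lemma klein_orbit a : a \in K -> a != 1 -> #|G : 'C_G[a]| <= 3.
Proof.
move=> Ka na; rewrite index_cent1.
have : a ^: G \subset K :\ 1.
  apply/subsetP => _ /imsetP[g Gg ->]; rewrite !inE conjg_eq1 na.
  by rewrite memJ_norm // (subsetP (normal_norm nKG)).
by move/subset_leq_card; have := cardsD1 1 K; rewrite group1 oK add1n => -[<-].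
Qed.

Lemma klein_stab a : a \in K -> a != 1 -> #|'C_G[a] : 'C_G(K)| <= 2.
Proof.
move=> Ka na; have [b Kb nb] : exists2 b, b \in K & b \notin [set 1; a].
  apply/subsetPn; apply/negP => /subset_leq_card; rewrite oK cards2.
  by case: (_ != _).
rewrite !inE negb_or in nb; have /andP[nb1 nba] := nb.
have -> : 'C_G(K) = 'C_('C_G[a])[b].
  rewrite -(klein_gen Ka Kb) // 1?eq_sym // cent_gen.
  by apply/setP => g; rewrite centU !cent_set1 !in_setI andbA.
rewrite index_cent1; have : b ^: 'C_G[a] \subset K :\: [set 1; a].
  apply/subsetP => _ /imsetP[g /setIP[Gg /cent1P ga] ->]; rewrite !inE conjg_eq1 negb_or nb1.
  rewrite memJ_norm ?(subsetP (normal_norm nKG)) // Kb andbT.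
  have ag : a ^ g = a by apply/conjg_fixP/commgP.
  by rewrite -[X in _ == X]ag (inj_eq (conjg_inj g)).
move/subset_leq_card; have s1a : [set 1; a] \subset K.
  by rewrite subUset !sub1set group1.
by rewrite cardsD (setIidPr s1a) cards2 oK eq_sym na.
Qed.

Lemma klein_subcent a : a \in K -> 'C_G(K) \subset 'C_G[a].
Proof. by move=> Ka; rewrite setIS // -cent_cycle centS // cycle_subG. Qed.

Lemma klein_index a : a \in K -> a != 1 ->
  #|G : 'C_G(K)| = (#|G : 'C_G[a]| * #|'C_G[a] : 'C_G(K)|)%N.
Proof.
by move=> Ka na; rewrite (Lagrange_index (subsetIl _ _) (klein_subcent Ka)).
Qed.

End KleinNormal.

(** A solvable group is controlled by its action on its Fitting subgroup. Here
    the odd part [N] of the latter is cyclic, so it is centralised by all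
    elements of odd order, and the 2-part lies in a dihedral group; if elements
    of odd order also centralise the 2-part then they all lie in [N], otherwise
    the 2-part is a Klein group, of automorphism group [S_3]. *)
Lemma involution_generated_structure (gT : finGroupType) (G S R : {group gT}) (X : {set gT}) :
    solvable G -> G = <<X>> :> {set gT} -> {in X, forall u, u * u = 1} ->
    (forall p (P : {group gT}), odd p -> p.-Sylow(G) P -> cyclic P) ->
    2.-Sylow(G) S -> cyclic R -> #|S : S :&: R| <= 2 ->
    {in S, forall s, s \notin R -> s * s = 1} ->
  (exists N : {group gT}, [/\ N <| G, cyclic N, odd #|N| & 2.-group (G / N)]) \/
  (exists K N : {group gT},
    [/\ K <| G /\ N <| G, 2.-abelem K /\ #|K| = 4, cyclic N /\ odd #|N|,
        K \x N = 'C_G(K) & #|G : 'C_G(K)| = 6]).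
Proof.
move=> solG genG invX cycP sylS cycR iS outR.
pose F := 'F(G)%G; pose N0 := 'O_2^'(F)%G; pose K := 'O_2(G)%G.
have nN0G : N0 <| G by rewrite gFnormal_trans ?Fitting_normal.
have nKG : K <| G by apply: pcore_normal.
have defF : K \x N0 = F by rewrite /= -p_core_Fitting nilpotent_pcoreC ?Fitting_nil.
have oddN0 : odd #|N0| by rewrite odd_2'nat; apply: pcore_pgroup.
have cyc_nil (A : {group gT}) : A \subset F -> odd #|A| -> cyclic A.
  move=> sAF oA; apply: nil_Zgroup_cyclic; last exact: nilpotentS sAF (Fitting_nil G).
  apply/forall_inP => V /SylowP[p pr_p sylV].
  have [_ pV _] := and3P sylV.
  have sAG : A \subset G := subset_trans sAF (Fitting_sub G).
  have [P sylP sVP] := Sylow_superset (subset_trans (pHall_sub sylV) sAG) pV.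
  have [odd_p | p2] := boolP (odd p); last first.
    have V1 : V :=: 1.
      apply: card1_trivg; apply: (@pnat_1 2); last first.
        by rewrite -odd_2'nat (dvdn_odd (cardSg (pHall_sub sylV))).
      by case/even_prime: pr_p p2 => [<- // | ->].
    by rewrite V1 cyclic1.
  exact: cyclicS sVP (cycP p P odd_p sylP).
have cycN0 : cyclic N0.
  by apply: cyc_nil => //; have [_ /mulG_sub[]] := dprodP defF.
have odd_cent g : g \in G -> odd #[g] -> g \in 'C(N0).
  exact: (odd_cent_cyclic genG invX nN0G cycN0).
have in_F g : g \in G -> odd #[g] -> g \in 'C(K) -> g \in N0.
  move=> Gg og cKg; have Fg : g \in F.
    apply: (subsetP (solvable_cent_Fitting solG)); rewrite inE Gg /=.
    by have [_ <- _ _] := dprodP defF; rewrite centM inE cKg odd_cent.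
  have hallN0 : 2^'.-Hall(F) N0 := nilpotent_pcore_Hall _ (Fitting_nil G).
  by rewrite (mem_normal_Hall hallN0) ?pcore_normal // /p_elt -odd_2'nat.
have indexR (A : {group gT}) : A \subset S -> #|A : A :&: R| <= 2.
  move=> sAS; rewrite (_ : A :&: R = A :&: (S :&: R)); last first.
    by rewrite setIA (setIidPl sAS).
  by rewrite indexgI (leq_trans (subset_leq_card (imsetS _ sAS))).
have sKS : K \subset S by apply: pcore_sub_Hall.
have [/forall_inP allc | ] := boolP [forall g in G, odd #[g] ==> (g \in 'C(K))].
  left; exists N0; split=> //; apply/pgroupP => p pr_p pdv.
  have [u Qu ou] := Cauchy pr_p pdv.
  case/morphimP: Qu ou => g Ng Gg -> og; rewrite inE /=; apply/idPn => p2.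
  have odd_p : odd p by case/even_prime: pr_p p2 => [-> | ->].
  have Ng0 : g.`_2^' \in N0.
    have Gg0 : g.`_2^' \in G by rewrite groupX.
    have og0 : odd #[g.`_2^'] by rewrite odd_2'nat; apply: p_elt_constt.
    by apply: in_F => //; have /implyP := allc _ Gg0; apply.
  have : (coset N0 g).`_2^' = coset N0 g.
    by apply: constt_p_elt; rewrite /p_elt -odd_2'nat [#[_]]og.
  rewrite -morph_constt //= coset_id // => g1.
  by move: og; rewrite /= -g1 order1 => p1; rewrite -p1 in pr_p.
rewrite negb_forall_in => /exists_inP[g Gg]; rewrite negb_imply => /andP[og ncg].
right; exists K.
have pS : 2.-group S := pHall_pgroup sylS.
have [abK oK] : 2.-abelem K /\ #|K| = 4.
  apply: (@odd_action_klein _ K (K :&: R)%G g) => //.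
  - exact: pcore_pgroup.
  - exact: subsetIl.
  - exact: cyclicS (subsetIr _ _) cycR.
  - exact: indexR.
  - by move=> k Kk; rewrite inE Kk /= => nRk; rewrite outR ?(subsetP sKS).
  - exact: (subsetP (normal_norm nKG)).
set C := 'C_G(K)%G.
have nCG : C <| G.
  rewrite /normal subsetIl normsI ?normG //.
  exact: subset_trans (normal_norm nKG) (cent_norm _).
have Kneq1 : exists2 a, a \in K & a != 1.
  by apply/trivgPn; rewrite trivg_card1 oK.
have [nCg sCG] : G \subset 'N(C) /\ C \subset G by case/andP: nCG.
have iC : #|G : C| = 6.
  have [a Ka na] := Kneq1.
  have n1 : #|G : 'C_G[a]| <= 3 by apply: klein_orbit Ka na.
  have n2 : #|'C_G[a] : C| <= 2 by apply: klein_stab Ka na.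
  have n12 : #|G : C| = (#|G : 'C_G[a]| * #|'C_G[a] : C|)%N by apply: klein_index.
  have even_iC : ~~ odd #|G : C|.
    apply/negP => oiC; case/negP: ncg; have sGC : G \subset C.
      rewrite genG gen_subG; apply/subsetP => u Xu.
      have Gu : u \in G by rewrite genG mem_gen.
      rewrite coset_idr ?(subsetP nCg) //; apply/eqP; rewrite -order_eq1 -dvdn1.
      have d1 : #[coset C u] %| 2.
        apply: dvdn_trans (morph_order _ (subsetP nCg u Gu)) _.
        by rewrite order_dvdn expg2 invX.
      have d2 : #[coset C u] %| #|G : C|.
        by rewrite -card_quotient // order_dvdG // mem_quotient.
      have co : coprime 2 #|G : C| by rewrite coprime2n.
      by rewrite -(eqP co) dvdn_gcd d1 d2.
    by have := subsetP sGC g Gg; rewrite inE Gg.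
  have ng1 : #[coset C g] != 1%N.
    rewrite order_eq1; apply: contra ncg => /eqP g1.
    have : g \in C by rewrite coset_idr ?(subsetP nCg).
    by rewrite inE Gg.
  have dg : #[coset C g] %| #|G : C|.
    by rewrite -card_quotient // order_dvdG // mem_quotient.
  have odd_g : odd #[coset C g].
    by apply: dvdn_odd og; apply: morph_order; apply: (subsetP nCg).
  move: even_iC dg; rewrite n12 => even_i dg.
  by apply: dvd6 even_i dg odd_g ng1; rewrite ?indexg_gt0.
have sylC : 2.-Sylow(C) K.
  have -> : K = (C :&: S)%G; last exact: Sylow_setI_normal nCG sylS.
  apply/eqP; rewrite -val_eqE eqEcard /= subsetI sKS subsetI (normal_sub nKG).
  rewrite (abelem_abelian abK : K \subset 'C(K)) /= oK; set T := (C :&: S)%G.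
  have sTS : T \subset S by apply: subsetIr.
  have [k Kk nRk] : exists2 k, k \in K & k \notin R.
    apply/subsetPn; apply/negP => sKR.
    by have := cyclicS sKR cycR; rewrite (abelem_cyclic abK) oK.
  have TR_le2 : #|T :&: R| <= 2.
    have /cyclicP[r defTR] : cyclic (T :&: R) := cyclicS (subsetIr _ _) cycR.
    have /setIP[/setIP[/setIP[_ cKr] Sr] Rr] : r \in T :&: R by rewrite defTR cycle_id.
    rewrite defTR; apply: dvdn_leq => //; rewrite order_dvdn expg2 -(mulKg k (r * r)).
    have kk : k * k = 1 := klein_sq abK Kk.
    have rk : r * k = k * r by have /centP/(_ k Kk) := cKr.
    have -> : k * (r * r) = k * (k * r * (k * r)).
      by rewrite -!mulgA (mulgA k k) kk mul1g (mulgA r k) rk -!mulgA.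
    have Skr : k * r \in S by rewrite groupM // (subsetP sKS).
    rewrite outR ?mulg1 ?mulVg //.
    by apply: contra nRk => Rkr; rewrite -(mulgK r k) groupM ?groupV.
  by rewrite -(Lagrange (subsetIl T R)) (leq_mul TR_le2 (indexR T sTS)).
have nKC : K <| C.
  have cKK : K \subset 'C(K) := abelem_abelian abK.
  rewrite /normal subsetI (normal_sub nKG) cKK /=.
  exact: subset_trans sCG (normal_norm nKG).
have /splitsP[N /complP[KN1 defC]] := SchurZassenhaus_split (pHall_Hall sylC) nKC.
have sNC : N \subset C by rewrite -defC mulG_subr.
have cKN : N \subset 'C(K) := subset_trans sNC (subsetIr _ _).
have dpC : K \x N = C by rewrite dprodE.
have oddN : odd #|N|.
  have [_ _] := and3P sylC; rewrite -odd_2'nat -divgS; last exact: normal_sub.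
  by rewrite -(dprod_card dpC) mulKn.
have nNG : N <| G.
  have hallN : 2^'.-Hall(C) N.
    rewrite /pHall sNC /pgroup -odd_2'nat oddN /= -divgS // -(dprod_card dpC) mulnK //.
    by rewrite oK pnatNK.
  have [_ nNC] := dprod_normal2 dpC.
  by rewrite -(normal_Hall_pcore hallN nNC) gFnormal_trans.
exists N; split=> //; split=> //; apply: cyc_nil => //.
apply: subset_trans (solvable_cent_Fitting solG); rewrite subsetI (normal_sub nNG) /=.
have [_ <- _ _] := dprodP defF; rewrite centM subsetI cKN /=.
apply/subsetP => u Nu; apply: odd_cent; first exact: (subsetP (normal_sub nNG)).
by apply: dvdn_odd oddN; apply: order_dvdG.
Qed.

(** A Sylow [p]-subgroup of [<<[set a; b]>>] is one of [G] when [p] misses the index.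
    It is thus cyclic for [p] odd, and contains rotations with index at most 2 for
    [p = 2]; if [|G| / 2] is odd then the Sylow 2-subgroups have order 2. *)
Lemma dihedral_index_structure (gT : finGroupType) (G : {group gT}) (X : {set gT}) :
    solvable G -> G = <<X>> :> {set gT} -> {in X, forall u, #[u] = 2} -> X != set0 ->
    (forall p, prime p -> p %| #|G|./2 -> exists a b,
       [/\ #[a] = 2, #[b] = 2, <<[set a; b]>> \subset G &
           ~~ (p %| #|G : <<[set a; b]>>|)]) ->
  (exists N : {group gT}, [/\ N <| G, cyclic N, odd #|N| & 2.-group (G / N)]) \/
  (exists K N : {group gT},
    [/\ K <| G /\ N <| G, 2.-abelem K /\ #|K| = 4, cyclic N /\ odd #|N|,
        K \x N = 'C_G(K) & #|G : 'C_G(K)| = 6]).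
Proof.
move=> solG genG invX /set0Pn[u Xu] dih.
have XX : {in X, forall u, u * u = 1} by move=> v Xv; apply/invol_sq/invX.
have Gu : u \in G by rewrite genG mem_gen.
have even_G : ~~ odd #|G|.
  apply/negP => oG; have := dvdn_odd (order_dvdG Gu) oG; by rewrite invX.
have G2 : #|G| = (#|G|./2 * 2)%N by rewrite muln2 even_halfK.
have sylD p (D : {group gT}) : D \subset G -> prime p -> ~~ (p %| #|G : D|) ->
    exists2 P : {group gT}, p.-Sylow(G) P & P \subset D.
  move=> sDG pr_p npD; have [P sylP] := Sylow_exists p D; exists P; last exact: pHall_sub sylP.
  have [sPD pP iP] := and3P sylP; rewrite /pHall (subset_trans sPD) // pP /=.
  rewrite -(Lagrange_index sDG sPD) pnatM iP andbT.
  by rewrite p'natE.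
have cycP p (P : {group gT}) : odd p -> p.-Sylow(G) P -> cyclic P.
  move=> odd_p sylP; have [pr_p | npr] := boolP (prime p); last first.
    have P1 : P :=: 1.
      apply: card1_trivg; rewrite (card_pgroup (pHall_pgroup sylP)).
      by rewrite lognE (negbTE npr).
    by rewrite P1 cyclic1.
  have [pG | npG] := boolP (p %| #|G|); last first.
    have P1 : P :=: 1.
      apply: card1_trivg; rewrite (card_Hall sylP) p_part.
      by rewrite lognE (negbTE npG) !andbF.
    by rewrite P1 cyclic1.
  have pE : p %| #|G|./2.
    by move: pG; rewrite {1}G2 Gauss_dvdl // coprimen2.
  have [a [b [oa ob sD npD]]] := dih p pr_p pE.
  have [P' sylP' sP'D] := sylD p <<[set a; b]>>%G sD pr_p npD.
  have [g Gg ->] := Sylow_trans sylP' sylP; rewrite cyclicJ.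
  apply: cyclicS (cycle_cyclic (a * b)); apply: dih_odd_sub => //.
  by apply: odd_pgroup_odd odd_p _; apply: pHall_pgroup sylP'.
have [even_E | odd_E] := boolP (2 %| #|G|./2); last first.
  have [S sylS] := Sylow_exists 2 G.
  have oS : #|S| = 2.
    rewrite (card_Hall sylS) p_part (_ : logn 2 _ = 1%N) //.
    have e_gt0 : 0 < #|G|./2.
      by rewrite half_gt0; case: #|G| (cardG_gt0 G) even_G => [|[|]].
    by rewrite G2 lognM // [logn 2 2](pfactorK 1) // lognE (negbTE odd_E) !andbF.
  apply: (involution_generated_structure solG genG XX cycP sylS (cyclic1 _)).
    by rewrite setIg1 indexg1 oS.
  by move=> s Ss _; rewrite -expg2 -oS expg_cardG.
have [a [b [oa ob sD npD]]] := dih 2 isT even_E.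
have [S sylS sSD] := sylD 2 <<[set a; b]>>%G sD isT npD.
apply: (involution_generated_structure solG genG XX cycP sylS (cycle_cyclic (a * b))).
  rewrite indexgI; apply: leq_trans (dih_index oa ob).
  exact: subset_leq_card (imsetS _ sSD).
by move=> s Ss nrs; apply: dih_out_sq nrs => //; apply: (subsetP sSD).
Qed.

(** The index of [A] and that of its image have the same parity, and the latter is a
    power of 2. *)
Lemma odd_index_quotient (gT : finGroupType) (G N A : {group gT}) :
    N <| G -> odd #|N| -> 2.-group (G / N) -> A \subset G ->
  odd #|G : A| = (A / N == G / N).
Proof.
move=> nNG oN pQ sAG; have nN := normal_norm nNG.
have nNA := subset_trans sAG nN.
have sQ : A / N \subset G / N by apply: quotientS.
have cG : #|G| = (#|N| * #|G / N|)%N.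
  by rewrite card_quotient // Lagrange // normal_sub.
have cA : #|A| = (#|N :&: A| * #|A / N|)%N.
  by rewrite card_quotient // -indexgI setIC Lagrange // subsetIl.
have : (#|N :&: A| * #|G : A|)%N = (#|N| * #|G / N : A / N|)%N.
  apply/eqP; rewrite -(eqn_pmul2r (cardG_gt0 (A / N))) -!mulnA (mulnC #|G : A|) !mulnA.
  by rewrite -cA (Lagrange sAG) cG -mulnA (mulnC #|_ : _|) Lagrange.
move/(congr1 odd); rewrite !oddM oN (dvdn_odd (cardSg (subsetIl N A)) oN) /= => ->.
rewrite eqEsubset sQ /= -indexg_eq1.
have : 2.-nat #|G / N : A / N| by apply: pnat_dvd (dvdn_indexg _ _) pQ.
move/p_natP=> [k ->]; by case: k => [|k] //; rewrite expnS oddM muln_eq1.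
Qed.

(** * Cyclic normal subgroups of 2-power index *)

Lemma odd_notin_invol (gT : finGroupType) (N : {group gT}) (x : gT) :
  odd #|N| -> #[x] = 2 -> x \notin N.
Proof. by move=> oN ox; apply/negP => /order_dvdG/dvdn_odd/(_ oN); rewrite ox. Qed.

(** Here [N] has index 2, as involutions lie outside [N]. The generators [x * y] and
    [x * z] of a subgroup [B] of [N] are inverted by [x], and [G = <[x]> * B], so
    that [B = N]: therefore [x] inverts [N] and the exponents [j], [k] of the two
    generators are coprime to [#[a]] when taken together. *)
Lemma dihedral_coordinates (gT : finGroupType) (G N : {group gT}) (x y z : gT) :
    G = <<[set x; y; z]>> :> {set gT} -> #[x] = 2 -> #[y] = 2 -> #[z] = 2 ->
    N <| G -> cyclic N -> odd #|N| -> 2.-group (G / N) -> ~~ (4 %| #|G|) ->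
  exists a j k, [/\ a \in G /\ #|G| = (2 * #[a])%N, odd #[a], a ^ x = a^-1 /\ x \notin <[a]>,
                    y = x * a ^+ j /\ z = x * a ^+ k & gcdn (gcdn j k) #[a] = 1%N].
Proof.
move=> genG ox oy oz nNG cycN oN pQ n4G.
have [Gx Gy Gz] : [/\ x \in G, y \in G & z \in G].
  by rewrite genG; split; apply: mem_gen; rewrite !inE eqxx ?orbT.
have nNx := odd_notin_invol oN ox.
have sNG := normal_sub nNG.
have iN : #|G : N| = 2.
  have : 2.-nat #|G : N| by rewrite -card_quotient ?normal_norm.
  case/p_natP=> [[|[|i]]] // iN.
    by case/negP: nNx; apply: (subsetP _ x Gx); rewrite -indexg_eq1 iN.
  by case/negP: n4G; rewrite -(Lagrange sNG) iN dvdn_mull // !expnS mulnA dvdn_mulr.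
have in_N u : u \in G -> #[u] = 2 -> x * u \in N.
  move=> Gu ou; have nNu := odd_notin_invol oN ou.
  rewrite -[u]invgK -mem_rcoset (rcoset_index2 sNG iN) !inE ?groupV ?nNu ?nNx ?Gu ?Gx //.
have [a defN] := cyclicP cycN.
have /cycleP[j xy] : x * y \in <[a]> by rewrite -defN in_N.
have /cycleP[k xz] : x * z \in <[a]> by rewrite -defN in_N.
have xx := invol_sq ox.
pose B := <<[set a ^+ j; a ^+ k]>>%G.
have sBa : B \subset <[a]> by rewrite gen_subG subUset !sub1set !mem_cycle.
have invB b : b \in B -> b ^ x = b^-1.
  have /subsetP sB : B \subset [set b in <[a]> | b ^ x == b^-1].
    apply: gen_lmul_sub => [|c d]; rewrite !inE; first by rewrite group1 conj1g invg1 eqxx.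
    have inv_i i u : x * u = a ^+ i -> #[u] = 2 -> (a ^+ i) ^ x == (a ^+ i)^-1.
      by move=> <- ou; rewrite dih_invl.
    move=> Bc /andP[ad /eqP dx].
    have ac : c \in <[a]> by case/orP: Bc => /eqP ->; apply: mem_cycle.
    have cx : c ^ x = c^-1.
      by case/orP: Bc => /eqP ->; apply/eqP; [apply: inv_i xy oy | apply: inv_i xz oz].
    rewrite groupM //= conjMg cx dx -invMg; apply/eqP; congr _^-1.
    exact: (centsP (cycle_abelian a)).
  by move/sB; rewrite inE => /andP[_ /eqP].
have nBx : x \in 'N(B).
  rewrite inE; apply/subsetP => _ /imsetP[b Bb ->].
  by rewrite invB ?groupV.
have oG : #|G| = (2 * #[a])%N by rewrite -(Lagrange sNG) iN mulnC defN.
have defB : B = <[a]> :> {set gT}.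
  apply/eqP; rewrite eqEcard sBa -(leq_pmul2l (isT : 0 < 2)) -[#|<[a]>|]/#[a] -oG.
  have sGB : G \subset <[x]> * B.
    rewrite {1}genG; apply: gen_lmul_sub => [|u g].
      by rewrite -[1]mulg1 mem_mulg.
    rewrite !inE -orbA => Xu /mulsgP[x' b Xx' Bb ->].
    have {Xu} [v Bv ->] : exists2 v, v \in B & u = x * v.
      case/or3P: Xu => /eqP ->; first by exists 1; rewrite ?mulg1.
        by exists (a ^+ j); rewrite ?mem_gen ?set21 // -xy mulgA xx mul1g.
      by exists (a ^+ k); rewrite ?mem_gen ?set22 // -xz mulgA xx mul1g.
    have -> : x * v * (x' * b) = x * x' * (v ^ x' * b).
      by rewrite conjgE -!mulgA mulKVg.
    have nBx' : x' \in 'N(B) by apply: (subsetP _ x' Xx'); rewrite cycle_subG.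
    by apply: mem_mulg; rewrite groupM ?cycle_id ?memJ_norm.
  apply: leq_trans (subset_leq_card sGB) _.
  by rewrite -ox -[#[x]]/#|<[x]>| mul_cardG leq_pmulr // cardG_gt0.
have dvd1 d : d %| #[a] -> d %| j -> d %| k -> d = 1%N.
  move=> da /dvdnP[j' dj] /dvdnP[k' dk].
  have sB : B \subset <[a ^+ d]>.
    by rewrite gen_subG subUset !sub1set dj dk mulnC expgM mem_cycle mulnC expgM mem_cycle.
  have : #[a] <= #[a ^+ d] by rewrite /order -defB subset_leq_card.
  rewrite orderXdiv // leq_divRL ?(dvdn_gt0 (order_gt0 a) da) //.
  rewrite -{2}[#[a]]muln1 leq_pmul2l //.
  by case: d da {dj dk sB} => [|[|d]] //; rewrite dvd0n => /eqP oa; have := order_gt0 a; rewrite oa.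
exists a, j, k; split=> //.
- by split=> //; apply: (subsetP sNG); rewrite defN cycle_id.
- by rewrite /order -defN.
- by rewrite -defN; split=> //; apply: invB; rewrite defB cycle_id.
- by rewrite -xy -xz !mulgA xx !mul1g.
by apply: dvd1; rewrite ?dvdn_gcdr // (dvdn_trans (dvdn_gcdl _ _)) ?dvdn_gcdl ?dvdn_gcdr.
Qed.

(** Two elements generate the dihedral group when their product generates its
    rotations, which form a cyclic 2-group. *)
Lemma dih_gen_odd (gT : finGroupType) (x y u v : gT) (m : nat) :
    #[x] = 2 -> #[y] = 2 -> x != y -> 2.-group <<[set x; y]>> ->
    #[u] = 2 -> #[v] = 2 -> u \in <<[set x; y]>> -> v \in <<[set x; y]>> ->
    u \notin <[x * y]> -> u * v = (x * y) ^+ m -> 2 %| #[x * y] ->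
  (<<[set u; v]>> == <<[set x; y]>>) = odd m.
Proof.
move=> ox oy nxy pQ ou ov Qu Qv nru uv even_r; set r := x * y.
have pr : 2.-nat #[r] by apply: mem_p_elt pQ _; rewrite groupM ?dih_l ?dih_r.
apply/eqP/idP => [E | odd_m].
  apply/negPn/negP => even_m.
  have : #|<<[set x; y]>>| <= #[r].
    rewrite -E; apply: leq_trans (dih_card_le ou ov) _.
    rewrite uv -(odd_double_half m) (negbTE even_m) add0n -mul2n expgM.
    rewrite mulnC -leq_divRL // -(orderXdiv even_r) dvdn_leq //.
    exact: orderXdvd.
  by rewrite dih_card // mul2n -addnn -{3}[#[r]]addn0 leq_add2l leqNgt order_gt0.
apply/eqP; rewrite eqEsubset gen_subG subUset !sub1set Qu Qv /=.
have rD : r \in <<[set u; v]>>.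
  have : <[r ^+ m]> = <[r]>.
    apply/eqP; rewrite eq_sym -[_ == _]/(generator _ _) generator_coprime.
    by have /p_natP[e ->] := pr; rewrite coprimeXl // coprime2n.
  by move/setP/(_ r); rewrite cycle_id -uv => /(subsetP (dih_rot u v)).
have xD : x \in <<[set u; v]>>.
  have := dih_cases ox oy Qu; rewrite (negbTE nru) /= => xu.
  rewrite -(mulgK u x) groupM ?groupV ?dih_l //.
  by apply: (subsetP _ _ xu); rewrite cycle_subG.
rewrite gen_subG subUset !sub1set xD /=.
have -> : y = x^-1 * r by rewrite mulKg.
by rewrite groupM ?groupV.
Qed.

(** In a dihedral 2-group [<x, y>] a reflection generates it together with
    exactly one of [x] and [y]. So if the number of generating pairs among three
    involutions is odd, the third one is a rotation, of order 2. *)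
Lemma dihedral_2group_third (gT : finGroupType) (Q : {group gT}) (x y z : gT) :
    2.-group Q -> Q = <<[set x; y]>> :> {set gT} -> z \in Q ->
    #[x] = 2 -> #[y] = 2 -> #[z] = 2 -> 4 %| #|Q| ->
    (<<[set x; z]>> == Q :> {set gT}) = (<<[set y; z]>> == Q :> {set gT}) ->
  (#|Q| = 4 /\ z = x * y) \/
  [/\ ~~ (#|Q| == 4), commute z x, commute z y & exists2 w, w \in Q & z = w * w].
Proof.
move=> pQ defQ Qz ox oy oz Q4 par; set r := x * y.
have nxy : x != y.
  apply: contraTneq Q4 => xy; rewrite defQ -xy setUid -[#|_|]/#[x] ox //.
have nrx : x \notin <[r]> by apply: dih_notin.
have oQ : #|Q| = (2 * #[r])%N by rewrite defQ dih_card.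
have even_r : 2 %| #[r] by move: Q4; rewrite oQ -[4]/(2 * 2)%N dvdn_pmul2l.
have pQ' : 2.-group <<[set x; y]>> by rewrite -defQ.
have Qx : x \in <<[set x; y]>> := dih_l x y.
have Qy : y \in <<[set x; y]>> := dih_r x y.
have Dz : z \in <<[set x; y]>> by rewrite -defQ.
have nry : y \notin <[r]>.
  by apply: contra nrx => ry; rewrite -(mulgK y x) groupM ?groupV ?cycle_id.
have [/cycleP[i zi] | nrz] := boolP (z \in <[r]>); last first.
  have := dih_cases ox oy Dz; rewrite (negbTE nrz) /= => /cycleP[i xz].
  move: par; rewrite !defQ (dih_gen_odd ox oy _ _ _ _ _ _ _ xz) //.
  have yz : y * z = r ^+ (#[r].-1 + i).
    rewrite expgD -xz -invg_expg invMg !invol_inv // -!mulgA (mulgA x x).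
    by rewrite invol_sq // mul1g.
  rewrite (dih_gen_odd ox oy _ _ _ _ _ _ _ yz) // oddD.
  have : ~~ odd #[r] by rewrite -dvdn2.
  by rewrite -(prednK (order_gt0 r)) /= negbK => ->; case: (odd i).
have zV : z^-1 = z by rewrite invol_inv.
have [zx zy] : z ^ x = z^-1 /\ z ^ y = z^-1.
  by apply: dih_inv_rot => //; rewrite zi mem_cycle.
rewrite zV in zx zy.
have czx : commute z x by apply/commgP/conjg_fixP.
have czy : commute z y by apply/commgP/conjg_fixP.
have ri2 : #[r] %| 2 * i.
  by rewrite order_dvdn mulnC expgM -zi expg2 invol_sq.
have [or2 | nr2] := eqVneq #[r] 2.
  left; rewrite oQ or2; split=> //.
  have : z \in <[r]> by rewrite zi mem_cycle.
  by rewrite cycle2g // !inE (negbTE (invol_neq1 oz)) => /eqP.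
right; split=> //; first by rewrite oQ -[4]/(2 * 2)%N eqn_pmul2l.
have even_i : ~~ odd i.
  have : 4 %| #[r].
    have pr : 2.-nat #[r] by apply: mem_p_elt pQ' _; rewrite groupM.
    case/p_natP: pr nr2 even_r => [[|[|e]]] -> // _ _.
    by rewrite !expnS mulnA dvdn_mulr.
  move/dvdn_trans/(_ ri2); rewrite -[4]/(2 * 2)%N dvdn_pmul2l // dvdn2 //.
exists (r ^+ i./2); first by rewrite defQ groupX // groupM.
by rewrite zi -expgD addnn -{1}(odd_double_half i) (negbTE even_i).
Qed.

Section TwoNilpotent.

Variables (gT : finGroupType) (G N : {group gT}) (x y z : gT).
Hypotheses (genG : G = <<[set x; y; z]>> :> {set gT}).
Hypotheses (ox : #[x] = 2) (oy : #[y] = 2) (oz : #[z] = 2).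
Hypotheses (nNG : N <| G) (cycN : cyclic N) (oN : odd #|N|).
Hypotheses (pQ : 2.-group (G / N)).

Let invX : {in [set x; y; z], forall u, u * u = 1}.
Proof. by move=> u; rewrite !inE -orbA => /or3P[] /eqP ->; apply: invol_sq. Qed.

Lemma gen3_in : [/\ x \in G, y \in G & z \in G].
Proof. by rewrite genG; split; apply: mem_gen; rewrite !inE eqxx ?orbT. Qed.

Lemma quotient_pair a b : a \in G -> b \in G ->
  <<[set a; b]>> / N = <<[set coset N a; coset N b]>>.
Proof.
move=> Ga Gb; have nN := normal_norm nNG.
have [Na Nb] := (subsetP nN a Ga, subsetP nN b Gb).
rewrite quotient_gen ?subUset ?sub1set ?Na ?Nb //.
by rewrite quotientU !quotient_set1.
Qed.

Lemma order_coset_invol a : a \in G -> #[a] = 2 -> #[coset N a] = 2.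
Proof.
move=> Ga oa; have Na := subsetP (normal_norm nNG) a Ga.
have : #[coset N a] %| 2 by rewrite -oa; apply: morph_order.
have : #[coset N a] != 1%N.
  rewrite order_eq1; apply: contra (odd_notin_invol oN oa) => /eqP.
  exact: coset_idr.
by move=> n1; rewrite (dvdn_divisors _ (isT : 0 < 2)) !inE (negbTE n1) /= => /eqP.
Qed.

Lemma odd_index_pair a b : a \in G -> b \in G ->
  odd #|G : <<[set a; b]>>| = (<<[set coset N a; coset N b]>> == G / N).
Proof.
move=> Ga Gb; rewrite -quotient_pair // (odd_index_quotient nNG) //.
by rewrite gen_subG subUset !sub1set Ga Gb.
Qed.

(** The indices of dihedral subgroups are odd when their images generate the 2-group
    [G / N], to which [dihedral_2group_third] applies. If [z] is central modulo [N],
    it is a square there, so it centralises the cyclic group [N]; its commutators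
    then lie in [N] and have order dividing 2, so [z] is central in [G] itself. *)
Lemma third_central :
    4 %| #|G| -> odd #|G : <<[set x; y]>>| ->
    odd #|G : <<[set x; z]>>| = odd #|G : <<[set y; z]>>| ->
  [/\ commute z x, commute z y & <<[set x; y]>> = G] \/
  (#|G / N| = 4 /\ x * y * z \in N).
Proof.
move=> G4 oxy par; have [Gx Gy Gz] := gen3_in.
have nN := normal_norm nNG.
have [Nx Ny Nz] : [/\ x \in 'N(N), y \in 'N(N) & z \in 'N(N)].
  by split; apply: (subsetP nN).
have defQ : (G / N)%G = <<[set coset N x; coset N y]>> :> {set _}.
  by apply/esym/eqP; rewrite -odd_index_pair.
have Q4 : 4 %| #|G / N|.
  move: G4; rewrite -(Lagrange (normal_sub nNG)) -card_quotient // Gauss_dvdr //.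
  by rewrite (coprimeXl 2 (_ : coprime 2 _)) // coprime2n.
have Qz : coset N z \in (G / N)%G by rewrite mem_quotient.
case: (dihedral_2group_third pQ defQ Qz _ _ _ Q4).
1-3: exact: order_coset_invol.
- by rewrite -!odd_index_pair.
- case=> oQ zxy; right; split=> //; apply: coset_idr; rewrite ?groupM //.
  by rewrite !morphM ?groupM //= -zxy invol_sq ?order_coset_invol.
case=> _ czx czy [w' Qw' zw]; left.
have /morphimP[w Nw Gw w'E] := Qw'; rewrite /= in w'E.
have cNz : z \in 'C(N).
  have zw2 : z * (w ^+ 2)^-1 \in N.
    apply: coset_idr; first by rewrite groupM ?groupV ?groupX.
    by rewrite morphM ?morphV ?groupV ?groupX //= morphX // expg2 zw w'E mulgV.
  have -> : z = (z * (w ^+ 2)^-1) * w ^+ 2 by rewrite mulgKV.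
  rewrite groupM ?(sq_cent_cyclic genG invX nNG cycN) //.
  by apply: (subsetP (cyclic_abelian cycN)).
have comm u : u \in G -> commute (coset N z) (coset N u) -> commute z u.
  move=> Gu czu; have Nu := subsetP nN u Gu.
  pose c := z^-1 * z ^ u.
  have Nc : c \in N.
    apply: coset_idr; first by rewrite groupM ?groupV ?groupJ.
    rewrite /c morphM ?morphV ?morphJ ?groupV ?groupJ //=.
    by have /commgP/conjg_fixP -> := czu; rewrite mulVg.
  have cc : c ^+ 2 = 1.
    have zc : z * c = z ^ u by rewrite mulKVg.
    have : z ^ u * z ^ u = 1 by rewrite -conjMg invol_sq // conj1g.
    have /centP/(_ c Nc) czc := cNz.
    rewrite -zc {1}czc -mulgA (mulgA z z) invol_sq // mul1g => <-.
    by rewrite expg2.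
  have c1 : c = 1.
    apply/eqP; rewrite -order_eq1 -dvdn1.
    have co : coprime 2 #|N| by rewrite coprime2n.
    by rewrite -(eqP co) dvdn_gcd order_dvdn cc eqxx order_dvdG.
  apply/commgP/conjg_fixP; apply/eqP; rewrite eq_sym eq_mulVg1 -/c c1 //.
have [zx zy] := (comm x Gx czx, comm y Gy czy).
split=> //; apply/eqP; rewrite eqEsubset gen_subG subUset !sub1set Gx Gy /=.
have sG : G \subset <<[set x; y]>> * <[z]>.
  rewrite {1}genG; apply: gen_lmul_sub => [|u g].
    by rewrite -[1]mulg1 mem_mulg.
  rewrite !inE => /orP[Du | /eqP ->] /mulsgP[d c Dd zc ->].
    by rewrite mulgA mem_mulg // groupM // mem_gen // !inE.
  have czd : commute z d.
    have /centP/(_ d Dd) : z \in 'C(<<[set x; y]>>).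
      rewrite cent_gen; apply/centP => v; rewrite !inE.
      by case/orP=> /eqP ->.
    by [].
  by rewrite mulgA czd -mulgA mem_mulg // groupM ?cycle_id.
have sD : <<[set x; y]>> \subset G by rewrite gen_subG subUset !sub1set Gx.
have defG : G = <<[set x; y]>> * <[z]> :> {set gT}.
  by apply/eqP; rewrite eqEsubset sG mulG_subG sD cycle_subG.
rewrite -indexg_eq1; move: oxy; rewrite defG indexMg.
have : #|<[z]> : <<[set x; y]>>| <= 2.
  by rewrite -oz; apply: leq_imset_card.
by case: #|_ : _| (indexg_gt0 <[z]> <<[set x; y]>>) => [|[|[|]]].
Qed.

End TwoNilpotent.

(** * Three dihedral subgroups in a quotient of order four *)

Section KleinQuotient.

Variables (gT : finGroupType) (G N : {group gT}).
Hypotheses (nNG : N <| G) (cycN : cyclic N) (oN : odd #|N|) (oQ : #|G / N| = 4).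

(** The three involutions play symmetric parts, since [G / N] is abelian. *)
Lemma klein_quotient_perm x y z : x \in G -> y \in G -> z \in G ->
  x * y * z \in N -> x * z * y \in N /\ y * z * x \in N.
Proof.
move=> Gx Gy Gz Nxyz; have nN := normal_norm nNG.
have abQ : abelian (G / N).
  by apply: (@p2group_abelian _ 2); rewrite /pgroup oQ // (pfactorK 2).
have [Nx Ny Nz] : [/\ x \in 'N(N), y \in 'N(N) & z \in 'N(N)].
  by split; apply: (subsetP nN).
have xyz1 : coset N x * coset N y * coset N z = 1.
  by rewrite -!morphM ?groupM //= coset_id.
have comm u v : u \in G -> v \in G -> coset N u * coset N v = coset N v * coset N u.
  by move=> Gu Gv; apply: (centsP abQ); rewrite mem_quotient.
split; apply: coset_idr; rewrite ?groupM // !morphM ?groupM //=.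
  by rewrite -mulgA (comm z y) // mulgA.
by rewrite -mulgA (comm z x) // mulgA (comm y x).
Qed.

(** [x] and [y] invert the powers of [x * y], and [z] acts on the abelian group [N]
    like [x * y]. *)
Lemma klein_quotient_pair x y z :
    x \in G -> y \in G -> z \in G -> #[x] = 2 -> #[y] = 2 -> #[z] = 2 ->
    x * y * z \in N ->
  [/\ #|<<[set x; y]>>| = (4 * #|<<[set x; y]>> :&: N|)%N,
      {in <<[set x; y]>> :&: N, forall u, [/\ u ^ x = u^-1, u ^ y = u^-1 & u ^ z = u]},
      #[x * y] = (2 * #|<<[set x; y]>> :&: N|)%N &
      <<[set x; y]>> :&: N \subset <[x * y]>].
Proof.
move=> Gx Gy Gz ox oy oz Nxyz; have nN := normal_norm nNG.
have pQ : 2.-group (G / N) by rewrite /pgroup oQ.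
have sD : <<[set x; y]>> \subset G by rewrite gen_subG subUset !sub1set Gx Gy.
have nxy : x != y.
  apply: contraTneq Nxyz => <-; rewrite invol_sq // mul1g.
  exact: odd_notin_invol.
have oD : #|<<[set x; y]>>| = (4 * #|<<[set x; y]>> :&: N|)%N.
  rewrite -(Lagrange (subsetIl _ N)) mulnC indexgI; congr (_ * _)%N.
  rewrite -card_quotient ?(subset_trans sD) // (quotient_pair nNG) //.
  have [ox' oy' oz'] : [/\ #[coset N x] = 2, #[coset N y] = 2 & #[coset N z] = 2].
    by split; apply: (order_coset_invol nNG oN).
  have xy_z : coset N x * coset N y = coset N z.
    have [Nx Ny Nz] : [/\ x \in 'N(N), y \in 'N(N) & z \in 'N(N)].
      by split; apply: (subsetP nN).
    apply: (mulIg (coset N z)); rewrite invol_sq // -!morphM ?groupM //=.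
    by rewrite coset_id.
  have nxy' : coset N x != coset N y.
    apply: contra_eq_neq xy_z => <-; rewrite invol_sq // eq_sym.
    by rewrite -order_eq1 oz'.
  by rewrite dih_card // xy_z oz'.
have oA : odd #|<<[set x; y]>> :&: N| by apply: dvdn_odd oN; rewrite cardSg ?subsetIr.
have sAr : <<[set x; y]>> :&: N \subset <[x * y]>.
  by apply: (@dih_odd_sub _ x y ox oy (<<[set x; y]>> :&: N)%G); rewrite ?subsetIl.
split=> //; last first.
  by apply/eqP; rewrite -(eqn_pmul2l (isT : 0 < 2)) -dih_card // oD mulnA.
move=> u Au; have [ux uy] := dih_inv_rot ox oy (subsetP sAr u Au).
split=> //; have : u ^ (x * y * z) = u.
  apply/conjg_fixP/commgP; apply: (centsP (cyclic_abelian cycN)) => //.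
  by case/setIP: Au.
by rewrite !conjgM ux conjVg uy invgK.
Qed.

(** A cyclic group has one subgroup of each prime order. *)
Lemma TI_cyclic_coprime (A B : {group gT}) :
  A \subset N -> B \subset N -> A :&: B = 1 -> coprime #|A| #|B|.
Proof.
move=> sA sB tiAB; apply/negPn/negP => nco.
have gcd_gt1 : 1 < gcdn #|A| #|B|.
  by rewrite ltn_neqAle eq_sym nco gcdn_gt0 cardG_gt0.
have pr_p := pdiv_prime gcd_gt1; have := pdiv_dvd (gcdn #|A| #|B|).
rewrite dvdn_gcd => /andP[pA pB].
have [u Au ou] := Cauchy pr_p pA; have [v Bv ov] := Cauchy pr_p pB.
have uv : <[u]> = <[v]>.
  apply/eqP; rewrite (eq_subG_cyclic cycN) ?cycle_subG ?(subsetP sA u Au) ?(subsetP sB v Bv) //.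
  by apply/eqP; rewrite -[LHS]/(#[u]) -[RHS]/(#[v]) ou ov.
have : u \in A :&: B.
  by rewrite inE Au -cycle_subG uv cycle_subG.
rewrite tiAB inE => /eqP u1; move: pr_p; by rewrite -ou u1 order1.
Qed.

End KleinQuotient.

Lemma odd_self_inv (gT : finGroupType) (N : {group gT}) (u : gT) :
  odd #|N| -> u \in N -> u^-1 = u -> u = 1.
Proof.
move=> oN Nu uV; apply/eqP; rewrite -order_eq1 -dvdn1.
have d2 : #[u] %| 2 by rewrite order_dvdn expg2 -{1}uV mulVg.
have co : coprime 2 #|N| by rewrite coprime2n.
by rewrite -(eqP co) dvdn_gcd d2 order_dvdG.
Qed.

Section KleinTriple.

Variables (gT : finGroupType) (G N : {group gT}) (x y z : gT).
Hypotheses (genG : G = <<[set x; y; z]>> :> {set gT}).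
Hypotheses (ox : #[x] = 2) (oy : #[y] = 2) (oz : #[z] = 2).
Hypotheses (nNG : N <| G) (cycN : cyclic N) (oN : odd #|N|).
Hypotheses (oQ : #|G / N| = 4) (Nxyz : x * y * z \in N).

Local Notation A := (<<[set x; y]>> :&: N)%G.
Local Notation B := (<<[set x; z]>> :&: N)%G.
Local Notation C := (<<[set y; z]>> :&: N)%G.

Let Gxyz := gen3_in genG.
Let Gx : x \in G. Proof. by case: Gxyz. Qed.
Let Gy : y \in G. Proof. by case: Gxyz. Qed.
Let Gz : z \in G. Proof. by case: Gxyz. Qed.
Let cNN : {in N &, forall u v, u * v = v * u}.
Proof. by move=> u v Nu Nv; apply: (centsP (cyclic_abelian cycN)). Qed.
Let cNJ u v : u \in N -> v \in N -> u ^ v = u.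
Proof. by move=> Nu Nv; apply/conjg_fixP/commgP/cNN. Qed.

Lemma klein_xy :
  [/\ #|<<[set x; y]>>| = (4 * #|A|)%N,
      {in A, forall u, [/\ u ^ x = u^-1, u ^ y = u^-1 & u ^ z = u]} &
      A \subset <[x * y]>].
Proof. by have [] := klein_quotient_pair nNG cycN oN oQ Gx Gy Gz ox oy oz Nxyz. Qed.

Lemma klein_xz :
  [/\ #|<<[set x; z]>>| = (4 * #|B|)%N,
      {in B, forall u, [/\ u ^ x = u^-1, u ^ z = u^-1 & u ^ y = u]},
      #[x * z] = (2 * #|B|)%N & B \subset <[x * z]>].
Proof.
have [Nxzy _] := klein_quotient_perm nNG oQ Gx Gy Gz Nxyz.
by have [] := klein_quotient_pair nNG cycN oN oQ Gx Gz Gy ox oz oy Nxzy.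
Qed.

Lemma klein_yz :
  [/\ #|<<[set y; z]>>| = (4 * #|C|)%N,
      {in C, forall u, [/\ u ^ y = u^-1, u ^ z = u^-1 & u ^ x = u]},
      #[y * z] = (2 * #|C|)%N & C \subset <[y * z]>].
Proof.
have [_ Nyzx] := klein_quotient_perm nNG oQ Gx Gy Gz Nxyz.
by have [] := klein_quotient_pair nNG cycN oN oQ Gy Gz Gx oy oz ox Nyzx.
Qed.

(** An involution that inverts one of the subgroups centralises another one. *)
Lemma klein_TI : [/\ A :&: B = 1, A :&: C = 1 & B :&: C = 1].
Proof.
have [_ Ai _] := klein_xy; have [_ Bi _ _] := klein_xz; have [_ Ci _ _] := klein_yz.
have ti (D E : {group gT}) : D \subset N ->
    (forall u, u \in D -> u \in E -> u^-1 = u) -> D :&: E = 1.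
  move=> sDN inv; apply/trivgP/subsetP => u /setIP[Du Eu]; rewrite inE.
  by apply/eqP/(odd_self_inv oN); [apply: (subsetP sDN) | apply: inv].
split; apply: ti => [|u Du Eu]; rewrite ?subsetIr //.
- by have [_ _ uz] := Ai u Du; have [_ <- _] := Bi u Eu.
- by have [_ _ uz] := Ai u Du; have [_ <- _] := Ci u Eu.
by have [_ _ uy] := Bi u Du; have [<- _ _] := Ci u Eu.
Qed.

Lemma klein_coprime : [/\ coprime #|A| #|B|, coprime #|A| #|C| & coprime #|B| #|C|].
Proof.
by have [AB AC BC] := klein_TI; split; apply: (TI_cyclic_coprime cycN);
  rewrite ?subsetIr.
Qed.

Lemma klein_oG : #|G| = (4 * #|N|)%N.
Proof. by rewrite -(Lagrange (normal_sub nNG)) -card_quotient ?normal_norm // oQ mulnC. Qed.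

(** Each dihedral subgroup has its index divisible by [|N| / (|A| |B| |C|)], which
    also divides [|G| / 2] and hence is 1. *)
Lemma klein_order :
    coprime (#|G : <<[set x; y]>>| + #|G : <<[set x; z]>>| + #|G : <<[set y; z]>>|)
            #|G|./2 ->
  #|N| = (#|A| * #|B| * #|C|)%N.
Proof.
move=> co; have [cAB cAC cBC] := klein_coprime.
have : #|A| * #|B| * #|C| %| #|N|.
  rewrite Gauss_dvd ?coprimeMl ?cAC // Gauss_dvd // !cardSg ?subsetIr //.
case/dvdnP=> q oNq; suff q1 : q = 1%N by rewrite oNq q1 mul1n.
have sub u v : u \in G -> v \in G -> <<[set u; v]>> \subset G.
  by move=> Gu Gv; rewrite gen_subG subUset !sub1set Gu.
have idx u v d e : <<[set u; v]>> \subset G ->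
    #|<<[set u; v]>>| = (4 * d)%N -> 0 < d -> #|N| = (d * (q * e))%N ->
    #|G : <<[set u; v]>>| = (q * e)%N.
  move=> sD oD d_gt0 Nde; apply/eqP; rewrite -(eqn_pmul2l d_gt0) -(eqn_pmul2l (isT : 0 < 4)).
  by rewrite mulnA -oD Lagrange // klein_oG Nde.
have [oxy _ _] := klein_xy; have [oxz _ _ _] := klein_xz; have [oyz _ _ _] := klein_yz.
move: co; rewrite (idx _ _ _ (#|B| * #|C|)%N _ oxy) ?sub //; last first.
  by rewrite oNq -!mulnA mulnCA.
rewrite (idx _ _ _ (#|A| * #|C|)%N _ oxz) ?sub //; last first.
  by rewrite oNq -!mulnA (mulnCA #|A|) mulnCA.
rewrite (idx _ _ _ (#|A| * #|B|)%N _ oyz) ?sub //; last first.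
  by rewrite oNq mulnA mulnC.
rewrite -!mulnDr => co; apply/eqP; rewrite -dvdn1 -(eqP co) dvdn_gcd dvdn_mulr //=.
by rewrite klein_oG oNq -[4]/(2 * 2)%N -mulnA mul2n doubleK mulnCA dvdn_mulr.
Qed.

Lemma klein_cases4 g : g \in G ->
  [\/ g \in N, x * g \in N, y * g \in N | z * g \in N].
Proof.
move=> Gg; have nN := normal_norm nNG.
have [Nx Ny Nz Ng] : [/\ x \in 'N(N), y \in 'N(N), z \in 'N(N) & g \in 'N(N)].
  by split; apply: (subsetP nN).
have [ox' oy' oz'] : [/\ #[coset N x] = 2, #[coset N y] = 2 & #[coset N z] = 2].
  by split; apply: (order_coset_invol nNG oN).
have xy_z : coset N x * coset N y = coset N z.
  apply: (mulIg (coset N z)); rewrite invol_sq // -!morphM ?groupM //=.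
  by rewrite coset_id.
have nxy' : coset N x != coset N y.
  apply: contra_eq_neq xy_z => <-; rewrite invol_sq // eq_sym.
  by rewrite -order_eq1 oz'.
have oxy : #|<<[set coset N x; coset N y]>>| = 4 by rewrite dih_card // xy_z oz'.
have defQ : <<[set coset N x; coset N y]>> = G / N.
  by apply/eqP; rewrite eqEcard oxy oQ -(quotient_pair nNG) // quotientS // gen_subG subUset !sub1set Gx.
have : coset N g \in <<[set coset N x; coset N y]>> by rewrite defQ mem_quotient.
move/(dih_cases ox' oy'); rewrite xy_z cycle2g // !inE -!morphM //=.
have back u : u \in 'N(N) -> coset N u == 1 -> u \in N by move=> Nu /eqP; apply: coset_idr.
have eqz u : u \in 'N(N) -> coset N u == coset N z -> z * u \in N.
  by move=> Nu /eqP uz; apply: coset_idr; rewrite ?groupM // morphM //= uz invol_sq.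
case/orP=> /orP[].
- by move/(back g Ng); constructor 1.
- by move/(eqz g Ng); constructor 4.
- by move/(back _ (groupM Nx Ng)); constructor 2.
move/(eqz _ (groupM Nx Ng)) => Nzxg; constructor 3.
have [Nxzy _] := klein_quotient_perm nNG oQ Gx Gy Gz Nxyz.
have -> : y * g = (x * z * y) ^ y^-1 * (z * (x * g)).
  rewrite conjgE invgK mulgK !mulgA -(mulgA _ z z) invol_sq //.
  by rewrite mulg1 -(mulgA y x x) invol_sq // mulg1.
by rewrite groupM // memJ_norm // groupV.
Qed.

(** The element [x * y * z] of [N = A * (B * C)] is a product of [a], [b] and [c];
    then [z] and [b * c] differ by an element of [<<[set x; y]>>]. As [(x * z) ^+ 2]
    is [b ^+ 2] and generates [B], so does [b], and similarly for [c]. *)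
Lemma klein_generators :
    #|N| = (#|A| * #|B| * #|C|)%N ->
  exists b c, [/\ b \in B, c \in C, #[b] = #|B|, #[c] = #|C| &
                 z * (b * c)^-1 \in <<[set x; y]>>].
Proof.
move=> oabc; have [cAB cAC cBC] := klein_coprime.
have [_ Ai _] := klein_xy; have [_ Bi oxz Bxz] := klein_xz; have [_ Ci oyz Cyz] := klein_yz.
have sBN : B \subset N by apply: subsetIr.
have sCN : C \subset N by apply: subsetIr.
have sAN : A \subset N by apply: subsetIr.
have defN : A * (B * C) = N.
  have cBC' : B * C = B <*> C.
    by rewrite comm_joingE //; apply: centC; apply: (sub_abelian_cent2 (cyclic_abelian cycN)).
  apply/eqP; rewrite eqEcard mul_subG ?mul_subG //= cBC'.
  have oBC : #|B <*> C| = (#|B| * #|C|)%N by rewrite -cBC' coprime_cardMg.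
  by rewrite coprime_cardMg oBC ?oabc ?mulnA // coprimeMr cAB.
have : x * y * z \in A * (B * C) by rewrite defN.
case/mulsgP=> a _ Aa /mulsgP[b c Bb Cc ->] wE.
have [Na Nb Nc] : [/\ a \in N, b \in N & c \in N].
  by split; [apply: (subsetP sAN) | apply: (subsetP sBN) | apply: (subsetP sCN)].
have zE : z = y * x * (a * (b * c)).
  by rewrite -wE !mulgA -(mulgA y x x) invol_sq // mulg1 invol_sq // mul1g.
have [[[ax ay az] [bx bz b_y]] [cy cz cx]] := (Ai a Aa, Bi b Bb, Ci c Cc).
have gen_sq (D : {group gT}) u v : odd #|D| -> D \subset <[v]> -> #[v] = (2 * #|D|)%N ->
    u \in D -> v ^+ 2 = u ^+ 2 -> #[u] = #|D|.
  move=> oD sDv ov Du vu; apply/eqP; rewrite eqn_dvd order_dvdG //=.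
  have : #[v ^+ 2] = #|D| by rewrite orderXdiv ov ?dvdn_mulr // mulKn.
  by move=> <-; rewrite vu orderXdvd.
exists b, c; split=> //.
- apply: (gen_sq B b (x * z)) => //; first exact: dvdn_odd (cardSg sBN) oN.
  have -> : x * z = x * y * x * (a * (b * c)) by rewrite {1}zE !mulgA.
  have axyx : a ^ (x * y * x) = a^-1 by rewrite !conjgM !(ax, ay, conjVg, invgK).
  have bxyx : b ^ (x * y * x) = b by rewrite !conjgM !(bx, b_y, conjVg, invgK).
  have cxyx : c ^ (x * y * x) = c^-1 by rewrite !conjgM !(cx, cy, conjVg, invgK).
  have sq : (x * y * x) * (x * y * x) = 1.
    by rewrite !mulgA -(mulgA _ x x) invol_sq // mulg1 -(mulgA _ y y) invol_sq // mulg1 invol_sq.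
  have sqV : (x * y * x)^-1 = x * y * x by apply: (mulgI (x * y * x)); rewrite mulgV sq.
  set d := x * y * x in axyx bxyx cxyx sq sqV *.
  have -> : (d * (a * (b * c))) ^+ 2 = (a * (b * c)) ^ d * (a * (b * c)).
    by rewrite expg2 conjgE sqV !mulgA.
  rewrite !conjMg axyx bxyx cxyx expg2.
  rewrite (cNN (groupVr Na) (groupM Nb (groupVr Nc))) -mulgA mulKg.
  by rewrite (cNN Nb Nc) -mulgA mulKg.
- apply: (gen_sq C c (y * z)) => //; first exact: dvdn_odd (cardSg sCN) oN.
  have -> : y * z = x * (a * (b * c)) by rewrite {1}zE -!mulgA (mulgA y y) invol_sq // mul1g.
  have -> : (x * (a * (b * c))) ^+ 2 = (a * (b * c)) ^ x * (a * (b * c)).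
    by rewrite expg2 conjgE invol_inv // !mulgA.
  rewrite !conjMg ax bx cx expg2.
  rewrite (cNN (groupVr Na) (groupM (groupVr Nb) Nc)) -mulgA mulKg.
  by rewrite -mulgA (mulgA c b) (cNN Nc Nb) -mulgA mulKg.
have -> : z * (b * c)^-1 = y * x * a by rewrite {1}zE mulgA mulgK.
by rewrite !groupM ?dih_l ?dih_r //; case/setIP: Aa.
Qed.

(** These are the hypotheses under which [b * c] labels the vertices by pairs of
    residues: [x] inverts [b] and centralises [c], and [y] does the opposite. *)
Lemma klein_direct b c :
    #|N| = (#|A| * #|B| * #|C|)%N -> 1 < #|B| -> 1 < #|C| ->
    b \in B -> c \in C -> #[b] = #|B| -> #[c] = #|C| -> z * (b * c)^-1 \in <<[set x; y]>> ->
  [/\ G \subset <<[set x; y]>> * <[b * c]>, #|G : <<[set x; y]>>| = (#|B| * #|C|)%N,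
      forall h, h \in <<[set x; y]>> -> exists k, [/\ (b * c) ^ h = (b * c) ^+ k,
       (k == 1 %[mod #|B|]) || (k.+1 == 0 %[mod #|B|]) &
       (k == 1 %[mod #|C|]) || (k.+1 == 0 %[mod #|C|])] &
      #|<<[set x; y]>> : <<[set x; y]>> :&: <<[set x; y]>> :^ z| = 4].
Proof.
move=> oabc B_gt1 C_gt1 Bb Cc ob oc zbc; have [cAB cAC cBC] := klein_coprime.
have [oH Ai _] := klein_xy; have [_ Bi _ _] := klein_xz; have [_ Ci _ _] := klein_yz.
have sBN : B \subset N by apply: subsetIr.
have sCN : C \subset N by apply: subsetIr.
have sHG : <<[set x; y]>> \subset G by rewrite gen_subG subUset !sub1set Gx Gy.
have [Nb Nc] : b \in N /\ c \in N.
  by split; [apply: (subsetP sBN) | apply: (subsetP sCN)].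
have [[bx bz b_y] [cy cz cx]] := (Bi b Bb, Ci c Cc).
have cbc : commute b c by apply: cNN.
have ocb : #[b * c] = (#|B| * #|C|)%N by rewrite orderM // ob oc.
have sNc0 : <[b * c]> \subset N by rewrite cycle_subG groupM.
have iH : #|G : <<[set x; y]>>| = (#|B| * #|C|)%N.
  apply/eqP; rewrite -(eqn_pmul2l (cardG_gt0 <<[set x; y]>>)) (Lagrange sHG).
  by rewrite oH klein_oG oabc !mulnA eqxx.
have tiHc : <<[set x; y]>> :&: <[b * c]> = 1.
  have -> : <<[set x; y]>> :&: <[b * c]> = A :&: <[b * c]> by rewrite -setIA (setIidPr sNc0).
  by apply: coprime_TIg; rewrite -[#|<[_]>|]/#[_] ocb coprimeMr cAB.
have GHc : G \subset <<[set x; y]>> * <[b * c]>.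
  have sub : <<[set x; y]>> * <[b * c]> \subset G.
    by rewrite mul_subG // (subset_trans sNc0) ?normal_sub.
  have oHc : #|<<[set x; y]>> * <[b * c]>| = #|G|.
    by rewrite (TI_cardMg tiHc) [#|<[_]>|]ocb -iH (Lagrange sHG).
  by have /eqP <- : <<[set x; y]>> * <[b * c]> == G; rewrite ?eqEcard ?sub ?oHc /=.
have H_sign h : h \in <<[set x; y]>> ->
    (b ^ h == b) || (b ^ h == b^-1) /\ (c ^ h == c) || (c ^ h == c^-1).
  have /subsetP sH : <<[set x; y]>> \subset [set h |
      ((b ^ h == b) || (b ^ h == b^-1)) && ((c ^ h == c) || (c ^ h == c^-1))].
    apply: gen_lmul_sub => [|u v]; rewrite !inE; first by rewrite !conjg1 !eqxx.
    have inv (d e : gT) : (d ^ e == d) || (d ^ e == d^-1) -> (d^-1 ^ e == d) || (d^-1 ^ e == d^-1).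
      by rewrite conjVg => /orP[] /eqP ->; rewrite ?invgK eqxx ?orbT.
    move=> Xu /andP[bv cv]; rewrite !conjgM; case/orP: Xu => /eqP ->.
      by rewrite bx cx inv.
    by rewrite b_y cy bv inv.
  by move/sH; rewrite inE => /andP[].
have sign_exp h : (b ^ h == b) || (b ^ h == b^-1) -> (c ^ h == c) || (c ^ h == c^-1) ->
    exists k, [/\ (b * c) ^ h = (b * c) ^+ k,
       (k == 1 %[mod #|B|]) || (k.+1 == 0 %[mod #|B|]) &
       (k == 1 %[mod #|C|]) || (k.+1 == 0 %[mod #|C|])].
  move=> hb hc.
  have pick (d : gT) m : #[d] = m -> (d ^ h == d) || (d ^ h == d^-1) ->
      exists i, d ^ h = d ^+ i /\ (i == 1 %[mod m]) || (i.+1 == 0 %[mod m]).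
    move=> od /orP[] /eqP ->; first by exists 1%N; rewrite expg1 eqxx.
    exists m.-1; rewrite -od invg_expg prednK ?order_gt0 //.
    by rewrite modnn mod0n eqxx orbT.
  have [i [bi Bi']] := pick b _ ob hb; have [j [cj Cj]] := pick c _ oc hc.
  exists (chinese #|B| #|C| i j); split.
  - rewrite conjMg bi cj expgMn //; congr (_ * _); apply/eqP.
      by rewrite eq_expg_mod_order ob chinese_modl.
    by rewrite eq_expg_mod_order oc chinese_modr.
  - by rewrite chinese_modl // -[(chinese _ _ _ _).+1]addn1 -modnDml chinese_modl // modnDml addn1.
  by rewrite chinese_modr // -[(chinese _ _ _ _).+1]addn1 -modnDml chinese_modr // modnDml addn1.
split=> //.
  move=> h Hh; have [hb hc] := H_sign h Hh; exact: sign_exp.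
have LA : <<[set x; y]>> :&: <<[set x; y]>> :^ z = A.
  have zV := invol_inv oz; apply/setP => h; rewrite inE mem_conjg zV [RHS]inE.
  case Hh: (h \in <<[set x; y]>>) => //=; apply/idP/idP => [Hhz | Nh]; last first.
    have Ah : h \in A by rewrite inE Hh.
    by have [_ _ ->] := Ai h Ah.
  have [t def_t] : {t | t = z * (b * c)^-1} by exists (z * (b * c)^-1).
  rewrite -def_t in zbc; have zt : z = t * (b * c) by rewrite def_t mulgKV.
  have Hht : h ^ t \in <<[set x; y]>> by rewrite groupJ.
  have Gt := subsetP sHG t zbc.
  suff : h ^ t \in N by rewrite memJ_norm // (subsetP (normal_norm nNG)).
  have fix_bc : (b * c) ^ (h ^ t) = b * c.
    have [k [bck _ _]] := sign_exp _ (H_sign _ Hht).1 (H_sign _ Hht).2.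
    have : ((b * c) ^ (h ^ t))^-1 * (b * c) \in <<[set x; y]>> :&: <[b * c]>.
      rewrite inE; apply/andP; split; last by rewrite bck groupM ?groupV ?mem_cycle ?cycle_id.
      have -> : ((b * c) ^ (h ^ t))^-1 * (b * c) = (h ^ t)^-1 * (h ^ t) ^ (b * c).
        by rewrite -conjVg !conjgE !mulgA.
      by rewrite groupM ?groupV // -conjgM -zt.
    rewrite tiHc inE -eq_mulVg1 => /eqP //.
  have Nbc : b * c \in N by rewrite groupM.
  have act u : u \in G -> #[u] = 2 -> u * h ^ t \in N -> (b * c) ^ u = b * c.
    move=> Gu ou Nuh; rewrite -[RHS]fix_bc.
    have -> : h ^ t = u * (u * h ^ t) by rewrite mulgA invol_sq // mul1g.
    by rewrite conjgM [RHS]cNJ // memJ_norm // (subsetP (normal_norm nNG)).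
  have neq1 u d : #[u] = d -> 1 < d -> u \in N -> u^-1 = u -> False.
    by move=> ou d_gt1 Nu /(odd_self_inv oN Nu) u1; move: d_gt1; rewrite -ou u1 order1.
  have [//|/(act x Gx ox)|/(act y Gy oy)|/(act z Gz oz)] := klein_cases4 (subsetP sHG _ Hht).
  - by rewrite conjMg bx cx => /mulIg /(neq1 b _ ob B_gt1 Nb).
  - by rewrite conjMg b_y cy => /mulgI /(neq1 c _ oc C_gt1 Nc).
  rewrite conjMg bz cz -invMg (cNN Nc Nb) => /(neq1 _ _ ocb) [] //.
  by rewrite (leq_trans B_gt1) // leq_pmulr // ltnW.
by rewrite LA -divgS ?subsetIl // oH mulnK.
Qed.

End KleinTriple.

(** * The case of a normal Klein group *)

(** Modulo the odd group [N] the group is [S_4]: [a] and [b] become transpositions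
    with a product of order 3, and [c] a double transposition that commutes with
    [b] and not with [a]. *)
Definition s4_triple (gT : finGroupType) (K N : {group gT}) (a b c : gT) : Prop :=
  [/\ [/\ a \notin K, b \notin K & c \in K], c ^ a != c /\ commute c b,
      #|<<[set a; b]>>| = (6 * #|N|)%N /\ N \subset <<[set a; b]>>,
      <<[set a; b]>> :&: K = 1 &
      {in K, forall k, k ^ (a * b) = k -> k = 1}].

Section NormalKlein.

Variables (gT : finGroupType) (G K N : {group gT}).
Hypotheses (nKG : K <| G) (nNG : N <| G) (abK : 2.-abelem K) (oK : #|K| = 4).
Hypotheses (cycN : cyclic N) (oN : odd #|N|) (defC : K \x N = 'C_G(K)).
Hypothesis (iC : #|G : 'C_G(K)| = 6).

Local Notation C := 'C_G(K)%G.

Lemma nk_C_normal : C <| G.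
Proof.
rewrite /normal subsetIl normsI ?normG //.
exact: subset_trans (normal_norm nKG) (cent_norm _).
Qed.

Lemma nk_oC : #|C| = (4 * #|N|)%N. Proof. by rewrite -(dprod_card defC) oK. Qed.

Lemma nk_oG : #|G| = (24 * #|N|)%N.
Proof. by rewrite -(Lagrange (normal_sub nk_C_normal)) iC nk_oC mulnC mulnA. Qed.

Lemma nk_invol u : u \in C -> u * u = 1 -> u \in K.
Proof.
have [_ <- cKN tiKN] := dprodP defC => /mulsgP[k v Kk Nv ->] uu.
suff -> : v = 1 by rewrite mulg1.
apply: (odd_self_inv oN Nv); apply: (mulIg v); rewrite mulVg.
have kv : v * k = k * v by have /centP/(_ k Kk) := subsetP cKN v Nv.
by rewrite -uu -!mulgA (mulgA v k) kv -!mulgA (mulgA k k) (klein_sq abK Kk) mul1g.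
Qed.

Lemma nk_exp u : u \in C -> u ^+ (2 * #|N|) = 1.
Proof.
have [_ <- cKN tiKN] := dprodP defC => /mulsgP[k v Kk Nv ->].
have kv : commute k v by have /centP/(_ k Kk) := subsetP cKN v Nv.
rewrite expgMn // expgM expg2 (klein_sq abK Kk) expg1n mul1g mulnC expgM.
by rewrite (expg_cardG Nv) expg1n.
Qed.

(** Involutions outside [K] map to transpositions of [G / C], which is [S_3]. *)
Lemma nk_cube a b : a \in G -> b \in G -> #[a] = 2 -> #[b] = 2 ->
  a \notin K -> b \notin K -> (a * b) ^+ 3 \in C.
Proof.
move=> Ga Gb oa ob nKa nKb; have nC := normal_norm nk_C_normal.
have [u Qu ou] : {u | u \in G / C & #[u] = 3}.
  by apply: Cauchy => //; rewrite card_quotient // iC.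
have iP : #|G / C : <[u]>| = 2.
  by rewrite -divgS ?cycle_subG // card_quotient // iC -[#|<[u]>|]/#[u] ou.
have sP : <[u]> \subset G / C by rewrite cycle_subG.
have out c : c \in G -> #[c] = 2 -> c \notin K -> coset C c \notin <[u]>.
  move=> Gc oc nKc; have Nc := subsetP nC c Gc; apply/negP => /order_dvdG.
  rewrite -[#|<[u]>|]/#[u] ou => d3.
  have d2 : #[coset C c] %| 2 by rewrite -oc; apply: morph_order.
  have /eqP : #[coset C c] == 1%N by rewrite -dvdn1 -[1%N]/(gcdn 2 3) dvdn_gcd d2.
  move/eqP; rewrite order_eq1 => /eqP/(coset_idr Nc) Cc.
  by case/negP: nKc; apply: nk_invol => //; apply: invol_sq.
have [Na Nb] := (subsetP nC a Ga, subsetP nC b Gb).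
have ab_u : coset C a * coset C b \in <[u]>.
  rewrite -[coset C b]invgK -mem_rcoset (rcoset_index2 sP iP) inE.
    by rewrite out ?mem_quotient.
  by rewrite groupV out //= groupV mem_quotient.
apply: coset_idr; first by rewrite groupX ?groupM.
rewrite morphX ?groupM // morphM //; apply/eqP; rewrite -order_dvdn.
by rewrite -ou order_dvdG.
Qed.

(** An odd index would give [<<[set a; b]>>] an order divisible by 8, like [|G|]; but
    [(a * b) ^+ 3] lies in [C], whose elements have order dividing [2 |N|]. *)
Lemma nk_even_index a b : a \in G -> b \in G -> #[a] = 2 -> #[b] = 2 ->
  a \notin K -> b \notin K -> ~~ odd #|G : <<[set a; b]>>|.
Proof.
move=> Ga Gb oa ob nKa nKb; apply/negP => odd_i.
have sD : <<[set a; b]>> \subset G by rewrite gen_subG subUset !sub1set Ga.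
have : 8 %| #|<<[set a; b]>>|.
  rewrite -(@Gauss_dvdl 8 _ #|G : <<[set a; b]>>|).
    by rewrite Lagrange // nk_oG -[24]/(8 * 3)%N -mulnA dvdn_mulr.
  by rewrite -[8]/(2 ^ 3)%N coprimeXl // coprime2n.
have [-> | nab] := eqVneq a b.
  by rewrite setUid -[#|_|]/#[b] ob.
rewrite dih_card // -[8]/(2 * 4)%N dvdn_pmul2l // => d4.
have : 4 %| 3 * (2 * #|N|).
  apply: dvdn_trans d4 _; rewrite order_dvdn expgM.
  by rewrite nk_exp ?nk_cube.
rewrite mulnCA -[4]/(2 * 2)%N dvdn_pmul2l // dvdn2 oddM oN //.
Qed.

(** The subgroup lies in the 2-group [<[a]> * K], while 3 divides [|G|]. *)
Lemma nk_index3 a b : a \in G -> #[a] = 2 -> b \in K ->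
  3 %| #|G : <<[set a; b]>>|.
Proof.
move=> Ga oa Kb; have Gb : b \in G := subsetP (normal_sub nKG) b Kb.
have sD : <<[set a; b]>> \subset G by rewrite gen_subG subUset !sub1set Ga.
have nKa : <[a]> \subset 'N(K) by rewrite cycle_subG (subsetP (normal_norm nKG)).
have : #|<<[set a; b]>>| %| 8.
  have s1 : <<[set a; b]>> \subset <[a]> <*> K.
    rewrite gen_subG subUset !sub1set (subsetP (joing_subl _ _)) ?cycle_id //.
    by rewrite (subsetP (joing_subr _ _)).
  apply: dvdn_trans (cardSg s1) _; rewrite /= norm_joinEl //.
  rewrite -[8]/(2 * 4)%N -oK -{1}oa mul_cardG dvdn_mulr //.
move=> d8; have : coprime 3 #|<<[set a; b]>>|.
  by rewrite (coprime_dvdr d8).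
move/Gauss_dvdr => <-; rewrite Lagrange // nk_oG -[24]/(3 * 8)%N -mulnA dvdn_mulr //.
Qed.

Lemma nk_order_comm b c : #[b] = 2 -> b \notin K -> c \in K -> c != 1 -> commute c b ->
  #|<<[set b; c]>>| = 4.
Proof.
move=> ob nKb Kc c1 cb.
have oc : #[c] = 2 by apply: abelem_order_p abK _ _.
have nbc : b != c by apply: contraNneq nKb => ->.
rewrite dih_card // (_ : #[b * c] = 2) //.
have bc2 : (b * c) ^+ 2 = 1.
  by rewrite (expgMn _ (commute_sym cb)) !expg2 (invol_sq ob) (invol_sq oc) mulg1.
have bc1 : b * c != 1.
  by apply: contra nbc => /eqP bc; rewrite -(inj_eq (mulIg c)) bc invol_sq.
have : #[b * c] %| 2 by rewrite order_dvdn bc2.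
by rewrite (dvdn_divisors _ (isT : 0 < 2)) !inE order_eq1 (negbTE bc1) /= => /eqP.
Qed.

Lemma nk_order_ncomm a c : a \in G -> #[a] = 2 -> c \in K -> c ^ a != c ->
  <<[set a; c]>> = <[a]> * K /\ #|<<[set a; c]>>| = 8.
Proof.
move=> Ga oa Kc nca; have nKa : <[a]> \subset 'N(K).
  by rewrite cycle_subG (subsetP (normal_norm nKG)).
have c1 : c != 1 by apply: contraNneq nca => ->; rewrite conj1g.
have Kca : c ^ a \in K by rewrite memJ_norm // (subsetP nKa) ?cycle_id.
have aK : a \notin K.
  by apply: contra nca => Ka; apply/eqP/conjg_fixP/commgP/(klein_comm abK).
have sK : K \subset <<[set a; c]>>.
  have ca1 : c ^ a != 1 by rewrite conjg_eq1.
  rewrite eq_sym in nca; rewrite -(klein_gen oK Kc Kca c1 ca1 nca).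
  by rewrite gen_subG subUset !sub1set groupJ ?dih_l ?dih_r.
have defD : <<[set a; c]>> = <[a]> * K.
  apply/eqP; rewrite eqEsubset; apply/andP; split; last first.
    by apply: mul_subG; [rewrite cycle_subG dih_l | exact: sK].
  rewrite -norm_joinEl //.
  rewrite gen_subG subUset !sub1set (subsetP (joing_subl _ _)) ?cycle_id //.
  by rewrite (subsetP (joing_subr _ _)).
split=> //; have tiaK : <[a]> :&: K = 1.
  apply/eqP; rewrite -subG1; apply/subsetP => u /setIP[].
  by rewrite /= cycle2g // !inE => /orP[] // /eqP ->; rewrite (negbTE aK).
by rewrite defD (TI_cardMg tiaK) oK [#|_|]oa.
Qed.

(** The rotation [r = a * b] has order 3 modulo [C], since otherwise 3 would divide
    the index. So [r] permutes the involutions of [K] cyclically, and [r ^+ 3], which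
    commutes with [r], lies in the factor [N] of [C = K \x N]. *)
Lemma nk_pair a b : a \in G -> b \in G -> #[a] = 2 -> #[b] = 2 ->
    a \notin K -> b \notin K -> ~~ (3 %| #|G : <<[set a; b]>>|) ->
  [/\ {in K, forall k, k ^ (a * b) = k -> k = 1}, <<[set a; b]>> :&: K = 1 &
      exists t, [/\ #|<<[set a; b]>>| = (6 * t)%N, t %| #|N| &
                    t = #|N| -> N \subset <<[set a; b]>>]].
Proof.
move=> Ga Gb oa ob nKa nKb n3; set r := a * b; set D := <<[set a; b]>>.
have sD : D \subset G by rewrite gen_subG subUset !sub1set Ga.
have Gr : r \in G by rewrite groupM.
have Cr3 : r ^+ 3 \in C by apply: nk_cube.
have nab : a != b.
  apply: contraNneq n3 => ab; have := Lagrange sD.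
  rewrite /D ab setUid -[#|_|]/#[b] ob nk_oG -[24]/(2 * 12)%N -mulnA => /eqP.
  by rewrite eqn_pmul2l // => /eqP ->; rewrite -[12]/(3 * 4)%N -mulnA dvdn_mulr.
have oD : #|D| = (2 * #[r])%N by rewrite /D dih_card.
have nCr : r \notin C.
  apply: contra n3 => Cr; have : #[r] %| 2 * #|N| by rewrite order_dvdn nk_exp.
  case/dvdnP=> q oN2; have := Lagrange sD; rewrite oD nk_oG -[24]/(2 * (6 * 2))%N.
  rewrite -!mulnA oN2 => /eqP; rewrite eqn_pmul2l // mulnA (mulnC _ #[r]) eqn_pmul2l ?order_gt0 //.
  by move/eqP ->; rewrite -[6]/(3 * 2)%N -mulnA dvdn_mulr.
have nC := normal_norm nk_C_normal; have Nr := subsetP nC r Gr.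
have or3 : #[coset C r] = 3.
  have : #[coset C r] %| 3 by rewrite order_dvdn -morphX //= coset_id.
  rewrite (dvdn_divisors _ (isT : 0 < 3)) !inE order_eq1 => /orP[/eqP/(coset_idr Nr)|/eqP //].
  by rewrite (negbTE nCr).
have fixK : {in K, forall k, k ^ r = k -> k = 1}.
  move=> k Kk kr; apply/eqP/negPn/negP => k1.
  have rk : r \in 'C_G[k].
    by rewrite inE Gr; apply/cent1P/commute_sym/commgP/conjg_fixP.
  have nCk : 'C_G[k] \subset 'N(C) by apply: subset_trans nC; apply: subsetIl.
  have : #[coset C r] %| #|'C_G[k] : C|.
    by rewrite -card_quotient // order_dvdG // mem_quotient.
  rewrite or3 => /dvdn_leq; rewrite indexg_gt0 => /(_ isT).
  by rewrite leqNgt ltnS (klein_stab nKG oK Kk k1).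
have KKr k : k \in K -> k ^ r \in K.
  by move=> Kk; rewrite memJ_norm // (subsetP (normal_norm nKG)).
have tiRK k : k \in K -> k \in <[r]> -> k = 1.
  move=> Kk /cycleP[i ki]; apply: fixK => //; rewrite ki.
  exact/conjg_fixP/commgP/commute_sym/commuteX.
have tiDK : D :&: K = 1.
  apply/eqP; rewrite -subG1; apply/subsetP => k /setIP[Dk Kk]; rewrite inE; apply/eqP.
  have Dr : r \in D by rewrite groupM ?dih_l ?dih_r.
  have := dih_cases oa ob Dk; case/orP=> [rk | rak]; first exact: tiRK.
  have Dkr : k ^ r \in D by rewrite groupJ.
  have := dih_cases oa ob Dkr; case/orP=> [rkr | rakr].
    by apply/eqP; rewrite -(conjg_eq1 k r); apply/eqP/tiRK; rewrite ?KKr.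
  apply: fixK => //; apply/eqP; rewrite eq_sym eq_mulVg1; apply/eqP/tiRK.
    by rewrite groupM ?groupV ?KKr.
  have -> : k^-1 * k ^ r = (a * k)^-1 * (a * k ^ r) by rewrite invMg -mulgA mulKg.
  by rewrite groupM ?groupV.
split=> //; exists #[r ^+ 3].
have Nr3 : r ^+ 3 \in N.
  have [_ defKN cKN tiKN] := dprodP defC.
  move: Cr3; rewrite -defKN => /mulsgP[k v Kk Nv r3].
  have kr : k ^ r * v ^ r = k * v.
    by rewrite -conjMg -r3; apply/conjg_fixP/commgP/commute_sym/commuteX.
  have k1 : k^-1 * k ^ r = 1.
    apply/set1gP; rewrite -tiKN inE groupM ?groupV ?KKr //=.
    have -> : k^-1 * k ^ r = v * (v ^ r)^-1 by rewrite -[k ^ r](mulgK (v ^ r)) kr -!mulgA mulKg.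
    by rewrite groupM ?groupV // memJ_norm // (subsetP (normal_norm nNG)).
  rewrite r3 (fixK k Kk) ?mul1g //; apply/eqP; by rewrite eq_sym eq_mulVg1 k1.
have d3 : 3 %| #[r] by rewrite -or3; apply: morph_order.
have oD6 : #|D| = (6 * #[r ^+ 3])%N.
  by rewrite oD orderXdiv // -[6]/(2 * 3)%N -mulnA (mulnC 3) divnK.
split=> //; first exact: order_dvdG.
move=> oN3; have <- : <[r ^+ 3]> = N.
  by apply/eqP; rewrite eqEcard cycle_subG Nr3 -oN3 /=.
by rewrite cycle_subG groupX // groupM ?dih_l ?dih_r.
Qed.

(** Neither [a] nor [b] lies in [K], by [nk_index3], so [<<[set a; b]>>] has even index;
    the sum of the indices is odd, which forces [c] into [K] and makes exactly one of
    [a] and [b] commute with [c]. The two last indices then add up to [9 |N|], so a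
    common factor of the first index and [|N|] would divide the sum and [|G| / 2]:
    hence [<<[set a; b]>>] has order [6 |N|]. *)
Lemma nk_triple a b c :
    a \in G -> b \in G -> c \in G -> #[a] = 2 -> #[b] = 2 -> #[c] = 2 ->
    coprime (#|G : <<[set a; b]>>| + #|G : <<[set a; c]>>| + #|G : <<[set b; c]>>|) #|G|./2 ->
    ~~ (3 %| #|G : <<[set a; b]>>|) ->
  s4_triple K N a b c \/ s4_triple K N b a c.
Proof.
move=> Ga Gb Gc oa ob oc co n3.
have nKa : a \notin K by apply: contra n3 => Ka; rewrite setUC; apply: nk_index3.
have nKb : b \notin K by apply: contra n3 => Kb; apply: nk_index3.
have even_ab := nk_even_index Ga Gb oa ob nKa nKb.
have o2 : #|G|./2 = (12 * #|N|)%N by rewrite nk_oG -[24]/(2 * 12)%N -mulnA mul2n doubleK.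
have odd_sum : odd #|G : <<[set a; c]>>| != odd #|G : <<[set b; c]>>|.
  have : coprime (#|G : <<[set a; b]>>| + #|G : <<[set a; c]>>| + #|G : <<[set b; c]>>|) 2.
    by apply: coprime_dvdr co; rewrite o2 -[12]/(2 * 6)%N -mulnA dvdn_mulr.
  by rewrite coprimen2 !oddD (negbTE even_ab) /=; case: (odd _); case: (odd _).
have Kc : c \in K.
  apply: contraR odd_sum => nKc.
  by rewrite (negbTE (nk_even_index Ga Gc oa oc nKa nKc)) (negbTE (nk_even_index Gb Gc ob oc nKb nKc)).
have c1 : c != 1 := invol_neq1 oc.
have even4 u : u \in G -> #[u] = 2 -> u \notin K -> commute c u ->
    #|G : <<[set u; c]>>| = (6 * #|N|)%N.
  move=> Gu ou nKu cu; have sD : <<[set u; c]>> \subset G by rewrite gen_subG subUset !sub1set Gu.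
  by rewrite -divgS // nk_order_comm // nk_oG -[24]/(4 * 6)%N -mulnA mulKn.
have odd3 u : u \in G -> #[u] = 2 -> u \notin K -> c ^ u != c ->
    #|G : <<[set u; c]>>| = (3 * #|N|)%N.
  move=> Gu ou nKu cu; have sD : <<[set u; c]>> \subset G by rewrite gen_subG subUset !sub1set Gu.
  have [_ oD] := nk_order_ncomm Gu ou Kc cu.
  by rewrite -divgS // oD nk_oG -[24]/(8 * 3)%N -mulnA mulKn.
have [fixK tiDK [t [oD tN sND]]] := nk_pair Ga Gb oa ob nKa nKb n3.
have sD : <<[set a; b]>> \subset G by rewrite gen_subG subUset !sub1set Ga.
have t_gt0 : 0 < t by apply: dvdn_gt0 tN; apply: cardG_gt0.
have [s oNs] := dvdnP tN.
have iD : #|G : <<[set a; b]>>| = (4 * s)%N.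
  rewrite -divgS // oD nk_oG oNs (_ : 24 * (s * t) = 4 * s * (6 * t))%N ?mulnK ?muln_gt0 //.
  by rewrite -[24]/(4 * 6)%N -!mulnA (mulnCA 6).
have tE : #|G : <<[set a; c]>>| + #|G : <<[set b; c]>>| = (9 * #|N|)%N -> t = #|N|.
  move=> sum9; move: co; rewrite -addnA sum9 iD o2 oNs => co.
  have : s %| 1.
    have sd k : s %| k * (s * t) by rewrite mulnCA dvdn_mulr.
    by rewrite -(eqP co) dvdn_gcd dvdn_add ?sd ?dvdn_mull.
  by rewrite dvdn1 => /eqP ->; rewrite mul1n.
have comm u : commute c u -> c ^ u == c by move=> cu; apply/eqP/conjg_fixP/commgP.
have [ca | nca] := boolP (c ^ a == c); have [cb | ncb] := boolP (c ^ b == c).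
- case/negP: odd_sum; rewrite !even4 //; by apply/commgP/conjg_fixP/eqP.
- right; have cca : commute c a by apply/commgP/conjg_fixP/eqP.
  have tN' : t = #|N| by apply: tE; rewrite even4 // odd3 // -mulnDl.
  rewrite /s4_triple setUC; split=> //; first by rewrite oD tN' sND.
  move=> k Kk kr; apply: fixK => //; rewrite -{1}kr -conjgM.
  by rewrite -mulgA (mulgA a a) !invol_sq // mul1g invol_sq // conjg1.
- left; have ccb : commute c b by apply/commgP/conjg_fixP/eqP.
  have tN' : t = #|N| by apply: tE; rewrite odd3 // even4 // -mulnDl.
  by rewrite /s4_triple; split=> //; rewrite oD tN' sND.
by case/negP: odd_sum; rewrite !odd3.
Qed.

End NormalKlein.

(** If [z] normalised [T] then [T] would have index at most 2 in [G]. *)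
Lemma meet_conj_index2 (gT : finGroupType) (G T L : {group gT}) (z : gT) :
    T \subset G -> G \subset <<z |: T>> -> z * z = 1 -> 2 < #|G : T| ->
    L \subset T -> L \subset T :^ z -> #|T : L| <= 2 ->
  #|T : T :&: T :^ z| = 2.
Proof.
move=> sTG genG zz iT sLT sLz iL.
have sL : L \subset T :&: T :^ z by rewrite subsetI sLT.
have le2 : #|T : T :&: T :^ z| <= 2.
  by apply: leq_trans iL; apply: dvdn_leq => //; apply: indexgS.
have : #|T : T :&: T :^ z| != 1%N.
  apply/negP; rewrite indexg_eq1 subsetI subxx /= => sTz.
  have nTz : z \in 'N(T).
    by apply/normP/eqP; rewrite eq_sym eqEcard sTz cardJg leqnn.
  have : G \subset T * <[z]>.
    apply: subset_trans genG _; rewrite -norm_joinEr ?cycle_subG // gen_subG.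
    by rewrite subUset sub1set joing_subl (subsetP (joing_subr _ _)) ?cycle_id.
  move=> sG; have : #|G : T| <= 2; last by rewrite leqNgt iT.
  have oz : #|<[z]>| <= 2 by apply: dvdn_leq => //; rewrite [_ %| 2]order_dvdn expg2 zz.
  apply: leq_trans oz; apply: leq_trans (leq_imset_card (rcoset T) <[z]>).
  rewrite -[#|[set _ | _ in _]|]/(#|<[z]> : T|) -(indexMg T <[z]>).
  exact: subset_leq_card (imsetS _ sG).
by case: #|_ : _| (indexg_gt0 T (T :&: T :^ z)) le2 => [|[|[|]]].
Qed.

(** * Graphs from extensions of the symmetric group of degree four *)

Section S4Triple.

Variables (gT : finGroupType) (G K N : {group gT}) (a b c : gT).
Hypotheses (nKG : K <| G) (nNG : N <| G) (abK : 2.-abelem K) (oK : #|K| = 4).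
Hypotheses (cycN : cyclic N) (oN : odd #|N|) (defC : K \x N = 'C_G(K)).
Hypothesis (iC : #|G : 'C_G(K)| = 6).
Hypotheses (genG : G \subset <<[set a; b; c]>>).
Hypotheses (Ga : a \in G) (Gb : b \in G) (oa : #[a] = 2) (ob : #[b] = 2) (oc : #[c] = 2).
Hypothesis s4 : s4_triple K N a b c.

Let KG k : k \in K -> k \in G. Proof. exact: (subsetP (normal_sub nKG)). Qed.
Let Kc : c \in K. Proof. by case: s4 => -[]. Qed.
Let nKa : a \notin K. Proof. by case: s4 => -[]. Qed.
Let nKb : b \notin K. Proof. by case: s4 => -[]. Qed.
Let cca : c ^ a != c. Proof. by case: s4 => _ []. Qed.
Let ccb : commute c b. Proof. by case: s4 => _ []. Qed.
Let oD : #|<<[set a; b]>>| = (6 * #|N|)%N. Proof. by case: s4 => _ _ []. Qed.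
Let sND : N \subset <<[set a; b]>>. Proof. by case: s4 => _ _ []. Qed.
Let tiDK : <<[set a; b]>> :&: K = 1. Proof. by case: s4. Qed.
Let fixK : {in K, forall k, k ^ (a * b) = k -> k = 1}. Proof. by case: s4. Qed.
Let nK g : g \in G -> g \in 'N(K). Proof. exact: (subsetP (normal_norm nKG)). Qed.
Let oG : #|G| = (24 * #|N|)%N. Proof. exact: nk_oG nKG oK defC iC. Qed.
Let sDG : <<[set a; b]>> \subset G. Proof. by rewrite gen_subG subUset !sub1set Ga. Qed.

Let Kca : c ^ a \in K. Proof. by rewrite memJ_norm ?nK. Qed.
Let c1 : c != 1. Proof. exact: invol_neq1. Qed.
Let ca1 : c ^ a != 1. Proof. by rewrite conjg_eq1. Qed.

Lemma s4_index : #|G : <<[set a; b]>>| = 4.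
Proof. by rewrite -divgS // oD oG -[24]/(4 * 6)%N -mulnA mulnK // muln_gt0 cardG_gt0. Qed.

Lemma s4_orders : #|<<[set a; c]>>| = 8 /\ #|<<[set b; c]>>| = 4.
Proof.
split; first by have [] := nk_order_ncomm nKG abK oK Ga oa Kc cca.
exact: (nk_order_comm abK ob nKb Kc c1 ccb).
Qed.

(** Conjugation by [a * b] fixes no involution of [K], and [b] commutes with [c] but
    not with all of [K]; so [c], [c ^ a] and [c ^ (a * b)] are the three involutions
    of [K]. *)
Lemma s4_conj : c ^ (a * b) = c * c ^ a.
Proof.
have ncca : c != c ^ a by rewrite eq_sym.
have Kcab : c ^ (a * b) \in K by rewrite memJ_norm ?nK ?groupM.
have := klein_cases abK oK Kc Kca c1 ca1 ncca Kcab.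
rewrite !inE conjg_eq1 (negbTE c1) /=.
case/or3P => /eqP // E.
  by case/eqP: c1; apply: fixK.
case/negP: nKb; apply: (nk_invol abK oN defC); last exact: invol_sq.
rewrite inE Gb /= -(klein_gen oK Kc Kca c1 ca1 ncca) cent_gen; apply/centP => u.
have cab : commute (c ^ a) b by apply/commgP/conjg_fixP; rewrite -conjgM.
by rewrite !inE => /orP[] /eqP ->; apply: commute_sym.
Qed.

(** An element [h] of [<<[set a; b]>>] with [h ^ c] in it as well commutes with [c],
    because the commutator lies in [K]; and [c] has three conjugates. *)
Lemma s4_complete_index :
  #|<<[set a; b]>> : <<[set a; b]>> :&: <<[set a; b]>> :^ c| = 3.
Proof.
have cV := invol_inv oc.
have -> : <<[set a; b]>> :&: <<[set a; b]>> :^ c = 'C_(<<[set a; b]>>)[c].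
  apply/setP => h; rewrite inE [RHS]inE mem_conjg cV.
  case Dh: (h \in _) => //=; apply/idP/idP => [Dhc | /cent1P hc]; last first.
    by rewrite (conjg_fixP _) //; apply/commgP.
  have Gh := subsetP sDG h Dh.
  apply/cent1P/commgP/conjg_fixP.
  have : h^-1 * h ^ c \in <<[set a; b]>> :&: K.
    rewrite inE groupM ?groupV //=.
    have -> : h^-1 * h ^ c = (c^-1) ^ h * c by rewrite !conjgE !mulgA.
    by rewrite groupM // memJ_norm ?groupV ?nK.
  by rewrite tiDK inE => /eqP E; apply/eqP; rewrite eq_sym eq_mulVg1 E.
rewrite index_cent1; apply/eqP; rewrite eqn_leq; apply/andP; split.
  have : c ^: <<[set a; b]>> \subset K :\ 1.
    apply/subsetP => _ /imsetP[g Dg ->]; rewrite !inE conjg_eq1 c1.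
    by rewrite memJ_norm ?nK ?(subsetP sDG).
  by move/subset_leq_card; have := cardsD1 1 K; rewrite group1 oK add1n => -[<-].
have s3 : [set c; c ^ a; c ^ (a * b)] \subset c ^: <<[set a; b]>>.
  by rewrite !subUset !sub1set class_refl !memJ_class ?groupM ?dih_l ?dih_r.
apply: leq_trans (subset_leq_card s3).
have n1 : c * c ^ a != c by rewrite -[X in _ != X]mulg1 (inj_eq (mulgI c)).
have n2 : c * c ^ a != c ^ a by rewrite -[X in _ != X]mul1g (inj_eq (mulIg _)).
by rewrite s4_conj setUC cardsU1 cards2 !inE negb_or n1 n2 (eq_sym c) cca.
Qed.

Lemma s4_gen (T : {group gT}) u v w : c \in T -> [set u; v] = [set a; b] ->
  w = v -> u \in T -> G \subset <<w |: T>>.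
Proof.
move=> Tc uv -> Tu; apply: subset_trans genG _; rewrite gen_subG -uv !subUset !sub1set.
by rewrite !mem_gen // !inE ?eqxx ?Tc ?Tu ?orbT.
Qed.

(** Here [<<[set a; c]>>] contains [K], which [b] normalises. *)
Lemma s4_cycle : G \subset <<b |: <<[set a; c]>>%G>> -> 2 < #|G : <<[set a; c]>>| ->
  #|<<[set a; c]>> : <<[set a; c]>> :&: <<[set a; c]>> :^ b| = 2.
Proof.
move=> gen iH; have [defH oH] := nk_order_ncomm nKG abK oK Ga oa Kc cca.
have sH : <<[set a; c]>> \subset G by rewrite gen_subG subUset !sub1set Ga KG.
have sK : K \subset <<[set a; c]>> by rewrite defH mulG_subr.
apply: (@meet_conj_index2 _ G _ K) => //; first exact: invol_sq.
  by have /normP <- := nK Gb; rewrite conjSg.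
by rewrite -divgS // oH oK.
Qed.

(** The subgroup [T] has order 8 and contains [K], so that its cosets form a cycle;
    each one is the union of two cosets of [<<[set b; c]>>]. *)
Lemma s4_lex :
  let T := (<[b]> <*> K)%G in
  [/\ <<[set b; c]>> \subset T, T \subset G, #|T : <<[set b; c]>>| = 2,
      #|T : T :&: T :^ a| = 2 & #|G : T| = (3 * #|N|)%N] /\
  #|<<[set b; c]>> : <<[set b; c]>> :&: <<[set b; c]>> :^ a| = 4.
Proof.
move=> T; have [_ oH] := s4_orders.
have nKb' : <[b]> \subset 'N(K) by rewrite cycle_subG nK.
have sHT : <<[set b; c]>> \subset T.
  rewrite gen_subG subUset !sub1set (subsetP (joing_subl _ _)) ?cycle_id //.
  by rewrite (subsetP (joing_subr _ _)).
have sTG : T \subset G by rewrite join_subG cycle_subG Gb normal_sub.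
have tibK : <[b]> :&: K = 1.
  apply/eqP; rewrite -subG1; apply/subsetP => u /setIP[].
  by rewrite /= cycle2g // !inE => /orP[] // /eqP ->; rewrite (negbTE nKb).
have defT : T = <[b]> * K :> {set gT} by rewrite /= norm_joinEl.
have oT : #|T| = 8 by rewrite defT (TI_cardMg tibK) oK [#|_|]ob.
have iT : #|G : T| = (3 * #|N|)%N by rewrite -divgS // oT oG -[24]/(8 * 3)%N -mulnA mulKn.
have sKT : K \subset T by apply: joing_subr.
have N_ge1 : 0 < #|N| by apply: cardG_gt0.
split.
  split=> //; first by rewrite -divgS // oT oH.
  apply: (@meet_conj_index2 _ G _ K) => //.
  - apply: (@s4_gen T b a) => //; last by rewrite (subsetP (joing_subl _ _)) ?cycle_id.
      by rewrite (subsetP sKT).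
    by rewrite setUC.
  - exact: invol_sq.
  - by rewrite iT; case: #|N| N_ge1 => // n _; rewrite mulnS.
  - by have /normP <- := nK Ga; rewrite conjSg.
  by rewrite -divgS // oT oK.
suff -> : <<[set b; c]>> :&: <<[set b; c]>> :^ a = 1 by rewrite indexg1 oH.
have nab2 : (b * a) ^+ 2 \notin K.
  apply/negP => Kab2.
  have : (b * a) ^+ 2 \in <<[set a; b]>> :&: K.
    by rewrite inE groupX // groupM ?dih_l ?dih_r.
  rewrite tiDK inE => /eqP ab2; have := nk_cube nKG abK oN defC iC Ga Gb oa ob nKa nKb.
  have abV : a * b = (b * a)^-1 by rewrite invMg !invol_inv.
  rewrite expgS abV expgVn ab2 invg1 mulg1 -abV inE => /andP[_ /centP/(_ c Kc) cab].
  by case/eqP: c1; apply: fixK => //; apply/conjg_fixP/commgP/commute_sym.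
apply/eqP; rewrite -subG1; apply/subsetP => u; rewrite inE mem_conjg invol_inv // => /andP[Hu Hua].
have Ku k : k \in [set 1; c] -> k \in K by rewrite !inE => /orP[] /eqP ->.
have cases v : v \in <<[set b; c]>> -> exists2 k, k \in [set 1; c] & v = k \/ v = b * k.
  have nbc : b != c by apply: contraNneq nKb => ->.
  have obc : #[b * c] = 2.
    by apply/eqP; rewrite -(eqn_pmul2l (isT : 0 < 2)) -dih_card ?oH.
  have bb := invol_sq ob; move/(dih_cases ob oc); rewrite cycle2g // !inE.
  case/orP=> /orP[] /eqP.
  - by move=> ->; exists 1; rewrite ?set21 //; left.
  - by move=> ->; exists c; rewrite ?set22 //; right.
  - by move=> bv; exists 1; rewrite ?set21 //; right; rewrite -bv mulgA bb mul1g.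
  by move/mulgI ->; exists c; rewrite ?set22 //; left.
have [k ck [uk | uk]] := cases u Hu.
  move: ck; rewrite !inE uk => /orP[] // /eqP kc; have := cases _ Hua; rewrite uk kc.
  case=> k' ck' [ck2 | cbk].
    by move: ck'; rewrite -ck2 !inE (negbTE ca1) (negbTE cca).
  case/negP: nKb; have -> : b = c ^ a * k'^-1 by rewrite cbk mulgK.
  by rewrite groupM // groupV Ku.
have [k' ck' [uk' | uk']] := cases _ Hua.
  case/negP: nKb; have : u ^ a \in K by rewrite uk' Ku.
  by rewrite memJ_norm ?nK // uk (groupMr _ (Ku k ck)).
case/negP: nab2; have -> : (b * a) ^+ 2 = k' * (k ^ a)^-1.
  have ba : b ^ a = b * (k' * (k ^ a)^-1) by rewrite mulgA -uk' uk conjMg mulgK.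
  have -> : (b * a) ^+ 2 = b * b ^ a by rewrite expg2 conjgE invol_inv // !mulgA.
  by rewrite ba mulgA invol_sq // mul1g.
have Kka : k ^ a \in K by rewrite memJ_norm ?nK // Ku.
by rewrite groupM ?groupV // Ku.
Qed.

(** [G] permutes the four cosets of [<a, b>]; an element of the kernel lies in
    [<a, b>], which avoids [K], so it centralises [K] and lies in [N]. *)
Lemma s4_isog : (G / N) \isog [set: 'S_4].
Proof.
set D := <<[set a; b]>>%G.
have [phi [phiE' phi_surj]] := coset_labelling s4_index.
have phiE : {in G &, forall g k, (phi g == phi k) = (g * k^-1 \in D)}.
  by move=> g k Gg Gk; rewrite eq_sym phiE'.
have rep_ex i : exists g, (g \in G) && (phi g == i).
  by have [g Gg gi] := phi_surj i; exists g; rewrite Gg gi eqxx.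
pose rep i := xchoose (rep_ex i).
have repG i : rep i \in G by case/andP: (xchooseP (rep_ex i)).
have phi_rep i : phi (rep i) = i by apply/eqP; case/andP: (xchooseP (rep_ex i)).
have phiM u v g : u \in G -> v \in G -> g \in G -> phi u = phi v -> phi (u * g) = phi (v * g).
  move=> Gu Gv Gg /eqP; rewrite phiE // => uv; apply/eqP.
  have [Gug Gvg] : u * g \in G /\ v * g \in G by rewrite !groupM.
  by rewrite phiE // invMg mulgA mulgK.
have act g u : g \in G -> u \in G -> phi (rep (phi u) * g) = phi (u * g).
  by move=> Gg Gu; apply: phiM.
pose f g i := phi (rep i * g).
have f_inj g : g \in G -> injective (f g).
  move=> Gg i j; rewrite /f => ij.
  by rewrite -(phi_rep i) -(phi_rep j) -(mulgK g (rep i)) -(mulgK g (rep j));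
    apply: phiM; rewrite ?groupM ?groupV.
pose h g : 'S_4 := if insub g is Some u then perm (@f_inj (val (u : {v | v \in G})) (valP u)) else 1.
have hE g i : g \in G -> h g i = phi (rep i * g).
  by move=> Gg; rewrite /h insubT permE.
have hM : {in G &, {morph h : u v / u * v}}.
  move=> u v Gu Gv; apply/permP => i; rewrite permM !hE ?groupM //.
  by rewrite act ?groupM // mulgA.
pose hm := Morphism hM.
have ker_h : 'ker hm = N.
  apply/eqP; rewrite eqEsubset; apply/andP; split; apply/subsetP => g; last first.
    move=> Ng; have Gg := subsetP (normal_sub nNG) g Ng.
    apply/kerP => //; apply/permP => i; rewrite /= hE // perm1 -[RHS]phi_rep.
    have Grg : rep i * g \in G by rewrite groupM.
    apply/eqP; rewrite phiE // (subsetP sND) //.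
    have -> : rep i * g * (rep i)^-1 = g ^ (rep i)^-1 by rewrite conjgE invgK mulgA.
    by rewrite memJ_norm // groupV (subsetP (normal_norm nNG)).
  move=> kg; have Gg : g \in G := dom_ker kg.
  have inD u : u \in G -> u * g * u^-1 \in D.
    move=> Gu; have Gug : u * g \in G by rewrite groupM.
    rewrite -phiE // -act //; have := mker kg => /= h1.
    by rewrite -hE // h1 perm1.
  have Dg : g \in D by have := inD 1 (group1 G); rewrite mul1g invg1 mulg1.
  have Cg : g \in 'C_G(K).
    rewrite inE Gg; apply/centP => k Kk; apply/commute_sym/commgP/conjg_fixP.
    have : g^-1 * (k * g * k^-1) \in D :&: K.
      rewrite inE groupM ?groupV ?inD ?KG //=.
      have -> : g^-1 * (k * g * k^-1) = k ^ g * k^-1 by rewrite conjgE !mulgA.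
      by rewrite groupM ?groupV ?memJ_norm ?nK.
    rewrite tiDK inE => /eqP E.
    have -> : k ^ g = g^-1 * (k * g * k^-1) * k by rewrite conjgE !mulgA mulgKV.
    by rewrite E mul1g.
  have [_ defKN _ _] := dprodP defC; move: Cg; rewrite -defKN => /mulsgP[k v Kk Nv gE].
  have : k \in D :&: K by rewrite inE Kk andbT -(mulgK v k) -gE groupM ?groupV // (subsetP sND).
  by rewrite tiDK inE gE => /eqP ->; rewrite mul1g.
have := first_isog hm; rewrite ker_h => iso.
have <- : hm @* G = [set: 'S_4]; last exact: iso.
apply/eqP; rewrite eqEcard subsetT cardsT card_Sn -(card_isog iso) card_quotient ?normal_norm //.
by rewrite -divgS ?normal_sub // oG mulnK ?cardG_gt0.
Qed.

End S4Triple.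

(** * Invariants of maps and of coset maps *)

(** Used for the vertices, the edges and the faces as classes of flags. *)
Lemma bij_of_surj (W W' V V' : finType) (f : W -> W') (p : W -> V) (p' : W' -> V') :
    bijective f -> (forall v, exists w, p w == v) -> (forall v, exists w, p' w == v) ->
    (forall w u, p w = p u <-> p' (f w) = p' (f u)) ->
  exists phi : V -> V', bijective phi /\ forall w, phi (p w) = p' (f w).
Proof.
case=> f' fK f'K p_surj p'_surj pE.
pose phi v := p' (f (xchoose (p_surj v))).
have phiE w : phi (p w) = p' (f w) by apply/pE/eqP/(xchooseP (p_surj (p w))).
exists phi; split=> //; apply: inj_card_bij.
  move=> v u; have [[w /eqP <-] [w' /eqP <-]] := (p_surj v, p_surj u).
  by rewrite !phiE => /pE.
rewrite -!cardsT; apply: leq_trans (leq_imset_card phi [set: V]).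
apply/subset_leq_card/subsetP => v _; have [w /eqP <-] := p'_surj v.
by rewrite -(f'K w) -phiE imset_f.
Qed.

Section MapIso.

Variables (M M' : surface_map) (f : flag M -> flag M').
Hypothesis f_bij : bijective f.
Hypotheses (f0 : forall w, f (t0 w) = t0 (f w)) (f1 : forall w, f (t1 w) = t1 (f w)).
Hypothesis (f2 : forall w, f (t2 w) = t2 (f w)).

Lemma map_iso_step (ts : seq (flag M -> flag M)) (ts' : seq (flag M' -> flag M')) :
    size ts = size ts' ->
    (forall i w, f (nth id ts i w) = nth id ts' i (f w)) ->
  forall w u, connect (step ts) w u <-> connect (step ts') (f w) (f u).
Proof.
move=> sz_ts fts w u; have [f' fK f'K] := f_bij; split.
  apply: homo_connect => {w u} w u /(has_nthP id)[i lt_i /eqP <-].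
  by apply/(has_nthP id); exists i; rewrite -?sz_ts // fts.
move=> c; rewrite -(fK w) -(fK u); apply: homo_connect c => {w u} w u.
case/(has_nthP id)=> i lt_i /eqP <-; apply/(has_nthP id); exists i; rewrite ?sz_ts //.
by apply/eqP/(bij_inj f_bij); rewrite fts !f'K.
Qed.

Lemma map_iso_vertex :
  exists phi : vertex M -> vertex M', bijective phi /\ forall w, phi (fv w) = fv (f w).
Proof.
apply: (bij_of_surj f_bij (@fv_surj M) (@fv_surj M')) => w u; split.
  by move/fvP/(map_iso_step (ts' := [:: @t1 M'; @t2 M'])) => H; apply/fvP/H => // -[|[|[|i]]].
by move/fvP => c; apply/fvP/(map_iso_step (ts' := [:: @t1 M'; @t2 M'])) => // -[|[|[|i]]].
Qed.

Lemma map_iso_edge :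
  exists phi : edge M -> edge M', bijective phi /\ forall w, phi (fe w) = fe (f w).
Proof.
apply: (bij_of_surj f_bij (@fe_surj M) (@fe_surj M')) => w u; split.
  by move/feP/(map_iso_step (ts' := [:: @t0 M'; @t2 M'])) => H; apply/feP/H => // -[|[|[|i]]].
by move/feP => c; apply/feP/(map_iso_step (ts' := [:: @t0 M'; @t2 M'])) => // -[|[|[|i]]].
Qed.

Lemma map_iso_face :
  exists phi : face M -> face M', bijective phi /\ forall w, phi (ff w) = ff (f w).
Proof.
apply: (bij_of_surj f_bij (@ff_surj M) (@ff_surj M')) => w u; split.
  by move/ffP/(map_iso_step (ts' := [:: @t0 M'; @t1 M'])) => H; apply/ffP/H => // -[|[|[|i]]].
by move/ffP => c; apply/ffP/(map_iso_step (ts' := [:: @t0 M'; @t1 M'])) => // -[|[|[|i]]].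
Qed.

Lemma map_iso_orientable : orientable M <-> orientable M'.
Proof.
have [f' fK f'K] := f_bij; split=> -[c cM].
  exists (c \o f') => w /=; have [c0 c1 c2] := cM (f' w).
  have inj := bij_inj f_bij.
  have [e0 e1 e2] : [/\ f' (t0 w) = t0 (f' w), f' (t1 w) = t1 (f' w) & f' (t2 w) = t2 (f' w)].
    by split; apply: inj; rewrite ?f0 ?f1 ?f2 !f'K.
  by rewrite e0 e1 e2.
exists (c \o f) => w /=; have [c0 c1 c2] := cM (f w).
by rewrite f0 f1 f2.
Qed.

End MapIso.

Lemma map_iso_invariants (M M' : surface_map) : map_iso M M' ->
  [/\ mg_iso (underlying_graph M) (underlying_graph M'), euler_char M = euler_char M',
      orientable M <-> orientable M', #|edge M| = #|edge M'| & #|vertex M| = #|vertex M'|].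
Proof.
case=> f [f_bij f0 f1 f2].
have [v [v_bij vE]] := map_iso_vertex f_bij f1 f2.
have [e [e_bij eE]] := map_iso_edge f_bij f0 f2.
have [F [F_bij FE]] := map_iso_face f_bij f0 f1.
have [[cV cE] cF] := (bij_eq_card v_bij, bij_eq_card e_bij, bij_eq_card F_bij).
have gI : mg_iso (underlying_graph M) (underlying_graph M').
  exists v, e; split=> // d; have [d0 /eqP <-] := fe_surj d.
  have [f' fK f'K] := f_bij; apply/setP => u; rewrite inE.
  apply/existsP/imsetP => [[w /andP[/eqP <- /eqP ew]] | [u' + ->]].
    exists (fv (f' w)); last by rewrite vE f'K.
    rewrite inE; apply/existsP; exists (f' w); rewrite eqxx /=.
    by rewrite -(inj_eq (bij_inj e_bij)) eE f'K ew.
  rewrite inE => /existsP[w /andP[/eqP <- /eqP ew]].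
  by exists (f w); rewrite vE -eE ew !eqxx.
by split=> //; [rewrite /euler_char cV cE cF | apply: map_iso_orientable f_bij f0 f1 f2].
Qed.

Section CosetMapInvariants.

Variables (gT : finGroupType) (G : {group gT}) (t : arc_regular_triple G).

Local Notation x := (tx t).
Local Notation y := (ty t).
Local Notation z := (tz t).

Lemma card_rcoset_type (A : {group gT}) : #|rcoset_type G A| = #|G : A|.
Proof. by rewrite card_sig. Qed.

Lemma card_half : #|G : <<[set z]>>| = #|G|./2.
Proof.
rewrite -divgS ?gen_subG ?sub_z // -/(<[z]>) -[#|<[z]>|]/#[z] tz_inv.
by rewrite divn2.
Qed.

Lemma euler_RevMap :
  euler_char (RevMap t) =
    ((#|G : <<[set x; y]>>| + #|G : <<[set x; z]>>| + #|G : <<[set y; z]>>|)%:Z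
      - (#|G|./2)%:Z)%R.
Proof.
rewrite /euler_char /= card_sum !card_rcoset_type card_half !PoszD addrAC.
by rewrite !addrA.
Qed.

Lemma euler_BiRevMap :
  euler_char (BiRevMap t) =
    ((#|G : <<[set x; y]>>| + #|G : <<[set x; (y ^ z)%g]>>|)%:Z - (#|G|./2)%:Z)%R.
Proof. by rewrite /euler_char /= !card_rcoset_type card_half !PoszD addrAC. Qed.

Lemma coprime_of_gcdz (m e : nat) : gcdz (m%:Z - e%:Z)%R e%:Z = 1%R -> coprime m e.
Proof.
rewrite gcdzC addrC -mulN1r gcdzMDl gcdzC => /eqP.
by rewrite /gcdz /coprime eqz_nat.
Qed.

(** A coherent colouring of the flags is, up to a constant, a homomorphism to
    the group of order 2 at the flags of one side of the arcs. *)
Lemma colour_parity (c : subg_of G * bool -> bool) (ez : bool) :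
    (forall g, c (cm_lmul x g, true) = ~~ c (g, true)) ->
    (forall g, c (cm_lmul y g, true) = ~~ c (g, true)) ->
    (forall g, c (cm_lmul z g, true) = ez (+) c (g, true)) ->
  exists e : gT -> bool, [/\ {in G &, forall a b, e (a * b) = e a (+) e b},
    e x = true, e y = true & e z = ez].
Proof.
move=> cx cy cz; pose e a := c (subg G a, true) (+) c (1, true).
have sub1 a : a \in G -> cm_lmul a (1 : subg_of G) = subg G a.
  by move=> Ga; rewrite /cm_lmul mulg1.
have base a b : a \in G -> (forall g, c (cm_lmul a g, true) = b (+) c (g, true)) -> e a = b.
  by move=> Ga ca; rewrite /e -sub1 // ca addbK.
have eP a : a \in G -> forall g, c (cm_lmul a g, true) = e a (+) c (g, true).
  have /subsetP sG : G \subset [set a in G | [exists b : bool, [forall g : subg_of G,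
      c (cm_lmul a g, true) == b (+) c (g, true)]]].
    rewrite {1}(t_gen t); apply: gen_lmul_sub => [|u d].
      rewrite inE group1; apply/existsP; exists false; apply/forallP => g.
      by rewrite cm_lmul1.
    move=> Xu; rewrite !inE => /andP[Gd /existsP[b /forallP cd]].
    have Gu : u \in G by rewrite (t_gen t) mem_gen.
    rewrite groupM //=; have [b' cb'] : exists b', forall g, c (cm_lmul u g, true) = b' (+) c (g, true).
      by move: Xu; rewrite !inE -orbA => /or3P[] /eqP ->; [exists true | exists true | exists ez].
    apply/existsP; exists (b' (+) b); apply/forallP => g.
    by rewrite cm_lmulM // cb' (eqP (cd g)) addbA.
  move=> Ga; have := sG a Ga; rewrite inE Ga => /existsP[b /forallP cb] g.
  by rewrite (eqP (cb g)) (base a b) // => k; apply/eqP.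
have [[Gx Gy] Gz] := (cm_xG t, cm_yG t, cm_zG t).
exists e; split.
- move=> a b Ga Gb; apply: base; first by rewrite groupM.
  by move=> g; rewrite cm_lmulM // !eP // addbA.
- by apply: base => // g; rewrite cx.
- by apply: base => // g; rewrite cy.
exact: base.
Qed.

Lemma RevMap_parity : orientable (RevMap t) ->
  exists e : gT -> bool, [/\ {in G &, forall a b, e (a * b) = e a (+) e b},
    e x = true, e y = true & e z = true].
Proof.
case=> c cM; apply: (@colour_parity c true) => g.
- by have [_ -> _] := cM (g, true).
- have c2 : c (cm_lmul y g, false) = ~~ c (cm_lmul y g, true).
    by have [_ _ E] := cM (cm_lmul y g, true); exact: E.
  have c1 : c (cm_lmul y g, false) = ~~ c (g, false).
    by have [_ E _] := cM (g, false); exact: E.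
  have c2' : c (g, false) = ~~ c (g, true) by have [_ _ E] := cM (g, true); exact: E.
  by apply: negb_inj; rewrite -c2 c1 c2'.
by have [-> _ _] := cM (g, true).
Qed.

Lemma BiRevMap_parity : orientable (BiRevMap t) ->
  exists e : gT -> bool, [/\ {in G &, forall a b, e (a * b) = e a (+) e b},
    e x = true, e y = true & e z = false].
Proof.
case=> c cM; apply: (@colour_parity c false) => g.
- by have [_ -> _] := cM (g, true).
- have c2 : c (cm_lmul y g, false) = ~~ c (cm_lmul y g, true).
    by have [_ _ E] := cM (cm_lmul y g, true); exact: E.
  have c1 : c (cm_lmul y g, false) = ~~ c (g, false).
    by have [_ E _] := cM (g, false); exact: E.
  have c2' : c (g, false) = ~~ c (g, true) by have [_ _ E] := cM (g, true); exact: E.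
  by apply: negb_inj; rewrite -c2 c1 c2'.
have c2 : c (cm_lmul z g, false) = ~~ c (cm_lmul z g, true).
  by have [_ _ E] := cM (cm_lmul z g, true); exact: E.
have c0 : c (cm_lmul z g, false) = ~~ c (g, true).
  by have [E _ _] := cM (g, true); exact: E.
by apply: negb_inj; rewrite -c2 c0.
Qed.

(** The product of the two colourings of the flags of [RevMap], by the coset of [N] and
    by the side of the arc, is coherent. *)
Lemma RevMap_orientable (N : {group gT}) :
    N \subset G -> #|G : N| = 2 -> x \notin N -> y \notin N -> z \notin N ->
  orientable (RevMap t).
Proof.
move=> sNG iN nNx nNy nNz.
have flip u g : u \in G -> u \notin N -> g \in G -> (u * g \in N) = (g \notin N).
  move=> Gu nNu Gg; have [Ng | nNg] := boolP (g \in N).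
    by rewrite groupMr // (negbTE nNu).
  rewrite -[g]invgK -mem_rcoset (rcoset_index2 sNG iN) inE ?nNu ?Gu //.
  by rewrite groupV nNg groupV.
exists (fun w : cm_flag G => (sgval w.1 \in N) (+) w.2) => -[g s].
have [[Gx Gy] Gz] := (cm_xG t, cm_yG t, cm_zG t).
have lm u (k : subg_of G) : u \in G -> u \notin N -> (sgval (cm_lmul u k) \in N) = (sgval k \notin N).
  by move=> Gu nNu; rewrite cm_lmulE //; apply: flip => //; apply: subgP.
split.
- by apply: (etrans (congr1 (addb^~ s) (lm z g Gz nNz))); rewrite addNb.
- case: s.
    by apply: (etrans (congr1 (addb^~ true) (lm x g Gx nNx))); rewrite addNb.
  by apply: (etrans (congr1 (addb^~ false) (lm y g Gy nNy))); rewrite addNb.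
exact: addbN.
Qed.

End CosetMapInvariants.

(** * Parity and dihedral products *)

Lemma is_dihedral_gen (gT : finGroupType) (G : {group gT}) (u v : gT) :
    #[u] = 2 -> #[v] = 2 -> u != v -> G = <<[set u; v]>> :> {set gT} ->
  is_dihedral G #[u * v].
Proof.
move=> ou ov nuv defG; have oD := dih_card ou ov nuv.
rewrite /is_dihedral; case: eqP => [o1 | _].
  by case/eqP: nuv; apply: (mulIg v); rewrite invol_sq //; apply/eqP; rewrite -order_eq1 o1.
rewrite order_gt0 /= -oD defG; exact: involutions_gen_dihedral.
Qed.

Lemma parity_odd_order (gT : finGroupType) (G : {group gT}) (e : gT -> bool) (u : gT) :
  {in G &, forall a b, e (a * b) = e a (+) e b} -> u \in G -> odd #[u] -> e u = false.
Proof.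
move=> eM Gu ou; have e1 : e 1 = false.
  by have := eM 1 1 (group1 G) (group1 G); rewrite mulg1; case: (e 1).
have eX i : e (u ^+ i) = odd i && e u.
  elim: i => [|i IHi]; first by rewrite expg0 e1.
  by rewrite expgS eM ?groupX // IHi /=; case: (odd i); case: (e u).
by have := eX #[u]; rewrite expg_order ou e1.
Qed.

Lemma parity_conj (gT : finGroupType) (G : {group gT}) (e : gT -> bool) (u v : gT) :
  {in G &, forall a b, e (a * b) = e a (+) e b} -> u \in G -> v \in G -> e (u ^ v) = e u.
Proof.
move=> eM Gu Gv; have := eM v (u ^ v) Gv (groupJ Gu Gv).
by rewrite -conjgC eM // addbC => /addbI.
Qed.

(** The two dihedral factors are [<<[set u; u * a]>>] and [<<[set v; v * b]>>]. They
    commute, hence meet in the centre of both, which is trivial. *)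
Lemma dih_product_isog (gT : finGroupType) (G : {group gT}) (u v a b : gT) :
    u \in G -> v \in G -> a \in G -> b \in G -> #[u] = 2 -> #[v] = 2 ->
    a ^ u = a^-1 -> b ^ v = b^-1 -> commute u v -> commute u b -> commute v a -> commute a b ->
    odd #[a] -> odd #[b] -> 1 < #[a] -> 1 < #[b] -> #|G| = (4 * #[a] * #[b])%N ->
  G \isog [set: ('D_(2 * #[a])%N * 'D_(2 * #[b])%N)%type].
Proof.
move=> Gu Gv Ga Gb ou ov au bv cuv cub cva cab odd_a odd_b a_gt1 b_gt1 oG.
have mk (w d : gT) : #[w] = 2 -> d ^ w = d^-1 -> odd #[d] -> 1 < #[d] ->
    [/\ #[w * d] = 2, w * (w * d) = d, w != w * d &
        #|<<[set w; w * d]>>| = (2 * #[d])%N].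
  move=> ow dw od d_gt1; have ww := invol_sq ow.
  have wwd : w * (w * d) = d by rewrite mulgA ww mul1g.
  have nwd : w != w * d.
    by apply: contraTneq d_gt1 => E; rewrite -wwd -E ww order1.
  have owd : #[w * d] = 2.
    have : #[w * d] %| 2.
      rewrite order_dvdn expg2; apply/eqP.
      have -> : w * d * (w * d) = d ^ w * d by rewrite conjgE invol_inv // !mulgA.
      by rewrite dw mulVg.
    rewrite (dvdn_divisors _ (isT : 0 < 2)) !inE order_eq1 => /orP[/eqP wd1|/eqP //].
    have dV : d = w by apply: (mulgI w); rewrite wd1 ww.
    by move: od; rewrite dV ow.
  by split=> //; rewrite dih_card // wwd.
have [oua uua nua oP] := mk u a ou au odd_a a_gt1.
have [ovb vvb nvb oR] := mk v b ov bv odd_b b_gt1.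
pose P := <<[set u; (u * a)%g]>>%G; pose R := <<[set v; (v * b)%g]>>%G.
have cPR : R \subset 'C(P).
  rewrite /= cent_gen gen_subG; apply/subsetP => w Rw; apply/centP => d Pd.
  have cvu := commute_sym cuv; have cbu := commute_sym cub.
  have cav := commute_sym cva; have cba := commute_sym cab.
  move: Rw Pd; rewrite !inE => /orP[] /eqP -> /orP[] /eqP -> //.
  - exact: commuteM.
  - by apply/commute_sym; apply: commuteM.
  by apply: commuteM; apply/commute_sym; apply: commuteM.
have tiPR : P :&: R = 1.
  apply/eqP; rewrite -subG1; apply/subsetP => p /setIP[Pp Rp]; rewrite inE.
  have cP d : d \in P -> commute p d.
    by move=> Pd; have /centP/(_ d Pd) := subsetP cPR p Rp.
  have Pa : a \in P by rewrite -{1}uua; apply: groupM; [exact: dih_l | exact: dih_r].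
  have Pu : u \in P by apply: dih_l.
  have := dih_cases ou oua Pp; rewrite uua => /orP[ap | aup].
    apply/eqP/(@odd_self_inv _ <[a]>) => //.
    have /cycleP[i pi] := ap; have pu : p ^ u = p by apply/conjg_fixP/commgP/cP.
    by rewrite -[RHS]pu pi conjXg au expgVn.
  have cau : commute a u.
    have c1 : commute a (u * p) by apply: (centsP (cycle_abelian a)); rewrite ?cycle_id.
    have := commuteM c1 (commuteV (commute_sym (cP a Pa))); by rewrite mulgK.
  have aV : a^-1 = a by rewrite -au; apply/conjg_fixP/commgP.
  by move: a_gt1; rewrite (@odd_self_inv _ <[a]> a) ?cycle_id // order1.
have sPG : P \subset G by rewrite gen_subG subUset !sub1set Gu groupM.
have sRG : R \subset G by rewrite gen_subG subUset !sub1set Gv groupM.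
have defG : P \x R = G.
  rewrite dprodE //; apply/eqP; rewrite eqEcard mul_subG //= (TI_cardMg tiPR).
  by rewrite oP oR oG -[4]/(2 * 2)%N !mulnA (mulnAC 2 2).
have defT : setX [set: 'D_(2 * #[a])] 1 \x setX 1 [set: 'D_(2 * #[b])]
    = [set: ('D_(2 * #[a])%N * 'D_(2 * #[b])%N)%type].
  by rewrite setX_dprod; apply/setP => w; rewrite !inE.
apply: (isog_dprod defG defT).
  by apply: isog_trans (isog_setX1 _ _); rewrite -oP; apply: involutions_gen_dihedral.
by apply: isog_trans (isog_set1X _ _); rewrite -oR; apply: involutions_gen_dihedral.
Qed.

Lemma coprime_prime (m n p : nat) : coprime m n -> prime p -> p %| n -> ~~ (p %| m).
Proof.
move=> co pr_p pn; apply: contraL co => pm; apply/negP => /eqP g1.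
by have := dvdn_gcd p m n; rewrite g1 pm pn dvdn1; case: eqP pr_p => // ->.
Qed.

(** The elements [v] and [v ^ w] are congruent modulo the Frattini subgroup. *)
Lemma conj_gen_2group (gT : finGroupType) (p : nat) (Q : {group gT}) (u v w : gT) :
  p.-group Q -> w \in Q -> <<[set u; v]>> = Q -> <<[set u; v ^ w]>> = Q.
Proof.
move=> pQ Qw genQ; apply: Phi_nongen; apply/eqP; rewrite eqEsubset.
have [Qu Qv] : u \in Q /\ v \in Q by rewrite -genQ dih_l dih_r.
rewrite join_subG Phi_sub subUset !sub1set groupJ ?Qu //=.
suff: <<[set u; v]>> \subset 'Phi(Q) <*> [set u; v ^ w] by rewrite genQ.
rewrite gen_subG subUset !sub1set.
have sub d : d \in [set u; v ^ w] -> d \in 'Phi(Q) <*> [set u; v ^ w].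
  by move=> Xd; rewrite mem_gen // inE Xd orbT.
rewrite sub ?set21 //=.
have vE : v = v ^ w * [~ v, w]^-1 by rewrite commgEl invMg invgK mulgA mulgV mul1g.
rewrite [X in X \in _]vE; apply: groupM; first by apply: sub; rewrite set22.
rewrite groupV mem_gen // inE.
by rewrite (Phi_joing pQ) (subsetP (joing_subl _ _)) // mem_commg.
Qed.

(** The alternatives depend on the graph only up to isomorphism, which allows the
    underlying graph of a map to be replaced by a coset graph. *)
Definition reversing_type (gT : finGroupType) (G : {group gT}) (Gamma : multigraph)
    (chi : int) (orient : Prop) : Prop :=
((exists n : nat,
        [/\ is_dihedral G n, ~~ odd n,
            mg_iso Gamma (multiple (cycle_graph n./2) 2),
            chi = 1%R &
            ~ orient]) \/
     (exists (n : nat) (j k : int) (d : nat),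
        [/\ is_dihedral G n /\ (gcdz (gcdz j k) n%:Z = 1)%R,
            (gcdz j n%:Z = d%:Z)%R /\ (3 <= d)%N,
            mg_iso Gamma (multiple (cycle_graph d) (n %/ d)),
            chi =
              (gcdz j n%:Z + gcdz k n%:Z + gcdz (j - k) n%:Z - n%:Z)%R &
            orient]) \/
     (exists m n : nat,
        [/\ [/\ (1 < m)%N, (1 < n)%N, odd m, odd n & coprime m n],
            G \isog [set: ('D_(2 * m)%N * 'D_(2 * n)%N)%type],
            mg_iso Gamma (multiple (cycle_graph m) (2 * n)%N) \/
            mg_iso Gamma
              (multiple (sg_direct (cycle_graph m) (cycle_graph n)) 1),
            chi = (m%:Z + n%:Z - (m * n)%N%:Z)%R &
            ~ orient]) \/
     (exists m n l : nat,
        [/\ [/\ (1 < m)%N, (1 < n)%N & (1 < l)%N] /\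
              [/\ odd m, odd n & odd l] /\
              [/\ coprime m n, coprime m l & coprime n l],
            exists A B : {group gT},
              [/\ A ><| B = G, A \isog Zp (m * n * l)%N &
                  B \isog [set: ('Z_2 * 'Z_2)%type]],
            mg_iso Gamma
              (multiple (sg_direct (cycle_graph m) (cycle_graph n)) l),
            chi = ((m * n)%N%:Z + (m * l)%N%:Z + (n * l)%N%:Z
                              - (2 * m * n * l)%N%:Z)%R &
            ~ orient]) \/
     (exists f s : nat,
        [/\ (1 <= s)%N /\ coprime 6 s,
            exists A : {group gT},
              [/\ A <| G, A \isog Zp (3 ^ f * s)%N &
                  (G / A) \isog [set: 'S_4]],
            [\/ mg_iso Gamma
                  (multiple (complete_graph 4) (2 * 3 ^ f * s)%N),
                mg_iso Gamma
                  (multiple (sg_lex (cycle_graph (3 ^ f.+1 * s)%N)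
                                         (edgeless_graph 2)) 1)
              | mg_iso Gamma
                  (multiple (cycle_graph (3 ^ f.+1 * s)%N) 4)],
            chi = (4 - (3 ^ f.+1 * s)%N%:Z)%R &
            ~ orient])).

Lemma reversing_type_iso (gT : finGroupType) (G : {group gT}) (Gamma Gamma' : multigraph)
    (chi : int) (o o' : Prop) :
    mg_iso Gamma' Gamma -> (o' <-> o) ->
  reversing_type G Gamma chi o -> reversing_type G Gamma' chi o'.
Proof.
move=> iG oE; have tr Delta : mg_iso Gamma Delta -> mg_iso Gamma' Delta := mg_iso_trans iG.
have no : ~ o -> ~ o' by move=> n1 /oE.
case=> [[n [? ? /tr ? ? /no ?]] | [[n [j [k [d [? ? /tr ? ? /oE ?]]]]] |
       [[m [n [? ? H ? /no ?]]] | [[m [n [l [? ? /tr ? ? /no ?]]]] | [f [s [? ? H ? /no ?]]]]]]].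
- by left; exists n.
- by right; left; exists n, j, k, d.
- right; right; left; exists m, n; split=> //.
  by case: H => /tr ?; [left | right].
- by right; right; right; left; exists m, n, l.
right; right; right; right; exists f, s; split=> //.
by case: H => /tr ?; [constructor 1 | constructor 2 | constructor 3].
Qed.

(** The expression [bc + ac + ab - 2abc], with [a], [b], [c] the orders of the three
    coprime factors of [N]. *)
Definition klein_euler (a b c : nat) : int :=
  ((b * c)%N%:Z + (a * c)%N%:Z + (a * b)%N%:Z - (2 * (a * b * c))%N%:Z)%R.

Lemma klein_eulerE (a b c : nat) (e : int) : e = klein_euler a b c ->
  [/\ a = 1%N -> e = (b%:Z + c%:Z - (b * c)%N%:Z)%R,
      b = 1%N -> e = (c%:Z + a%:Z - (c * a)%N%:Z)%R,
      c = 1%N -> e = (b%:Z + a%:Z - (b * a)%N%:Z)%R &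
      e = ((b * c)%N%:Z + (b * a)%N%:Z + (c * a)%N%:Z - (2 * b * c * a)%N%:Z)%R].
Proof. by rewrite /klein_euler => ->; split; lia. Qed.

(** * Maps of solvable groups *)

Section ReversingMaps.

Variables (gT : finGroupType) (G : {group gT}) (t : arc_regular_triple G).

Local Notation x := (tx t).
Local Notation y := (ty t).
Local Notation z := (tz t).
Local Notation H := <<[set x; y]>>%G.
Local Notation Gamma := (coset_graph t).
Local Notation ixy := #|G : <<[set x; y]>>|.
Local Notation ixz := #|G : <<[set x; z]>>|.
Local Notation iyz := #|G : <<[set y; z]>>|.
Local Notation chi := ((ixy + ixz + iyz)%:Z - (#|G|./2)%:Z)%R.

Let Gx := cm_xG t.
Let Gy := cm_yG t.
Let Gz := cm_zG t.
Let ox := tx_inv t.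
Let oy := ty_inv t.
Let oz := tz_inv t.
Let zz := tz_sq t.
Let genG := t_gen t.
Let i3 : 2 < ixy := t_index t.

Lemma index_pair a b : a \in G -> b \in G ->
  (#|<<[set a; b]>>| * #|G : <<[set a; b]>>|)%N = #|G|.
Proof. by move=> Ga Gb; rewrite Lagrange // gen_subG subUset !sub1set Ga. Qed.

(** The central involution [c] fixes each vertex, so the two neighbours of a vertex
    are joined to it by two edges each. *)
Lemma rev_central (u c : gT) :
    (u = x /\ c = y) \/ (u = y /\ c = x) ->
    commute c u -> commute c z -> <<[set u; z]>> = G -> 4 %| #|G| ->
  exists n : nat,
    [/\ is_dihedral G n, ~~ odd n, mg_iso Gamma (multiple (cycle_graph n./2) 2),
        chi = 1%R & ~ orientable (RevMap t)].
Proof.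
move=> uc_xy cu cz genuz G4.
have [ou oc Gu Gc] : [/\ #[u] = 2, #[c] = 2, u \in G & c \in G].
  by case: uc_xy => -[-> ->].
have defH : <<[set x; y]>> = <<[set u; c]>> by case: uc_xy => -[-> ->] //; rewrite setUC.
have nzH : z \notin <<[set u; c]>> by rewrite -defH cm_z_notin.
have nuz : u != z by apply: contraNneq nzH => <-; rewrite dih_l.
have ncz : c != z by apply: contraNneq nzH => <-; rewrite dih_r.
pose n := #[u * z]; have oG : #|G| = (2 * n)%N by rewrite -genuz dih_card.
have even_n : ~~ odd n by move: G4; rewrite oG -[4]/(2 * 2)%N dvdn_pmul2l // dvdn2.
have iH : #|G : <<[set u; c]>>| = ixy by rewrite defH.
have n2 : n != 2.
  apply: contraTneq i3 => n2; rewrite -leqNgt -iH -(leq_pmul2l (isT : 0 < 2)).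
  have oG4 : #|G| = 4 by rewrite oG n2.
  rewrite -[(2 * 2)%N]/4 -oG4 -(index_pair Gu Gc) leq_mul2r; apply/orP; right.
  have : #[u] <= #|<<[set u; c]>>| by apply: subset_leq_card; rewrite cycle_subG dih_l.
  by rewrite ou.
have nuc : u != c.
  apply: contraNneq n2 => uc; have cuz : commute u z by rewrite uc.
  have : #[u * z] %| 2 by rewrite order_dvdn (expgMn _ cuz) !expg2 (invol_sq ou) zz mulg1.
  rewrite (dvdn_divisors _ (isT : 0 < 2)) !inE order_eq1 => /orP[/eqP uz1|//].
  by case/eqP: nuz; apply: (mulIg z); rewrite uz1 zz.
have order2 v : #[v] = 2 -> v != c -> commute c v -> #|<<[set v; c]>>| = 4.
  move=> ov nvc cv; rewrite dih_card // (_ : #[v * c] = 2) //.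
  have : #[v * c] %| 2 by rewrite order_dvdn (expgMn _ (commute_sym cv)) !expg2 (invol_sq ov) (invol_sq oc) mulg1.
  rewrite (dvdn_divisors _ (isT : 0 < 2)) !inE order_eq1 => /orP[/eqP vc1|/eqP //].
  by case/eqP: nvc; apply: (mulIg c); rewrite vc1 invol_sq.
have half v : v \in G -> #[v] = 2 -> v != c -> commute c v -> #|G : <<[set v; c]>>| = n./2.
  move=> Gv ov nvc cv; apply/eqP; rewrite -(eqn_pmul2l (isT : 0 < 4)).
  rewrite -{1}(order2 v ov nvc cv) index_pair // oG -[4]/(2 * 2)%N -mulnA eqn_pmul2l //.
  by rewrite mul2n even_halfK.
have iuc := half u Gu ou nuc cu; have izc := half z Gz oz _ cz.
rewrite eq_sym ncz in izc; have {}izc := izc isT.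
exists n; split=> //.
- exact: is_dihedral_gen.
- have e1 : ixy = n./2 by rewrite -iH.
  have e2 : #|<<[set x; y]>>| %/ 2 = 2 by rewrite defH order2.
  suff /coset_graph_cycle : #|<<[set x; y]>> : <<[set x; y]>> :&: <<[set x; y]>> :^ z| = 2.
    by rewrite /= e1 e2.
  rewrite defH; apply: (@meet_conj_index2 _ G <<[set u; c]>> <[c]>) => //.
  + by rewrite /= -defH tH_sub.
  + by rewrite /= -defH; apply: tG_gen.
  + by rewrite /= iH.
  + by rewrite cycle_subG dih_r.
  + rewrite /= cycle_subG mem_conjg (conjg_fixP _) ?dih_r //.
    by apply/commgP; rewrite tz_V.
  by rewrite -divgS ?cycle_subG ?dih_r // order2 // -[#|<[c]>|]/#[c] oc.
- have -> : (ixy + ixz + iyz = n.+1)%N.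
    have iuz : #|G : <<[set u; z]>>| = 1%N by rewrite genuz indexgg.
    have icz : #|G : <<[set c; z]>>| = n./2 by rewrite setUC.
    have nn : n = (n./2 + n./2)%N by rewrite addnn even_halfK.
    case: uc_xy => -[xu yc]; rewrite -xu -yc ?iuc ?iuz ?icz.
      by rewrite addnAC -nn addn1.
    by rewrite setUC iuc -nn addn1.
  by rewrite oG mul2n doubleK -addn1 PoszD addrC addKr.
case/RevMap_parity => e [eM ex ey ez].
have [eu ec] : e u = true /\ e c = true by case: uc_xy => -[-> ->].
have : c \in <<[set u; z]>> by rewrite genuz.
move/(dih_cases ou oz); have even_rot v : v \in <[u * z]> -> e v = false.
  move=> /cycleP[i ->]; elim: i => [|i IHi].
    by have := eM 1 1 (group1 G) (group1 G); rewrite mulg1; case: (e 1).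
  by rewrite expgS eM ?groupX ?groupM // IHi eM // eu ez.
case/orP => [/even_rot | ruc]; first by rewrite ec.
case/eqP: n2.
have [uc_u _] := dih_inv_rot ou oz ruc; have [r_u _] := dih_inv_rot ou oz (cycle_id (u * z)).
have cr : commute (u * z) (u * c) by apply: (centsP (cycle_abelian (u * z))); rewrite ?cycle_id.
have crc : commute (u * z) c by apply: commute_sym; apply: commuteM.
have cru : commute (u * z) u.
  by have := commuteM cr crc; rewrite -mulgA (invol_sq oc) mulg1.
have rr : (u * z) ^+ 2 = 1.
  by rewrite expg2 -{1}(conjg_fixP (introT commgP cru)) r_u mulVg.
have : #[u * z] %| 2 by rewrite order_dvdn rr.
rewrite (dvdn_divisors _ (isT : 0 < 2)) !inE order_eq1 => /orP[/eqP uz1|/eqP //].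
by case/eqP: nuz; apply: (mulIg z); rewrite uz1 zz.
Qed.

Section Coordinates.

Variables (a : gT) (j k : nat).
Hypotheses (Ga : a \in G) (oG : #|G| = (2 * #[a])%N) (oa : odd #[a]) (ax : a ^ x = a^-1).
Hypotheses (nax : x \notin <[a]>) (yE : y = x * a ^+ j) (zE : z = x * a ^+ k).
Hypothesis (jk1 : gcdn (gcdn j k) #[a] = 1%N).

Lemma coord_inv u i : u = x * a ^+ i -> a ^ u = a^-1.
Proof.
move=> ->; rewrite conjgM ax; apply/conjg_fixP/commgP.
by apply: commuteX; apply: commute_sym; apply: commuteV.
Qed.

Lemma coord_index u v m : u \in G -> v \in G -> #[u] = 2 -> #[v] = 2 ->
  u * v = a ^+ m \/ v * u = a ^+ m -> #|G : <<[set u; v]>>| = gcdn m #[a].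
Proof.
move=> Gu Gv ou ov uvm.
have ouv : #[u * v] = #[a ^+ m].
  case: uvm => <- //; by rewrite -orderV invMg !invol_inv.
have ordX : (#[a ^+ m] * gcdn m #[a] = #[a])%N.
  by rewrite orderXgcd (gcdnC m) divnK // dvdn_gcdl.
apply/eqP; rewrite -(eqn_pmul2l (cardG_gt0 <<[set u; v]>>)) index_pair // oG.
have [uv | nuv] := eqVneq u v.
  have am1 : #[a ^+ m] = 1%N by rewrite -ouv uv invol_sq // order1.
  have -> : gcdn m #[a] = #[a] by rewrite -[RHS]ordX am1 mul1n.
  by rewrite uv setUid [#|_|]ov.
by rewrite dih_card // ouv -mulnA ordX.
Qed.

Lemma coord_vertex : ixy = gcdn j #[a].
Proof. by apply: coord_index => //; left; rewrite yE mulgA invol_sq // mul1g. Qed.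

Lemma coord_dihedral : is_dihedral G #[a].
Proof.
have oxa : #[x * a] = 2.
  have : #[x * a] %| 2.
    rewrite order_dvdn expg2; apply/eqP.
    have -> : x * a * (x * a) = a ^ x * a by rewrite conjgE invol_inv // !mulgA.
    by rewrite ax mulVg.
  rewrite (dvdn_divisors _ (isT : 0 < 2)) !inE order_eq1 => /orP[/eqP xa1|/eqP //].
  case/negP: nax; have -> : x = a^-1 by apply: (mulIg a); rewrite xa1 mulVg.
  by rewrite groupV cycle_id.
have xxa : x * (x * a) = a by rewrite mulgA invol_sq // mul1g.
have nxa : x != x * a.
  apply: contraTneq i3 => xa; rewrite -leqNgt.
  have a1 : a = 1 by rewrite -xxa -xa invol_sq.
  by rewrite coord_vertex a1 order1 gcdn1.
rewrite -{1}xxa; apply: is_dihedral_gen => //; apply/esym/eqP.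
rewrite eqEcard gen_subG subUset !sub1set Gx groupM //=.
by rewrite dih_card // xxa oG.
Qed.

Lemma coord_graph : mg_iso Gamma (multiple (cycle_graph ixy) (#[a] %/ ixy)).
Proof.
have <- : #|<<[set x; y]>>| %/ 2 = (#[a] %/ ixy)%N.
  have : 2 %| #|<<[set x; y]>>| by rewrite -{1}ox order_dvdG ?dih_l.
  case/dvdnP=> h oH; have := index_pair Gx Gy; rewrite oH oG mulnAC mulnC.
  by move/eqP; rewrite eqn_pmul2l // => /eqP <-; rewrite mulnK // mulnK // indexg_gt0.
apply: coset_graph_cycle; apply: (@meet_conj_index2 _ G H <[x * y]>) => //.
- exact: tH_sub.
- exact: tG_gen.
- exact: dih_rot.
- have xy : x * y = a ^+ j by rewrite yE mulgA invol_sq // mul1g.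
  rewrite cycle_subG mem_conjg tz_V xy conjXg (coord_inv zE) expgVn groupV -xy.
  by rewrite groupM ?dih_l ?dih_r.
exact: dih_index.
Qed.

Lemma coord_diff u v i l m : u * v = a ^- i * a ^+ l -> u \in G -> v \in G ->
  #[u] = 2 -> #[v] = 2 -> m = `|(i%:Z - l%:Z)%R|%N -> #|G : <<[set u; v]>>| = gcdn m #[a].
Proof.
move=> uv Gu Gv ou ov ->; apply: coord_index => //.
case: (leqP i l) => [le_il | lt_li].
  left; rewrite distnC distnEl // uv -{1}(subnKC le_il) expgD mulKg //.
right; rewrite distnEl ?(ltnW lt_li) //.
have -> : v * u = (u * v)^-1 by rewrite invMg !invol_inv.
by rewrite uv invMg invgK -{1}(subnKC (ltnW lt_li)) expgD mulKg.
Qed.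

Let half_oG : #|G|./2 = #[a]. Proof. by rewrite oG mul2n doubleK. Qed.

(** A dihedral subgroup generated by two reflections has as index the greatest common
    divisor of [#[a]] and the exponent of their product. *)
Lemma rev_coord :
  exists (n : nat) (j k : int) (d : nat),
    [/\ is_dihedral G n /\ (gcdz (gcdz j k) n%:Z = 1)%R,
        (gcdz j n%:Z = d%:Z)%R /\ (3 <= d)%N,
        mg_iso Gamma (multiple (cycle_graph d) (n %/ d)),
        chi = (gcdz j n%:Z + gcdz k n%:Z + gcdz (j - k) n%:Z - n%:Z)%R &
        orientable (RevMap t)].
Proof.
have xx := invol_sq ox.
have ixzE : ixz = gcdn k #[a] by apply: coord_index => //; left; rewrite zE mulgA xx mul1g.
have iyzE : iyz = gcdn `|(j%:Z - k%:Z)%R|%N #[a].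
  apply: (@coord_diff y z j k) => //; rewrite {1}yE {1}zE mulgA.
  congr (_ * _); rewrite -expgVn -ax -conjXg conjgE invol_inv // mulgA //.
exists #[a], (Posz j), (Posz k), ixy; split.
- by split; [exact: coord_dihedral | rewrite /gcdz /= jk1].
- by split=> //; rewrite coord_vertex.
- exact: coord_graph.
- by rewrite half_oG ixzE iyzE coord_vertex !PoszD.
have sNG : <[a]> \subset G by rewrite cycle_subG.
have out i : x * a ^+ i \notin <[a]> by rewrite groupMr ?mem_cycle.
apply: (@RevMap_orientable _ _ _ <[a]>) => //.
- by rewrite -divgS // oG -[#|<[a]>|]/#[a] mulnK.
- by rewrite yE out.
by rewrite zE out.
Qed.

(** As for [rev_coord], with [y ^ z] the reflection of exponent [2 k - j]. Since [#[a]]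
    is odd, both sides of the orientability criterion fail: the elements [x * y] and
    [x * z] have odd order, whereas a coherent colouring makes [x * z] odd. *)
Lemma birev_coord :
  exists n : nat, is_dihedral G n /\
    exists (j k : int) (d : nat),
      [/\ (gcdz (gcdz j k) n%:Z = 1)%R,
          (gcdz j n%:Z = d%:Z)%R /\ (3 <= d)%N,
          mg_iso Gamma (multiple (cycle_graph d) (n %/ d)),
          ((ixy + #|G : <<[set x; (y ^ z)%g]>>|)%:Z - (#|G|./2)%:Z
             = gcdz j n%:Z + gcdz (2 * k - j) n%:Z - n%:Z)%R &
          orientable (BiRevMap t) <-> (gcdz (gcdz j (2 * k)) n%:Z = 2)%R].
Proof.
have xx := invol_sq ox.
have inE' : #|G : <<[set x; y ^ z]>>| = gcdn `|(2 * k%:Z - j%:Z)%R|%N #[a].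
  apply: (@coord_diff _ _ j (2 * k)) => //; rewrite ?groupJ ?orderJ ?oy //.
    have -> : x * y ^ z = a ^+ k * (a ^+ j) ^ x * a ^+ k.
      rewrite !conjgE tz_V {1 2}zE yE invol_inv // !mulgA xx mul1g.
      by rewrite -!mulgA.
    rewrite conjXg ax expgVn mul2n -addnn expgD mulgA; congr (_ * _).
    exact/commuteV/commuteX2.
  by rewrite distnC PoszM.
exists #[a]; split; first exact: coord_dihedral.
exists (Posz j), (Posz k), ixy; split.
- by rewrite /gcdz /= jk1.
- by split=> //; rewrite coord_vertex.
- exact: coord_graph.
- by rewrite half_oG inE' coord_vertex PoszD.
split=> [or | g2].
  have [e [eM ex ey ez]] := BiRevMap_parity or.
  have xz : x * z = a ^+ k by rewrite zE mulgA xx mul1g.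
  have := parity_odd_order eM (groupM Gx Gz).
  rewrite xz (dvdn_odd (orderXdvd a k) oa) => /(_ isT).
  by rewrite -xz eM // ex ez.
have : 2 %| #[a].
  have [d2] : gcdn (gcdn j `|(2 * k%:Z)%R|%N) #[a] = 2 by move: g2 => [].
  by rewrite -{1}d2 dvdn_gcdr.
by rewrite dvdn2 oa.
Qed.

End Coordinates.

Section RevKlein.

Variable N : {group gT}.
Hypotheses (nNG : N <| G) (cycN : cyclic N) (oN : odd #|N|).
Hypotheses (oQ : #|G / N| = 4) (Nxyz : x * y * z \in N).
Hypothesis co : coprime (ixy + ixz + iyz) #|G|./2.

Local Notation A := (<<[set x; y]>> :&: N)%G.
Local Notation B := (<<[set x; z]>> :&: N)%G.
Local Notation C := (<<[set y; z]>> :&: N)%G.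

Let oabc : #|N| = (#|A| * #|B| * #|C|)%N.
Proof. exact: klein_order genG ox oy oz nNG cycN oN oQ Nxyz co. Qed.
Let oG : #|G| = (4 * #|N|)%N. Proof. exact: klein_oG nNG oQ. Qed.
Let klxy := klein_xy genG ox oy oz nNG cycN oN oQ Nxyz.
Let klxz := klein_xz genG ox oy oz nNG cycN oN oQ Nxyz.
Let klyz := klein_yz genG ox oy oz nNG cycN oN oQ Nxyz.
Let klco := klein_coprime genG ox oy oz nNG cycN oN oQ Nxyz.

Let odd_sub (D : {group gT}) : D \subset N -> odd #|D|.
Proof. by move=> sDN; apply: dvdn_odd (cardSg sDN) oN. Qed.

Lemma klein_indices :
  [/\ ixy = (#|B| * #|C|)%N, ixz = (#|A| * #|C|)%N & iyz = (#|A| * #|B|)%N].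
Proof.
have idx u v d e : u \in G -> v \in G ->
    #|<<[set u; v]>>| = (4 * d)%N -> 0 < d -> #|N| = (d * e)%N ->
    #|G : <<[set u; v]>>| = e.
  move=> Gu Gv oD d_gt0 Nde; apply/eqP; rewrite -(eqn_pmul2l d_gt0) -(eqn_pmul2l (isT : 0 < 4)).
  by rewrite mulnA -oD index_pair // oG Nde.
have [oxy _ _] := klxy; have [oxz _ _ _] := klxz; have [oyz _ _ _] := klyz.
split.
- by apply: (idx _ _ _ _ Gx Gy oxy); rewrite ?cardG_gt0 // oabc mulnA.
- by apply: (idx _ _ _ _ Gx Gz oxz); rewrite ?cardG_gt0 // oabc mulnCA mulnA.
by apply: (idx _ _ _ _ Gy Gz oyz); rewrite ?cardG_gt0 // oabc mulnC.
Qed.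

Lemma klein_chi :
  chi = klein_euler #|A| #|B| #|C|.
Proof.
have [-> -> ->] := klein_indices.
by rewrite oG oabc -[4]/(2 * 2)%N -mulnA mul2n doubleK !PoszD.
Qed.

(** A coherent colouring is odd on [x], [y] and [z], hence on [x * y * z], whose order
    is odd. *)
Lemma klein_nonorientable : ~ orientable (RevMap t).
Proof.
case/RevMap_parity => e [eM ex ey ez].
have : e (x * y * z) = false.
  apply: (parity_odd_order eM); first by rewrite !groupM.
  by apply: dvdn_odd oN; apply: order_dvdG.
by rewrite !eM ?groupM // ex ey ez.
Qed.

(** The involution [c] and the subgroup [A], which [z] centralises, generate a
    subgroup of index 2 in [<x, y>] that is invariant under [z]. *)
Lemma klein_cycle c : c \in [set x; y] -> commute c z ->
  mg_iso Gamma (multiple (cycle_graph ixy) (2 * #|A|)).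
Proof.
move=> cxy ccz; have [oH Ai sAr] := klxy.
have Hc : c \in <<[set x; y]>> by rewrite mem_gen.
have oc : #[c] = 2 by move: cxy; rewrite !inE => /orP[] /eqP ->.
have Gc : c \in G by move: cxy; rewrite !inE => /orP[] /eqP ->.
have ncN : c \notin A by rewrite inE negb_and (odd_notin_invol oN oc) orbT.
have nAc : <[c]> \subset 'N(A).
  rewrite cycle_subG inE; apply/subsetP => _ /imsetP[a Aa ->].
  rewrite inE; case/setIP: Aa => Ha Na; rewrite groupJ //=.
  by rewrite memJ_norm // (subsetP (normal_norm nNG)).
pose L := (<[c]> <*> A)%G.
have oL : #|L| = (2 * #|A|)%N.
  rewrite /= norm_joinEl // TI_cardMg; first by rewrite [#|<[c]>|]oc.
  apply/eqP; rewrite -subG1; apply/subsetP => u /setIP[].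
  by rewrite /= cycle2g // !inE => /orP[] // /eqP -> cA; rewrite inE cA in ncN.
have <- : #|<<[set x; y]>>| %/ 2 = (2 * #|A|)%N.
  by rewrite oH -[4]/(2 * 2)%N -mulnA mulKn.
apply: coset_graph_cycle; apply: (@meet_conj_index2 _ G _ L) => //.
- exact: tH_sub.
- exact: tG_gen.
- by rewrite join_subG cycle_subG Hc subsetIl.
- rewrite join_subG cycle_subG mem_conjg tz_V (conjg_fixP _) ?Hc /=; last by apply/commgP.
  apply/subsetP => u Au; have [_ _ uz] := Ai u Au.
  by rewrite mem_conjg tz_V uz; case/setIP: Au.
have sLH : L \subset <<[set x; y]>> by rewrite join_subG cycle_subG Hc subsetIl.
by rewrite -divgS // oL oH -[4]/(2 * 2)%N -mulnA mulnK // muln_gt0 cardG_gt0.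
Qed.

(** When [B] and [C] are nontrivial the two signs that [H] can change are independent. *)
Lemma klein_direct_graph : 1 < #|B| -> 1 < #|C| ->
  mg_iso Gamma (multiple (sg_direct (cycle_graph #|B|) (cycle_graph #|C|)) #|A|).
Proof.
move=> B_gt1 C_gt1; have [_ _ cBC] := klco.
have [b [c [Bb Cc ob oc zbc]]] := klein_generators genG ox oy oz nNG cycN oN oQ Nxyz oabc.
have [GHc iH cH iL] := klein_direct genG ox oy oz nNG cycN oN oQ Nxyz oabc B_gt1 C_gt1 Bb Cc ob oc zbc.
have [oH _ _] := klxy.
have <- : #|<<[set x; y]>>| %/ 4 = #|A| by rewrite oH mulKn.
apply: (coset_graph_direct B_gt1 C_gt1 cBC _ GHc iH zbc cH iL).
by rewrite groupM //; [case/setIP: Bb | case/setIP: Cc] => _; apply: (subsetP (normal_sub nNG)).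
Qed.

(** A quotient of order 4 generated by involutions is a Klein group. *)
Lemma klein_complement :
  exists S T : {group gT}, [/\ S ><| T = G, S \isog Zp #|N| & T \isog [set: ('Z_2 * 'Z_2)%type]].
Proof.
have hallN : Hall G N.
  rewrite /Hall (normal_sub nNG) -card_quotient ?normal_norm // oQ.
  by rewrite -[4]/(2 ^ 2)%N coprimeXr // coprimen2.
have /splitsP[T /complP[tiNT defG]] := SchurZassenhaus_split hallN nNG.
have sdG : N ><| T = G.
  by rewrite sdprodE // (subset_trans _ (normal_norm nNG)) // -defG mulG_subr.
exists N, T; split=> //.
  case/cyclicP: cycN => a ->; rewrite isog_sym; exact: Zp_isog.
apply: isog_trans (sdprod_isog sdG) _.
have pQ2 : 2.-group (G / N) by rewrite /pgroup oQ.
have aQ : abelian (G / N) by apply: (card_p2group_abelian (p := 2)); rewrite ?oQ.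
have abQ : 2.-abelem (G / N).
  apply/(abelem_Ohm1P aQ pQ2)/eqP; rewrite eqEsubset Ohm_sub /=.
  have Om u : u \in G -> #[u] = 2 -> coset N u \in 'Ohm_1(G / N).
    move=> Gu ou; rewrite (OhmE 1 pQ2) mem_gen // !inE mem_quotient //=.
    by rewrite expn1 -(order_coset_invol nNG oN Gu ou) expg_order.
  rewrite sub_quotient_pre ?normal_norm //.
  have: <<[set x; y; z]>> \subset coset N @*^-1 'Ohm_1(G / N).
    rewrite gen_subG; apply/subsetP => u xyz_u.
    have [Gu ou] : u \in G /\ #[u] = 2.
      by move: xyz_u; rewrite !inE -orbA => /or3P[] /eqP ->.
    by rewrite mem_morphpre ?Om // (subsetP (normal_norm nNG)).
  by rewrite -genG.
rewrite (isog_abelem_card _ abQ) cardsT card_prod !card_ord oQ andbT.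
apply/abelemP => //; split=> [|[u v] _].
  by apply: (card_p2group_abelian (p := 2)); rewrite // cardsT card_prod !card_ord.
by case: u v => [[|[|u]] hu] [[|[|v]] hv] //; apply/eqP.
Qed.

Let commute_invol (u v : gT) : #[u] = 2 -> #[v] = 2 -> #[u * v] = 2 -> commute u v.
Proof.
move=> ou ov ouv; rewrite /commute -{1}(invol_inv ouv) invMg.
by rewrite (invol_inv ou) (invol_inv ov).
Qed.

Lemma klein_dih_product (D E : {group gT}) (u v : gT) :
    D \subset N -> E \subset N -> u \in G -> v \in G -> #[u] = 2 -> #[v] = 2 -> commute u v ->
    {in D, forall d, d ^ u = d^-1 /\ d ^ v = d} -> {in E, forall d, d ^ v = d^-1 /\ d ^ u = d} ->
    1 < #|D| -> 1 < #|E| -> #|N| = (#|D| * #|E|)%N ->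
  G \isog [set: ('D_(2 * #|D|)%N * 'D_(2 * #|E|)%N)%type].
Proof.
move=> sDN sEN Gu Gv ou ov cuv Di Ei D_gt1 E_gt1 oDE.
have [/cyclicP[d dD] /cyclicP[e eE]] := (cyclicS sDN cycN, cyclicS sEN cycN).
have [Dd Ee] : d \in D /\ e \in E by rewrite dD eE !cycle_id.
have [odd_D odd_E] := (odd_sub sDN, odd_sub sEN).
have [[du dv] [ev eu]] := (Di d Dd, Ei e Ee).
have cent (p q : gT) : p ^ q = p -> commute q p.
  by move=> pq; apply/commute_sym/commgP/conjg_fixP.
have sNG := subsetP (normal_sub nNG).
rewrite {}dD {}eE in sDN sEN Dd Ee odd_D odd_E D_gt1 E_gt1 oDE *.
apply: (@dih_product_isog _ _ u v d e) => //.
- by apply/sNG/(subsetP sDN)/cycle_id.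
- by apply/sNG/(subsetP sEN)/cycle_id.
- exact: cent.
- exact: cent.
- by apply: (centsP (cyclic_abelian cycN)); [apply: (subsetP sDN) | apply: (subsetP sEN)].
by rewrite oG oDE mulnA.
Qed.

(** The cases differ in which of [A], [B], [C] are trivial; [B] and [C] are not both so,
    as their orders multiply to the number of vertices. If just one is
    trivial then two generators commute and [G] is a direct product of two dihedral
    groups; if two are trivial then one of [x], [y] is central. *)
Lemma rev_klein : reversing_type G Gamma chi (orientable (RevMap t)).
Proof.
have [oxy Ai sAr] := klxy; have [oxz Bi oxz2 _] := klxz; have [oyz Ci oyz2 _] := klyz.
have [cAB cAC cBC] := klco; have [ixyE ixzE iyzE] := klein_indices.
have [sAN sBN sCN] : [/\ A \subset N, B \subset N & C \subset N] by rewrite !subsetIr.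
have [oddA oddB oddC] := And3 (odd_sub sAN) (odd_sub sBN) (odd_sub sCN).
have nor := klein_nonorientable; have G4 : 4 %| #|G| by rewrite oG dvdn_mulr.
have [chiA chiB chiC chiABC] := klein_eulerE klein_chi.
have defG u v : u \in G -> v \in G -> #|<<[set u; v]>>| = #|G| -> <<[set u; v]>> = G.
  move=> Gu Gv oD; apply/eqP; rewrite eqEcard oD leqnn andbT.
  by rewrite gen_subG subUset !sub1set Gu.
have cyz : #|C| = 1%N -> commute y z.
  by move=> C1; apply: commute_invol; rewrite // oyz2 C1.
have cxz : #|B| = 1%N -> commute x z.
  by move=> B1; apply: commute_invol; rewrite // oxz2 B1.
have cxy : #|A| = 1%N -> commute x y.
  move=> A1; have /eqP := oxy; rewrite A1 dih_card //; last first.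
    by apply/eqP => xy; move: oxy; rewrite A1 -xy setUid [#|_|]ox.
  rewrite -[(4 * 1)%N]/(2 * 2)%N eqn_pmul2l // => /eqP; exact: commute_invol.
have eq1 (D : {group gT}) : #|D| = 1%N \/ 1 < #|D|.
  by case: (ltngtP 1 #|D|) (cardG_gt0 D) => [||->]; [right | case: #|D| | left].
have [A1 | A_gt1] := eq1 A; have [B1 | B_gt1] := eq1 B; have [C1 | C_gt1] := eq1 C.
- by move: i3; rewrite ixyE B1 C1.
- left; apply: (@rev_central y x) => //; first by right.
  + exact: cxy.
  + exact: cxz.
  by apply: defG => //; rewrite oyz oG oabc A1 B1 !mul1n.
- left; apply: (@rev_central x y) => //; first by left.
  + exact/commute_sym/cxy.
  + exact: cyz.
  by apply: defG => //; rewrite oxz oG oabc A1 C1 mul1n muln1.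
- right; right; left; exists #|B|, #|C|; split=> //.
  + apply: (klein_dih_product (u := x) (v := y)) => //; first exact: cxy.
    * by move=> d /Bi[].
    * by move=> d /Ci[].
    by rewrite oabc A1 mul1n.
  + by right; have := klein_direct_graph B_gt1 C_gt1; rewrite A1.
  exact: chiA.
- by move: i3; rewrite ixyE B1 C1.
- right; right; left; exists #|C|, #|A|; split=> //; first by rewrite coprime_sym.
  + apply: (klein_dih_product (u := z) (v := x)) => //; first exact/commute_sym/cxz.
    * by move=> d /Ci[].
    * by move=> d /Ai[].
    by rewrite oabc B1 muln1 mulnC.
  + left; have := @klein_cycle x; rewrite ixyE B1 mul1n; apply; last exact: cxz.
    by rewrite !inE eqxx.
  exact: chiB.
- right; right; left; exists #|B|, #|A|; split=> //; first by rewrite coprime_sym.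
  + apply: (klein_dih_product (u := z) (v := y)) => //; first exact/commute_sym/cyz.
    * by move=> d /Bi[].
    * by move=> d /Ai[].
    by rewrite oabc C1 muln1 mulnC.
  + left; have := @klein_cycle y; rewrite ixyE C1 muln1; apply; last exact: cyz.
    by rewrite !inE eqxx orbT.
  exact: chiC.
right; right; right; left; exists #|B|, #|C|, #|A|; split=> //.
- by split=> //; split; split=> //; rewrite coprime_sym.
- have [S [T [ST iS iT]]] := klein_complement; exists S, T; split=> //.
  by rewrite (_ : (_ * _ * _)%N = #|N|) // mulnC mulnA -oabc.
exact: klein_direct_graph.
Qed.

End RevKlein.

Section RevS4.

Variables K N : {group gT}.
Hypotheses (nKG : K <| G) (nNG : N <| G) (abK : 2.-abelem K) (oK : #|K| = 4).
Hypotheses (cycN : cyclic N) (oN : odd #|N|) (defC : K \x N = 'C_G(K)).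
Hypothesis (iC : #|G : 'C_G(K)| = 6).

(** The vertex stabilizer is generated by the two elements of the triple that differ
    from [z], which leaves three possibilities. *)
Lemma s4_coset_graph (a b c : gT) :
    a \in G -> b \in G -> c \in G -> #[a] = 2 -> #[b] = 2 -> #[c] = 2 ->
    s4_triple K N a b c -> G \subset <<[set a; b; c]>> ->
    [\/ z = c /\ [set x; y] = [set a; b], z = b /\ [set x; y] = [set a; c] |
        z = a /\ [set x; y] = [set b; c]] ->
  [\/ mg_iso Gamma (multiple (complete_graph 4) (2 * #|N|)),
      mg_iso Gamma (multiple (sg_lex (cycle_graph (3 * #|N|)) (edgeless_graph 2)) 1) |
      mg_iso Gamma (multiple (cycle_graph (3 * #|N|)) 4)].
Proof.
move=> Ga Gb Gc oa ob oc s4 genabc.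
have iab := s4_index nKG oK defC iC Ga Gb s4.
have oG := nk_oG nKG oK defC iC.
have [oac obc] := s4_orders nKG abK oK Ga oa ob oc s4.
case=> [[zE xyE] | [zE xyE] | [zE xyE]].
- constructor 1; have [_ _ [oD _] _ _] := s4.
  have <- : #|<<[set x; y]>>| %/ 3 = (2 * #|N|)%N.
    by rewrite xyE oD -[6]/(3 * 2)%N -mulnA mulKn.
  apply: coset_graph_complete4; rewrite ?xyE ?zE //.
  exact: s4_complete_index nKG abK oK oN defC Ga Gb ob oc s4.
- constructor 3; have iH := i3.
  have iE : #|G : <<[set x; y]>>| = (3 * #|N|)%N.
    rewrite xyE -divgS ?gen_subG ?subUset ?sub1set ?Ga //.
    by rewrite oac oG -[24]/(8 * 3)%N -mulnA mulKn.
  have := @coset_graph_cycle _ _ t; rewrite iE xyE oac zE; apply.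
  apply: (s4_cycle nKG abK oK Ga Gb oa ob s4); last by rewrite -xyE.
  by have := tG_gen t; rewrite /= zE xyE.
constructor 2; have [[sHT sTG iHT iLT iT] iL] := s4_lex nKG abK oK oN defC iC genabc Ga Gb oa ob oc s4.
have N_gt0 := cardG_gt0 N.
have := @coset_graph_lex _ _ t (<[b]> <*> K)%G.
rewrite iT xyE obc zE; apply=> //.
by case: #|N| N_gt0 => // n _; rewrite mulnS.
Qed.

(** The indices are [4], [3 |N|] and [6 |N|]. A coherent colouring would take the same
    value on the three conjugates [c], [c ^ a] and [c * c ^ a], hence would be even
    on [c]. *)
Lemma rev_s4_triple (a b c : gT) :
    a \in G -> b \in G -> c \in G -> #[a] = 2 -> #[b] = 2 -> #[c] = 2 ->
    s4_triple K N a b c -> G \subset <<[set a; b; c]>> ->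
    (ixy + ixz + iyz = #|G : <<[set a; b]>>| + #|G : <<[set a; c]>>| + #|G : <<[set b; c]>>|)%N ->
    c \in [set x; y; z] ->
    [\/ z = c /\ [set x; y] = [set a; b], z = b /\ [set x; y] = [set a; c] |
        z = a /\ [set x; y] = [set b; c]] ->
  reversing_type G Gamma chi (orientable (RevMap t)).
Proof.
move=> Ga Gb Gc oa ob oc s4 genabc sumE cxyz roles.
have oG := nk_oG nKG oK defC iC.
have [oac obc] := s4_orders nKG abK oK Ga oa ob oc s4.
have nE : #|N| = (3 ^ logn 3 #|N| * #|N|`_3^')%N by rewrite -p_part partnC.
have n3E : (3 * #|N|)%N = (3 ^ (logn 3 #|N|).+1 * #|N|`_3^')%N by rewrite {1}nE expnS mulnA.
right; right; right; right; exists (logn 3 #|N|), (#|N|`_3^')%N; split.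
- split; first exact: part_gt0.
  rewrite -[6]/(2 * 3)%N coprimeMl coprime2n (dvdn_odd (dvdn_part _ _) oN) /=.
  by rewrite prime_coprime // -p'natE // part_pnat.
- exists N; rewrite -nE; split=> //.
    have /cyclicP[d ->] := cycN; rewrite isog_sym; exact: Zp_isog.
  exact: s4_isog nKG nNG oK defC iC Ga Gb s4.
- by rewrite -n3E -mulnA -nE; apply: s4_coset_graph roles.
- have i24 (u v : gT) (d e : nat) : u \in G -> v \in G -> #|<<[set u; v]>>| = d -> 0 < d ->
      (d * e)%N = 24 -> #|G : <<[set u; v]>>| = (e * #|N|)%N.
    move=> Gu Gv oD d0 de; apply/eqP; rewrite -(eqn_pmul2l d0) mulnA de -oG -oD.
    by rewrite index_pair.
  rewrite sumE (s4_index nKG oK defC iC Ga Gb s4).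
  rewrite (i24 a c 8 3) // (i24 b c 4 6) // oG -n3E.
  have -> : ((24 * #|N|)./2 = 12 * #|N|)%N by rewrite -[24]/(2 * 12)%N -mulnA mul2n doubleK.
  by move: #|N| => n; clear; lia.
case/RevMap_parity => e [eM ex ey ez].
have ec : e c = true by move: cxyz; rewrite !inE -orbA => /or3P[] /eqP ->.
have := congr1 e (s4_conj nKG abK oK oN defC Ga Gb ob oc s4).
by rewrite eM ?groupJ // !(parity_conj eM) ?groupM // ec.
Qed.

End RevS4.

Section ClassifyTriples.

Local Notation iyzz := #|G : <<[set x; y ^ z]>>|.

Hypothesis solG : solvable G.

Let oyz : #[y ^ z] = 2. Proof. by rewrite orderJ. Qed.
Let Gyz : y ^ z \in G. Proof. exact: groupJ. Qed.

Let genP u : u \in [set x; y; z] -> u \in G /\ #[u] = 2.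
Proof. by rewrite !inE -orbA => /or3P[] /eqP ->. Qed.

Let sub2 (a b : gT) : a \in G -> b \in G -> <<[set a; b]>> \subset G.
Proof. by move=> Ga Gb; rewrite gen_subG subUset !sub1set Ga. Qed.

Let structure :
    (forall p : nat, prime p -> p %| #|G|./2 -> exists a b : gT,
      [/\ #[a] = 2, #[b] = 2, <<[set a; b]>> \subset G & ~~ (p %| #|G : <<[set a; b]>>|)]) ->
  (exists N : {group gT}, [/\ N <| G, cyclic N, odd #|N| & 2.-group (G / N)]) \/
  (exists K N : {group gT}, [/\ K <| G /\ N <| G, 2.-abelem K /\ #|K| = 4,
      cyclic N /\ odd #|N|, K \x N = 'C_G(K) & #|G : 'C_G(K)| = 6]).
Proof.
apply: (dihedral_index_structure solG genG) => [u /genP[] //|].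
by apply/set0Pn; exists x; rewrite !inE eqxx.
Qed.

(** When 4 divides [|G|] and [N] has 2-power index, the sum of the three indices is odd,
    so that [third_central] applies to a suitable order of the generators; the case
    of [z] central is excluded, as [x] and [y] do not generate [G]. *)
Theorem RevMap_type :
    coprime (ixy + ixz + iyz) #|G|./2 ->
  reversing_type G Gamma ((ixy + ixz + iyz)%:Z - (#|G|./2)%:Z)%R (orientable (RevMap t)).
Proof.
move=> co; case: structure => [p pr_p pG||].
- have := coprime_prime co pr_p pG.
  case pxy: (p %| ixy); last by exists x, y; rewrite pxy sub2.
  case pxz: (p %| ixz); last by exists x, z; rewrite pxz sub2.
  by rewrite dvdn_addr ?dvdn_add // => pyz; exists y, z; rewrite pyz sub2.
- case=> N [nNG cycN oN pQ]; have [G4 | nG4] := boolP (4 %| #|G|); last first.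
    have [a [j [k [[Ga oG] _ [ax nax] [yE zE] jk1]]]] :=
      dihedral_coordinates genG ox oy oz nNG cycN oN pQ nG4.
    by right; left; apply: rev_coord Ga oG ax nax yE zE jk1.
  have odd_sum : odd (ixy + ixz + iyz).
    have half2 : 2 %| #|G|./2.
      by case/dvdnP: G4 => m ->; rewrite -[4]/(2 * 2)%N mulnA muln2 doubleK dvdn_mull.
    by have := coprime_prime co (isT : prime 2) half2; rewrite dvdn2 negbK.
  have klein : #|G / N| = 4 -> x * y * z \in N ->
      reversing_type G Gamma ((ixy + ixz + iyz)%:Z - (#|G|./2)%:Z)%R (orientable (RevMap t)).
    by move=> oQ Nxyz; apply: rev_klein nNG cycN oN oQ Nxyz co.
  have [oxy | nxy] := boolP (odd ixy).
    have par : odd ixz = odd iyz.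
      by move: odd_sum; rewrite !oddD oxy; case: (odd ixz); case: (odd iyz).
    case: (third_central genG ox oy oz nNG cycN oN pQ G4 oxy par) => [[_ _ defG] | []].
      by move: i3; rewrite defG indexgg.
    exact: klein.
  have [oxz | nxz] := boolP (odd ixz).
    have genG' : G = <<[set x; z; y]>> :> {set gT}.
      by rewrite genG -!setUA (setUC [set y]).
    have par : odd ixy = odd #|G : <<[set z; y]>>|.
      rewrite (setUC [set z] [set y]); move: odd_sum; rewrite !oddD oxz (negbTE nxy).
      by case: (odd iyz).
    case: (third_central genG' ox oz oy nNG cycN oN pQ G4 oxz par) => [[cyx cyz defG] | [oQ Nxzy]].
      by left; apply: (rev_central (u := x) (c := y)) => //; left.
    by apply: klein => //; have [] := klein_quotient_perm nNG oQ Gx Gz Gy Nxzy.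
  have oyz' : odd iyz by move: odd_sum; rewrite !oddD (negbTE nxy) (negbTE nxz).
  have genG' : G = <<[set y; z; x]>> :> {set gT} by rewrite genG setUC -setUA setUC -!setUA; congr <<_>>; rewrite setUC -setUA.
  have par : odd #|G : <<[set y; x]>>| = odd #|G : <<[set z; x]>>|.
    by rewrite !(setUC _ [set x]) (negbTE nxy) (negbTE nxz).
  case: (third_central genG' oy oz ox nNG cycN oN pQ G4 oyz' par) => [[cxy cxz defG] | [oQ Nyzx]].
    by left; apply: (rev_central (u := y) (c := x)) => //; right.
  apply: klein => //; have [_ Nzxy] := klein_quotient_perm nNG oQ Gy Gz Gx Nyzx.
  by have [] := klein_quotient_perm nNG oQ Gz Gx Gy Nzxy.
case=> K [N [[nKG nNG] [abK oK] [cycN oN] defC iC]].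
have half3 : 3 %| #|G|./2.
  by rewrite (nk_oG nKG oK defC iC) -[24]/(2 * 12)%N -mulnA mul2n doubleK dvdn_mulr.
have n3 := coprime_prime co (isT : prime 3) half3.
have type a b c : a \in [set x; y; z] -> b \in [set x; y; z] -> c \in [set x; y; z] ->
    [set x; y; z] = [set a; b; c] ->
    (ixy + ixz + iyz = #|G : <<[set a; b]>>| + #|G : <<[set a; c]>>| + #|G : <<[set b; c]>>|)%N ->
    [\/ z = c /\ [set x; y] = [set a; b], z = b /\ [set x; y] = [set a; c] |
        z = a /\ [set x; y] = [set b; c]] ->
    ~~ (3 %| #|G : <<[set a; b]>>|) ->
    reversing_type G Gamma ((ixy + ixz + iyz)%:Z - (#|G|./2)%:Z)%R (orientable (RevMap t)).
  move=> Xa Xb Xc XE sumE roles nab.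
  have [[Ga oa] [Gb ob] [Gc oc]] := And3 (genP Xa) (genP Xb) (genP Xc).
  have gen : G \subset <<[set a; b; c]>> by rewrite -XE -genG.
  rewrite sumE in co.
  case: (nk_triple nKG nNG abK oK oN defC iC Ga Gb Gc oa ob oc co nab) => s4.
    exact: rev_s4_triple Ga Gb Gc oa ob oc s4 gen sumE Xc roles.
  apply: (rev_s4_triple nKG nNG abK oK cycN oN defC iC Gb Ga Gc ob oa oc s4 _ _ Xc).
  - by rewrite (setUC [set b] [set a]).
  - by rewrite sumE (setUC [set b] [set a]) addnAC.
  by rewrite (setUC [set b] [set a]); case: roles => -[? ?]; [constructor 1 | constructor 3 | constructor 2].
case pxy: (3 %| ixy); last first.
  apply: (type x y z); rewrite ?pxy ?inE ?eqxx ?orbT //; by constructor 1.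
case pxz: (3 %| ixz); last first.
  apply: (type x z y); rewrite ?pxz ?inE ?eqxx ?orbT //.
  - by rewrite -!setUA (setUC [set y]).
  - by rewrite (setUC [set z] [set y]) (addnC ixy).
  by constructor 2.
apply: (type y z x); rewrite ?inE ?eqxx ?orbT //.
- by rewrite setUC -setUA setUC -!setUA; rewrite setUC -setUA.
- by rewrite !(setUC _ [set x]); lia.
- by constructor 2; rewrite setUC.
by move: n3; rewrite dvdn_addr ?dvdn_add.
Qed.

(** The two indices have opposite parities as soon as [|G| / 2] is even. This excludes
    the case of a 2-group [G / N], since [y] and [y ^ z] are congruent modulo its
    Frattini subgroup; and that of a Klein group [K], since [x], [y] and [y ^ z] lie
    outside [K] by [nk_index3] and then both indices are even. *)
Theorem BiRevMap_type :
    coprime (ixy + iyzz) #|G|./2 ->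
  exists n : nat, is_dihedral G n /\
    exists (j k : int) (d : nat),
      [/\ (gcdz (gcdz j k) n%:Z = 1)%R,
          (gcdz j n%:Z = d%:Z)%R /\ (3 <= d)%N,
          mg_iso Gamma (multiple (cycle_graph d) (n %/ d)),
          ((ixy + iyzz)%:Z - (#|G|./2)%:Z
             = gcdz j n%:Z + gcdz (2 * k - j) n%:Z - n%:Z)%R &
          orientable (BiRevMap t) <-> (gcdz (gcdz j (2 * k)) n%:Z = 2)%R].
Proof.
move=> co; case: structure => [p pr_p pG||].
- have := coprime_prime co pr_p pG.
  case pxy: (p %| ixy); last by exists x, y; rewrite pxy sub2.
  by rewrite dvdn_addr // => pyz; exists x, (y ^ z); rewrite pyz sub2.
- case=> N [nNG cycN oN pQ]; have [G4 | nG4] := boolP (4 %| #|G|); last first.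
    have [a [j [k [[Ga oG] oa [ax nax] [yE zE] jk1]]]] :=
      dihedral_coordinates genG ox oy oz nNG cycN oN pQ nG4.
    exact: birev_coord Ga oG oa ax nax yE zE jk1.
  have half2 : 2 %| #|G|./2.
    by case/dvdnP: G4 => m ->; rewrite -[4]/(2 * 2)%N mulnA muln2 doubleK dvdn_mull.
  have := coprime_prime co (isT : prime 2) half2; rewrite dvdn2 negbK oddD.
  have nN := subsetP (normal_norm nNG).
  have cyz : coset N (y ^ z) = coset N y ^ coset N z by rewrite morphJ ?nN.
  have Qz : coset N z \in G / N by apply: mem_quotient.
  rewrite !(odd_index_pair nNG) // cyz.
  suff -> : (<<[set coset N x; coset N y ^ coset N z]>> == G / N)
      = (<<[set coset N x; coset N y]>> == G / N) by rewrite addbb.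
  apply/eqP/eqP => [E | E]; last exact: (conj_gen_2group pQ Qz E).
  have := conj_gen_2group pQ Qz E.
  by rewrite -conjgM -morphM ?nN // (invol_sq oz) morph1 conjg1.
case=> K [N [[nKG nNG] [abK oK] [cycN oN] defC iC]].
have half12 : #|G|./2 = (12 * #|N|)%N.
  by rewrite (nk_oG nKG oK defC iC) -[24]/(2 * 12)%N -mulnA mul2n doubleK.
have half3 : 3 %| #|G|./2 by rewrite half12 dvdn_mulr.
have half2 : 2 %| #|G|./2 by rewrite half12 dvdn_mulr.
have n3 := coprime_prime co (isT : prime 3) half3.
have nKy : y \notin K.
  apply: contra n3 => Ky; rewrite dvdn_add // (nk_index3 nKG oK defC iC) //.
  by rewrite memJ_norm // (subsetP (normal_norm nKG)).
have nKx : x \notin K.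
  by apply: contra n3 => Kx; rewrite dvdn_add // setUC (nk_index3 nKG oK defC iC).
have nKyz : y ^ z \notin K by rewrite memJ_norm // (subsetP (normal_norm nKG)).
have := coprime_prime co (isT : prime 2) half2; rewrite dvdn2 negbK oddD.
have ev := nk_even_index nKG abK oK oN defC iC.
by rewrite (negbTE (ev x y Gx Gy ox oy nKx nKy)) (negbTE (ev x _ Gx Gyz ox oyz nKx nKyz)).
Qed.

End ClassifyTriples.

End ReversingMaps.

(** * Vertex-reversing maps as coset maps *)

(** A dihedral group with commuting generators has exponent 2. *)
Lemma cyclic_dihedral (gT : finGroupType) (A : {group gT}) (n : nat) :
  is_dihedral A n -> cyclic A -> #|A| = 2.
Proof.
rewrite /is_dihedral; case: eqP => [_ /card_isog -> _ | n1 /andP[n_gt0 isoA] cycA].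
  by rewrite cardsT card_ord.
have n_gt1 : 1 < n by rewrite ltn_neqAle n_gt0 andbT eq_sym; apply/eqP.
rewrite mul2n in isoA; have oA := card_isog isoA; rewrite card_dihedral // in oA.
have /existsP[[u v] /= /eqP[defA _ v2 uv]] :
    A \homg Grp (u : v : u ^+ n, v ^+ 2, u ^ v = u ^-1).
  by rewrite -Grp_dihedral //; apply: isog_hom.
have [Au Av] : u \in A /\ v \in A.
  by rewrite -defA; split; rewrite mem_gen // inE ?cycle_id ?orbT.
have cA := cyclic_abelian cycA.
have sq1 : {in A, forall g, g ^+ 2 = 1}.
  have u2 : u ^+ 2 = 1.
    have uu : u ^ v = u by apply/conjg_fixP/commgP/(centsP cA).
    by rewrite expg2 -{2}uu uv mulgV.
  have cuv : <[v]> \subset 'C(<[u]>).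
    by apply: (sub_abelian_cent2 cA); rewrite cycle_subG.
  move=> g; rewrite -defA (cent_joinEr cuv) => /mulsgP[_ _ /cycleP[i ->] /cycleP[j ->] ->].
  rewrite expgMn; last by apply/commuteX2/(centsP cA).
  by rewrite -!expgM !(mulnC _ 2) !expgM u2 v2 !expg1n mulg1.
have [a defa] := cyclicP cycA.
have : #[a] %| 2 by rewrite order_dvdn sq1 // defa cycle_id.
move/dvdn_leq => /(_ isT); rewrite -[#[a]]/#|<[a]>| -defa oA.
by case: (n) n_gt1 => [|[|k]] // _; rewrite doubleS.
Qed.

Section Flags.

Variables (M : surface_map) (G : {group {perm flag M}}).
Hypothesis autG : G \subset map_aut M.
Hypothesis arcG : acts_regularly (@arc_act M) G (arcs M).

Implicit Types (w u : flag M) (g h : {perm flag M}).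

Lemma aut_t g w : g \in G -> [/\ g (t0 w) = t0 (g w), g (t1 w) = t1 (g w) & g (t2 w) = t2 (g w)].
Proof.
move/(subsetP autG); rewrite inE => /forallP/(_ w).
by case/and3P => /eqP -> /eqP -> /eqP ->.
Qed.

Lemma aut_t0 g w : g \in G -> g (t0 w) = t0 (g w). Proof. by move=> Gg; have [] := aut_t w Gg. Qed.
Lemma aut_t1 g w : g \in G -> g (t1 w) = t1 (g w). Proof. by move=> Gg; have [] := aut_t w Gg. Qed.
Lemma aut_t2 g w : g \in G -> g (t2 w) = t2 (g w). Proof. by move=> Gg; have [] := aut_t w Gg. Qed.

Lemma closed_all (P : pred (flag M)) w : P w ->
    (forall u, P u -> [/\ P (t0 u), P (t1 u) & P (t2 u)]) -> forall u, P u.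
Proof.
move=> Pw cl u; have /connectP[p + ->] := map_connected w u.
elim: p w Pw => //= v p IHp w Pw /andP[/or4P[] // /eqP <-]; apply: IHp;
  by have [] := cl w Pw.
Qed.

(** The fixed flags of an automorphism are closed under adjacency and the map is
    connected. *)
Lemma semiregular g w : g \in G -> g w = w -> g = 1.
Proof.
move=> Gg gw; apply/permP => u; rewrite perm1; apply/eqP.
apply: (closed_all (P := fun u => g u == u) (w := w)) => [|v /eqP gv]; first by apply/eqP.
by rewrite /= aut_t0 // aut_t1 // aut_t2 // gv !eqxx.
Qed.

Lemma fv_t1 w : fv (t1 w) = fv w.
Proof. by apply/fvP/connect1; rewrite /step /= t1K eqxx. Qed.

Lemma fv_t2 w : fv (t2 w) = fv w.
Proof. by apply/fvP/connect1; rewrite /step /= t2K eqxx orbT. Qed.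

(** The involutions [t0] and [t2] commute. *)
Lemma edge_flags w u : fe w = fe u -> u \in [:: w; t2 w; t0 w; t2 (t0 w)].
Proof.
move/feP/connectP => [p + ->]; move: p.
suff cl : forall p v, v \in [:: w; t2 w; t0 w; t2 (t0 w)] ->
    path (step [:: @t0 M; @t2 M]) v p -> last v p \in [:: w; t2 w; t0 w; t2 (t0 w)].
  by move=> p; apply: cl; rewrite inE eqxx.
elim=> //= v' p IHp v Xv /andP[/or3P[] // /eqP <-]; apply: IHp; move: Xv;
  rewrite !inE => /or4P[] /eqP ->; by rewrite ?t02C ?t2K ?t0K ?eqxx ?orbT.
Qed.

(** The other two flags of the edge are at its other end, which is another vertex. *)
Lemma arc_flags w u : fv w = fv u -> fe w = fe u -> u = w \/ u = t2 w.
Proof.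
move=> vwu /edge_flags; rewrite !inE => /or4P[] /eqP uE; [by left | by right | |];
  by have := map_loopless w; rewrite vwu uE ?fv_t2 eqxx.
Qed.

(** An arc has two flags, exchanged by [t2]. *)
Lemma arc_transitive w u : exists2 g, g \in G & g w = u \/ g w = t2 u.
Proof.
have arcP v : (fv v, fe v) \in arcs M.
  by rewrite inE; apply/existsP; exists v; rewrite /= !eqxx.
have /eqP := arcG (arcP w) (arcP u); case/cards1P=> g /setP/(_ g).
rewrite !inE eqxx => /andP[Gg /eqP[]]; have Ag := subsetP autG g Gg.
rewrite vactE // eactE // => vE eE; exists g => //.
by apply: arc_flags.
Qed.

Lemma arc_unique g w : g \in G -> g w = t2 w -> False.
Proof.
move=> Gg gw.
have arcP v : (fv v, fe v) \in arcs M.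
  by rewrite inE; apply/existsP; exists v; rewrite /= !eqxx.
have fix_arc h : h w = w \/ h w = t2 w -> h \in G ->
    h \in [set k in G | arc_act (fv w, fe w) k == (fv w, fe w)].
  move=> hw Gh; rewrite inE Gh /arc_act /= vactE ?eactE ?(subsetP autG) //.
  case: hw => ->; rewrite ?fv_t2 ?eqxx //.
  by apply/eqP; congr (_, _); apply/feP/connect1; rewrite /step /= t2K eqxx orbT.
have /eqP := arcG (arcP w) (arcP w); case/cards1P=> k kE.
have := fix_arc g (or_intror gw) Gg; have := fix_arc 1 (or_introl (perm1 w)) (group1 G).
rewrite kE !inE => /eqP <- /eqP g1.
by have := t2_fpf w; rewrite -gw g1 perm1 eqxx.
Qed.

Lemma same_arc g h w : g \in G -> h \in G -> h w = g w \/ h w = g (t2 w) -> h = g.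
Proof.
move=> Gg Gh hw; apply: (mulIg g^-1); rewrite mulgV.
have Gk : h * g^-1 \in G by rewrite groupM ?groupV.
case: hw => E; first by apply: (@semiregular _ w); rewrite // permM E permK.
by case: (@arc_unique (h * g^-1) w); rewrite // permM E permK.
Qed.

(** If a flag and its mirror image at the vertex lay in different orbits, the
    vertex stabilizer would consist of rotations only; a cyclic dihedral group
    has order 2, so vertices would have valency 2, the graph would be a cycle,
    and its complement has at most two faces. *)
Lemma vertex_reflection (w : flag M) :
    (exists n, is_dihedral (vertex_stab G (fv w)) n) -> 3 <= #|face M| ->
  exists2 g, g \in G & g w = t1 w.
Proof.
case=> n dihG F3; have [g Gg [gw | gw]] := arc_transitive w (t1 w); first by exists g.
have t1w : t1 w = g (t2 w) by rewrite aut_t2 // gw t2K.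
have t1t2w : g (t1 (t2 w)) = w by rewrite aut_t1 // -t1w t1K.
have Gc h : h \in <[g]> -> h \in G by apply/subsetP; rewrite cycle_subG.
have cgg h : h \in <[g]> -> g * h \in <[g]> /\ g^-1 * h \in <[g]>.
  by move=> ch; split; rewrite groupM ?groupV ?cycle_id.
have gV u : g^-1 (g u) = u by rewrite permK.
have stab_cyc : vertex_stab G (fv w) = <[g]>.
  apply/eqP; rewrite eqEsubset; apply/andP; split; last first.
    apply/subsetP => h ch; rewrite inE Gc // vactE ?(subsetP autG) ?Gc //=.
    have /cycleP[i ->] := ch; apply/eqP; elim: i => [|i IHi]; first by rewrite perm1.
    by rewrite expgSr permM -!(@vactE _ g) ?(subsetP autG) // IHi vactE ?(subsetP autG) // gw
      fv_t2 fv_t1.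
  apply/subsetP => h; rewrite inE => /andP[Gh]; rewrite vactE ?(subsetP autG) //.
  move/eqP/esym/fvP/connectP => [p].
  suff cl : forall p u, (exists2 k, k \in <[g]> & u = k w \/ u = k (t2 w)) ->
      path (step [:: @t1 M; @t2 M]) u p -> exists2 k, k \in <[g]> & last u p = k w \/ last u p = k (t2 w).
    move=> /cl pP hE; have [|k ck] := pP; first by exists 1; rewrite ?group1 // perm1; left.
    by rewrite -hE => kw; rewrite (same_arc (Gc k ck) Gh kw).
  elim=> //= v q IHq u [k ck uk] /andP[/or3P[] // /eqP <-]; apply: IHq.
    have [c1 c2] := cgg k ck; case: uk => ->; [exists (g * k) | exists (g^-1 * k)] => //.
      by right; rewrite permM -t1w aut_t1 // Gc.
    by left; rewrite permM -aut_t1 ?Gc // -{2}t1t2w gV.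
  exists k => //; case: uk => ->; [right | left]; first by rewrite aut_t2 ?Gc.
  by rewrite -aut_t2 ?Gc // t2K.
have gg1 : g * g = 1.
  have o2 : #|<[g]>| = 2.
    by rewrite stab_cyc in dihG; apply: (cyclic_dihedral dihG); apply: cycle_cyclic.
  by rewrite -expg2 -o2 expg_order.
have t12w : t1 (t2 w) = t2 (t1 w).
  rewrite -gw; apply: (@perm_inj _ g); rewrite t1t2w.
  by rewrite -permM gg1 perm1.
have t12 u : t1 (t2 u) = t2 (t1 u).
  have [h Gh [<- | hE]] := arc_transitive w u.
    by rewrite -aut_t2 // -!aut_t1 // -aut_t2 // t12w.
  by rewrite -[u]t2K -hE t2K -!aut_t2 // -!aut_t1 // -aut_t2 // t12w t2K.
have two u : (ff u == ff w) || (ff u == ff (t2 w)).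
  have f01 (v : flag M) : ff (t0 v) = ff v /\ ff (t1 v) = ff v.
    by split; apply/ffP/connect1; rewrite /step /= ?t0K ?t1K eqxx ?orbT.
  apply: (closed_all (P := fun u => (ff u == ff w) || (ff u == ff (t2 w))) (w := w)) => [|v Pv].
    by rewrite eqxx.
  have [-> ->] := f01 v; split=> //.
  have f2 (a b : flag M) : ff a = ff b -> ff (t2 a) = ff (t2 b).
    move/ffP => c; apply/ffP; apply: (homo_connect _ c) => c1 c2.
    by rewrite /step /= => /or3P[] // /eqP <-; rewrite -?t02C ?t12 ?eqxx ?orbT.
  by case/orP: Pv => /eqP /f2 ->; rewrite ?t2K eqxx ?orbT.
have : #|face M| <= #|[set ff w; ff (t2 w)]|.
  rewrite -cardsT; apply/subset_leq_card/subsetP => f _.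
  by have [u /eqP <-] := ff_surj f; rewrite !inE two.
by rewrite cards2 leqNgt (leq_trans _ F3) // ltnS; case: (_ != _).
Qed.

End Flags.

Lemma map_iso_sym (M M' : surface_map) : map_iso M M' -> map_iso M' M.
Proof.
case=> f [[f' fK f'K] f0 f1 f2]; exists f'.
by split=> [|w|w|w]; [exists f | rewrite -{1}(f'K w) -f0 | rewrite -{1}(f'K w) -f1
  | rewrite -{1}(f'K w) -f2]; rewrite ?fK.
Qed.

(** The labels [(g, true)] and [(g, false)] are given to [g w] and [g (t2 w)]. As a
    product of permutations applies its left factor first, left multiplication by
    [x], [y] and [z] then corresponds to the adjacencies of [w] and of [t2 w]; the
    two kinds of map correspond to the two flags of the arc onto which [z] can send
    [w]. *)
Theorem vertex_reversing_coset_map (M : surface_map) (G : {group {perm flag M}}) :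
    vertex_reversing G -> 3 <= #|vertex M| -> 3 <= #|face M| ->
  exists t : arc_regular_triple G, map_iso M (RevMap t) \/ map_iso M (BiRevMap t).
Proof.
case=> autG arcG stabG V3 F3; have /card_gt0P[w _] := flag_inh M.
have refl u : exists2 g, g \in G & g u = t1 u.
  by apply: (vertex_reflection autG arcG) F3; have [] := stabG (fv u).
have T0 g u : g \in G -> g (t0 u) = t0 (g u) := @aut_t0 M G autG g u.
have T1 g u : g \in G -> g (t1 u) = t1 (g u) := @aut_t1 M G autG g u.
have T2 g u : g \in G -> g (t2 u) = t2 (g u) := @aut_t2 M G autG g u.
have order2 g u v : g \in G -> g u = v -> v != u -> g v = u -> #[g] = 2.
  move=> Gg gu nvu gv; have g2 : g ^+ 2 = 1.
    by apply: (semiregular autG (w := u)); rewrite ?groupX // expg2 permM gu gv.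
  have : #[g] %| 2 by rewrite order_dvdn g2.
  rewrite (dvdn_divisors _ (isT : 0 < 2)) !inE order_eq1 => /orP[/eqP g1|/eqP //].
  by case/eqP: nvu; rewrite -gu g1 perm1.
have [x Gx xw] := refl w; have [y Gy yw] := refl (t2 w).
have ox : #[x] = 2 by apply: (order2 x w (t1 w)); rewrite ?t1_fpf // T1 // xw t1K.
have oy : #[y] = 2 by apply: (order2 y (t2 w) (t1 (t2 w))); rewrite ?t1_fpf // T1 // yw t1K.
have nv0 : t0 w != w by apply: contraNneq (map_loopless w) => ->.
have nv20 : t2 (t0 w) != w by apply: contraNneq (map_loopless w) => {2}<-; rewrite fv_t2.
have [z Gz zw] := arc_transitive autG arcG w (t0 w).
have oz : #[z] = 2.
  case: zw => zw; first by apply: (order2 z w (t0 w)); rewrite // T0 // zw t0K.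
  by apply: (order2 z w (t2 (t0 w))); rewrite // T2 // T0 // zw !t02C t2K t0K.
have [z1 z2] : (t0 w = z w \/ t0 w = z (t2 w)) /\ (t0 (t2 w) = z w \/ t0 (t2 w) = z (t2 w)).
  by case: zw => zw; split; rewrite ?T2 // zw ?t2K ?t02C; [left | right | right | left].
have cover (H : {group {perm flag M}}) : H \subset G -> x \in H -> y \in H -> z \in H ->
    forall u, exists2 h, h \in H & u = h w \/ u = h (t2 w).
  move=> sHG Hx Hy Hz u; have HG h : h \in H -> h \in G := subsetP sHG h.
  suff : [exists h : {perm flag M}, (h \in H) && ((u == h w) || (u == h (t2 w)))].
    by case/existsP => h /andP[Hh /orP[] /eqP uE]; exists h => //; [left | right].
  pose P u := [exists h : {perm flag M}, (h \in H) && ((u == h w) || (u == h (t2 w)))].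
  have PI h v : h \in H -> v = h w \/ v = h (t2 w) -> P v.
    by move=> Hh [] ->; apply/existsP; exists h; rewrite Hh eqxx ?orbT.
  apply: (closed_all (P := P) (w := w)); first by apply: (PI 1); rewrite // perm1; left.
  move=> v /existsP[h /andP[Hh]]; have Gh := HG h Hh.
  case/orP=> /eqP ->; split.
  - apply: (PI (z * h)); rewrite ?groupM // !permM -T0 //.
    by case: z1 => ->; [left | right].
  - by apply: (PI (x * h)); rewrite ?groupM // permM xw T1 //; left.
  - by apply: (PI h) => //; right; rewrite T2.
  - apply: (PI (z * h)); rewrite ?groupM // !permM -T0 //.
    by case: z2 => ->; [left | right].
  - by apply: (PI (y * h)); rewrite ?groupM // !permM yw T1 //; right.
  by apply: (PI h) => //; left; rewrite -T2 // t2K.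
have genG : G = <<[set x; y; z]>> :> {set {perm flag M}}.
  have sG : <<[set x; y; z]>> \subset G by rewrite gen_subG !subUset !sub1set Gx Gy.
  apply/eqP; rewrite eqEsubset sG andbT; apply/subsetP => g Gg.
  have genX u : u \in [set x; y; z] -> u \in <<[set x; y; z]>> by apply: mem_gen.
  have [||| h Hh hg] := cover <<[set x; y; z]>>%G sG _ _ _ (g w);
    try by apply: genX; rewrite !inE eqxx ?orbT.
  by rewrite (same_arc autG arcG (subsetP sG h Hh) Gg hg).
have ixy : 3 <= #|G : <<[set x; y]>>|.
  apply: leq_trans V3 _; pose phi (C : {set {perm flag M}}) := fv (repr C w).
  apply: leq_trans (leq_imset_card phi (rcosets <<[set x; y]>> G)).
  rewrite -cardsT; apply/subset_leq_card/subsetP => v _; have [u /eqP <-] := fv_surj v.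
  have [g Gg gu] := cover G (subxx _) Gx Gy Gz u.
  have -> : fv u = fv (g w) by case: gu => ->; rewrite ?T2 ?fv_t2.
  apply/imsetP; exists (<<[set x; y]>> :* g); first by rewrite mem_rcosets mulSGid ?gen_subG ?subUset ?sub1set ?Gx.
  have /rcosetP[h Hh hE] := mem_repr_rcoset <<[set x; y]>>%G g.
  rewrite /phi hE permM -!(@vactE _ g) ?(subsetP autG) //; congr (vact _ g).
  have : <<[set x; y]>> \subset [set k in G | fv (k w) == fv w].
    apply: gen_lmul_sub => [|c k xy_c]; first by rewrite inE group1 perm1 eqxx.
    rewrite !inE => /andP[Gk /eqP vk].
    have [Gc vc] : c \in G /\ fv (c w) = fv w.
      move: xy_c; rewrite !inE => /orP[] /eqP ->; first by rewrite xw fv_t1.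
      by rewrite -[fv (y w)]fv_t2 -T2 // yw fv_t1 fv_t2.
    by rewrite groupM // permM -(@vactE _ k) ?(subsetP autG) // vc vactE ?(subsetP autG) // vk eqxx.
  by move/subsetP/(_ h Hh); rewrite inE => /andP[_ /eqP].
pose t := ARTriple ox oy oz genG ixy; exists t.
pose phi (a : cm_flag G) : flag M := sgval a.1 (if a.2 then w else t2 w).
have Ga (g : subg_of G) : sgval g \in G := subgP g.
have phi_bij : bijective phi.
  apply: inj_card_bij.
    move=> [g b] [h c]; rewrite /phi /=; case: b; case: c => /= E.
    - by congr (_, _); apply/val_inj/(same_arc autG arcG (Ga h) (Ga g) (w := w)); left.
    - have gh := same_arc autG arcG (Ga h) (Ga g) (or_intror E).
      by have := t2_fpf w; rewrite -(inj_eq (@perm_inj _ (sgval h))) -E gh eqxx.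
    - have gh := same_arc autG arcG (Ga g) (Ga h) (or_intror (esym E)).
      by have := t2_fpf w; rewrite -(inj_eq (@perm_inj _ (sgval g))) E gh eqxx.
    by congr (_, _); apply/val_inj/(same_arc autG arcG (Ga h) (Ga g) (w := t2 w)); left.
  rewrite -!cardsT; apply: leq_trans (leq_imset_card phi [set: cm_flag G]).
  apply/subset_leq_card/subsetP => u _.
  have [g Gg [-> | ->]] := cover G (subxx _) Gx Gy Gz u; apply/imsetP.
    by exists (subg G g, true); rewrite // /phi /= subgK.
  by exists (subg G g, false); rewrite // /phi /= subgK.
have mulE u (g : subg_of G) v : u \in G -> sgval (cm_lmul u g) v = sgval g (u v).
  by move=> Gu; rewrite cm_lmulE // permM.
have P1 a : phi (@cm_t1 _ _ t a) = t1 (phi a).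
  case: a => g []; rewrite /phi /= -T1 //; first by rewrite -xw -mulE.
  by rewrite -yw -mulE.
have P2 a : phi (cm_t2 a) = t2 (phi a).
  by case: a => g []; rewrite /phi /= -T2 // t2K.
case: zw => zw; [left | right]; apply: map_iso_sym; exists phi; split=> // -[g b].
  have zw2 : z (t2 w) = t0 (t2 w) by rewrite T2 // zw t02C.
  by case: b; rewrite /phi /= mulE // ?zw ?zw2 T0.
have zw2 : z (t2 w) = t0 w by rewrite T2 // zw t2K.
by case: b; rewrite /phi /= mulE // ?zw2 ?zw -?t02C T0.
Qed.

(** * The classification *)

Theorem theorem1p2 (M : surface_map) (G : {group {perm flag M}}) :
  vertex_reversing G ->
  solvable G ->
  (3 <= #|vertex M|)%N ->
  (3 <= #|face M|)%N ->
  (gcdz (euler_char M) #|edge M|%:Z = 1)%R ->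
  (exists n : nat,
    [/\ is_dihedral G n,
        bireversing_map M G &
        exists (j k : int) (d : nat),
          [/\ (gcdz (gcdz j k) n%:Z = 1)%R,
              (gcdz j n%:Z = d%:Z)%R /\ (3 <= d)%N,
              mg_iso (underlying_graph M) (multiple (cycle_graph d) (n %/ d)),
              euler_char M = (gcdz j n%:Z + gcdz (2 * k - j) n%:Z - n%:Z)%R &
              orientable M <->
                (gcdz (gcdz j (2 * k)) n%:Z = 2)%R]])
  \/
  (reversing_map M G /\
    ((exists n : nat,
        [/\ is_dihedral G n, ~~ odd n,
            mg_iso (underlying_graph M) (multiple (cycle_graph n./2) 2),
            euler_char M = 1%R &
            ~ orientable M]) \/
     (exists (n : nat) (j k : int) (d : nat),
        [/\ is_dihedral G n /\ (gcdz (gcdz j k) n%:Z = 1)%R,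
            (gcdz j n%:Z = d%:Z)%R /\ (3 <= d)%N,
            mg_iso (underlying_graph M) (multiple (cycle_graph d) (n %/ d)),
            euler_char M =
              (gcdz j n%:Z + gcdz k n%:Z + gcdz (j - k) n%:Z - n%:Z)%R &
            orientable M]) \/
     (exists m n : nat,
        [/\ [/\ (1 < m)%N, (1 < n)%N, odd m, odd n & coprime m n],
            G \isog [set: ('D_(2 * m)%N * 'D_(2 * n)%N)%type],
            mg_iso (underlying_graph M) (multiple (cycle_graph m) (2 * n)%N) \/
            mg_iso (underlying_graph M)
              (multiple (sg_direct (cycle_graph m) (cycle_graph n)) 1),
            euler_char M = (m%:Z + n%:Z - (m * n)%N%:Z)%R &
            ~ orientable M]) \/
     (exists m n l : nat,
        [/\ [/\ (1 < m)%N, (1 < n)%N & (1 < l)%N] /\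
              [/\ odd m, odd n & odd l] /\
              [/\ coprime m n, coprime m l & coprime n l],
            exists A B : {group {perm flag M}},
              [/\ A ><| B = G, A \isog Zp (m * n * l)%N &
                  B \isog [set: ('Z_2 * 'Z_2)%type]],
            mg_iso (underlying_graph M)
              (multiple (sg_direct (cycle_graph m) (cycle_graph n)) l),
            euler_char M = ((m * n)%N%:Z + (m * l)%N%:Z + (n * l)%N%:Z
                              - (2 * m * n * l)%N%:Z)%R &
            ~ orientable M]) \/
     (exists f s : nat,
        [/\ (1 <= s)%N /\ coprime 6 s,
            exists A : {group {perm flag M}},
              [/\ A <| G, A \isog Zp (3 ^ f * s)%N &
                  (G / A) \isog [set: 'S_4]],
            [\/ mg_iso (underlying_graph M)
                  (multiple (complete_graph 4) (2 * 3 ^ f * s)%N),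
                mg_iso (underlying_graph M)
                  (multiple (sg_lex (cycle_graph (3 ^ f.+1 * s)%N)
                                         (edgeless_graph 2)) 1)
              | mg_iso (underlying_graph M)
                  (multiple (cycle_graph (3 ^ f.+1 * s)%N) 4)],
            euler_char M = (4 - (3 ^ f.+1 * s)%N%:Z)%R &
            ~ orientable M]))).
Proof.
move=> vrG solG V3 F3 gcd1.
have [t [iso | iso]] := vertex_reversing_coset_map vrG V3 F3; have := map_iso_invariants iso;
  case=> gI chiE orE edgeE _.
  right; split; first by exists t.
  have co : coprime (#|G : <<[set tx t; ty t]>>| + #|G : <<[set tx t; tz t]>>|
      + #|G : <<[set ty t; tz t]>>|) #|G|./2.
    apply: coprime_of_gcdz; rewrite -euler_RevMap -chiE -(card_half t).
    by rewrite -(card_rcoset_type G <<[set tz t]>>) -[in X in _ = X]gcd1 edgeE.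
  change (reversing_type G (underlying_graph M) (euler_char M) (orientable M)).
  rewrite chiE euler_RevMap.
  exact: reversing_type_iso (mg_iso_trans gI (RevMap_graph t)) orE (RevMap_type solG co).
left; have co : coprime (#|G : <<[set tx t; ty t]>>| + #|G : <<[set tx t; ty t ^ tz t]>>|) #|G|./2.
  apply: coprime_of_gcdz; rewrite -euler_BiRevMap -chiE -(card_half t).
  by rewrite -(card_rcoset_type G <<[set tz t]>>) -[in X in _ = X]gcd1 edgeE.
have [n [dG [j [k [d [jk1 jd gammaE chiE' or']]]]]] := BiRevMap_type solG co.
exists n; split=> //; first by exists t.
exists j, k, d; split=> //.
- exact: mg_iso_trans (mg_iso_trans gI (BiRevMap_graph t)) gammaE.
- by rewrite chiE euler_BiRevMap.
by rewrite orE.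
Qed.
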